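(* Let $(X_t)_{t\in\mathbb{Z}}$ be a strictly stationary sequence of random variables with $\mathbb{E}X_0=0$, $\mathbb{E}X_0^2<\infty$, $\sigma_n\to\infty$ and $\rho(n)\to0$ as $n\to\infty$. Let $\alpha>0$ and $\beta<1$. Assume that at least one of the following conditions (a), (b) holds: (a) $\mathbb{E}\big[X_0^2(\log^+\log^+|X_0|)^{2\alpha}\big]<\infty$ and $\rho(n)\le\alpha(\log n)^{-1}(\log\log n)^{-1}$ for every $n$ sufficiently large; (b) $\mathbb{E}\Big[X_0^2\exp\Big(\dfrac{2\alpha\,(\log^+\log^+|X_0|)^{1-\beta}}{1-\beta}\Big)\Big]<\infty$ and $\rho(n)\le\alpha(\log n)^{-1}(\log\log n)^{-\beta}$ for every $n$ sufficiently large. Then $S_n/\sigma_n$ converges in distribution to the standard normal law $N(0,1)$ as $n\to\infty$.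
   Context: Notation: $\log$ is the logarithm to base $2$, $\log^+x=\log(x\vee1)$, and $\exp$ is the natural exponential. For a strictly stationary sequence $(X_t)_{t\in\mathbb{Z}}$ on a probability space, $S_n=\sum_{i=1}^n X_i$, $\sigma_n^2=\mathrm{var}(S_n)$ ($\sigma_n\ge 0$), $\mathcal{F}_m^n$ is the $\sigma$-field generated by $(X_t)_{m\le t\le n}$ for $-\infty\le m\le n\le\infty$, and the mixing coefficient is $$\rho(n)=\sup\{|\mathrm{corr}(f,g)|: f\in L_2(\mathcal{F}_{-\infty}^0),\ g\in L_2(\mathcal{F}_n^\infty)\}.$$ *)

(* Defs.v *)
From HB Require Import structures.
From mathcomp Require Import all_boot all_order all_algebra.
From mathcomp Require Import all_classical all_reals all_analysis.
From mathcomp Require Import measurable_realfun.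

Set Implicit Arguments.
Unset Strict Implicit.
Unset Printing Implicit Defensive.

Import Order.TTheory GRing.Theory Num.Theory.
Import numFieldNormedType.Exports.

Local Open Scope classical_set_scope.
Local Open Scope ring_scope.

Section logarithms.
Variable R : realType.
Implicit Types x : R.

Definition log2 x : R := ln x / ln 2.

Definition log2p x : R := log2 (Num.max x 1).

End logarithms.

Section stationary_processes.
Context {d : measure_display} {T : measurableType d} {R : realType}
  (P : probability T R).
Implicit Types X : int -> {RV P >-> R}.

(* Equality of the joint laws as measures on the product sigma-algebra of
   [k.-tuple R]. *)
Definition strictly_stationary X :=
  forall (k : nat) (t : 'I_k -> int) (h : int) (A : set (k.-tuple R)),
    measurable A ->
    P ((fun w => [tuple X (t i + h) w | i < k]) @^-1` A) =
    P ((fun w => [tuple X (t i) w | i < k]) @^-1` A).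

Definition process_sigma X (I : set int) : set (set T) :=
  <<s \bigcup_(t in I) preimage_set_system setT (X t) measurable >>.

(* [L2 F] consists of functions, not of classes modulo a.e. equality; [Lfun]
   alone would only require measurability for the ambient sigma-algebra. *)
Definition L2 (F : set (set T)) : set (T -> R) :=
  [set f | preimage_set_system setT f measurable `<=` F /\ f \in Lfun P 2%:E].

(* Since [0^-1 = 0], [corr f g = 0] if [f] or [g] is a.s. constant; such pairs
   do not change the supremum defining [rho]. *)
Definition corr (f g : T -> R) : R :=
  fine (covariance P f g) /
  (Num.sqrt (fine 'V_P[f]) * Num.sqrt (fine 'V_P[g])).

Definition rho X (n : nat) : \bar R :=
  ereal_sup [set r | exists f g : T -> R,
    [/\ L2 (process_sigma X [set t | t <= 0]) f,
        L2 (process_sigma X [set t | n%:Z <= t]) g &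
        r = `|corr f g|%:E ] ].

Definition partial_sum X (n : nat) : {RV P >-> R} :=
  \sum_(1 <= i < n.+1) (X i%:Z : {mfun T >-> R}).

Definition sigma X (n : nat) : R := Num.sqrt (fine 'V_P[partial_sum X n]).

(* Convergence of the distribution functions at every continuity point of the
   limit distribution function. *)
Definition cvg_in_distribution (Y : nat -> {RV P >-> R})
    (mu : probability (measurableTypeR R) R) :=
  forall x : R, {for x, continuous (fun r : R => mu `]-oo, r]%classic)} ->
    cdf (Y n) x @[n --> \oo] --> mu `]-oo, x]%classic.

End stationary_processes.

Arguments cvg_in_distribution {d T R} P Y mu.

(* Main.v *)
(* Write v_m = E S_m^2 and S_m(f) for the partial sums of f(X_t).  Comparing
   S_(2m) with two copies of S_m separated by a gap of length m^(4/5) shows that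
   v_(2^i) lies between 2^i times exp (-1.01 R_i) and 2^i times exp (R_i), up to
   constants, where R_i is the sum over j < i of rho (2^(4j/5)).  The upper bound
   holds for every centered f(X_0), with a constant proportional to its variance.
   Truncate X_0 at the level (11/10)^i.  The rate on rho bounds exp (2.01 R_i) by a
   multiple of the moment weight at that level, so the moment condition makes the
   sums of the high part negligible in L^2 compared with v_(2^i); for the low part
   a recursion over doublings gives E S^4 = O(v_(2^i)^2).
   For n = k 2^i + r with k large but bounded, second-order Taylor expansions
   of E cos and E sin over one block, and decorrelation over the k blocks, give
   E cos (t S_n / sigma_n - c) -> exp (-t^2/2) cos c.
   Products of such cosines are combinations of such cosines, so the convergence
   extends to polynomials in one of them.  Let u be an affine function of
   cos (w x - c) with values in [0, 1], increasing on [-K, K]; the polynomials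
   (1 - (s u)^n)^N are close to 1 left of a and close to 0 right of b > a.  With
   Chebyshev's inequality outside [-K, K] this gives convergence of the
   distribution functions. *)
Require Import Defs.
From HB Require Import structures.
From mathcomp Require Import all_boot all_order all_algebra.
From mathcomp Require Import all_classical all_reals all_analysis.
From mathcomp Require Import measurable_realfun.
From mathcomp Require Import ring lra zify.

Set Implicit Arguments.
Unset Strict Implicit.
Unset Printing Implicit Defensive.

Import Order.TTheory GRing.Theory Num.Theory.
Import numFieldNormedType.Exports.

Local Open Scope classical_set_scope.
Local Open Scope ring_scope.

(** * Expectations *)

Section expectation.
Context {d : measure_display} {T : measurableType d} {R : realType}
  (P : probability T R).
Implicit Types f g h : T -> R.

(** The variance bounds lose a factor exp R_i upwards and almost as much downwards, and the moment
    weight, whose exponent has coefficient exactly 2 alpha, must pay for both. The room for this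
    comes from the base of the logarithm: summing the rate along powers of two gives R_i of order
    (5/4) ln 2 * alpha * G (log i) for a primitive G of y^(-beta), and (5/4) ln 2 < 1. This ties
    down the gap exponent 4/5: a much shorter gap exhausts the room, a much longer one is not
    negligible against the block. The remaining numerical constants share out the same slack. The
    rate and the stronger moment enter only through the smallness of exp (2.01 R_i) times the
    truncated tail. In the last stage the number k of blocks is bounded before i tends to infinity,
    so a gap of fixed length q with rho (q) small suffices there. Cosines with an arbitrary phase
    replace complex exponentials: by the addition formula, appending a block maps the expectation of
    such a cosine to a multiple of itself, up to an error governed by the expected sine of one
    block. *)

Definition rint f := P.-integrable [set: T] (EFin \o f).

(** [Rintegral] takes the value 0 when the integral is infinite. Positivity therefore holds without
    integrability, while linearity and monotonicity require it. *)
Definition Ex f : R := \int[P]_x f x.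

Definition sqint f := measurable_fun [set: T] f /\ rint (fun w => f w ^+ 2).

Lemma rint_measurable f : rint f -> measurable_fun [set: T] f.
Proof. by move=> /integrableP[/measurable_EFinP]. Qed.

Lemma rint_le f g : measurable_fun [set: T] f -> rint g ->
  (forall w, `|f w| <= g w) -> rint f.
Proof.
move=> mf ig fg; apply: (le_integrable _ _ _ ig) => //.
- exact/measurable_EFinP.
- by move=> w _ /=; rewrite lee_fin (le_trans (fg w)) ?ler_norm.
Qed.

Lemma rint_cst (c : R) : rint (fun=> c).
Proof. by apply: finite_measure_integrable_cst. Qed.

Lemma rint_bounded f (c : R) : measurable_fun [set: T] f ->
  (forall w, `|f w| <= c) -> rint f.
Proof. by move=> mf /(rint_le mf (rint_cst c)). Qed.

Lemma rintD f g : rint f -> rint g -> rint (fun w => f w + g w).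
Proof. by move=> If Ig; exact: (integrableD _ If Ig). Qed.

Lemma rintZ (c : R) f : rint f -> rint (fun w => c * f w).
Proof. by move=> If; exact: (integrableZl _ _ If). Qed.

Lemma rintN f : rint f -> rint (fun w => - f w).
Proof. by move=> /(rintZ (-1)); under eq_fun do rewrite mulN1r. Qed.

Lemma rintB f g : rint f -> rint g -> rint (fun w => f w - g w).
Proof. by move=> If /rintN; exact: rintD. Qed.

Lemma rint_norm f : rint f -> rint (fun w => `|f w|).
Proof. by move=> If; exact: (integrable_abse If). Qed.

Lemma ExD f g : rint f -> rint g -> Ex (fun w => f w + g w) = Ex f + Ex g.
Proof. by move=> If Ig; exact: RintegralD. Qed.

Lemma ExZ (c : R) f : rint f -> Ex (fun w => c * f w) = c * Ex f.
Proof. by move=> If; exact: RintegralZl. Qed.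

Lemma ExB f g : rint f -> rint g -> Ex (fun w => f w - g w) = Ex f - Ex g.
Proof. by move=> If Ig; exact: RintegralB. Qed.

Lemma Ex_cst (c : R) : Ex (fun=> c) = c.
Proof. by rewrite /Ex Rintegral_cst//; have /= -> := probability_setT P; rewrite mulr1. Qed.

Lemma Ex_le f g : rint f -> rint g -> (forall w, f w <= g w) -> Ex f <= Ex g.
Proof. by move=> If Ig fg; apply: le_Rintegral. Qed.

Lemma Ex_ge0 f : (forall w, 0 <= f w) -> 0 <= Ex f.
Proof. by move=> f0; apply: Rintegral_ge0. Qed.

Lemma Ex_norm f : rint f -> `|Ex f| <= Ex (fun w => `|f w|).
Proof. by move=> If; exact: le_normr_Rintegral. Qed.

Lemma Ex_norm_le f g : rint f -> rint g -> (forall w, `|f w| <= g w) ->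
  `|Ex f| <= Ex g.
Proof.
move=> If Ig fg; apply: (le_trans (Ex_norm If)).
by apply: Ex_le => //; exact: rint_norm.
Qed.

Lemma EFin_Ex f : rint f -> (Ex f)%:E = 'E_P[f]%E.
Proof. by move=> If; rewrite /Ex /Rintegral fineK ?unlock// integrable_fin_num. Qed.

Lemma rintM f g : sqint f -> sqint g -> rint (fun w => f w * g w).
Proof.
move=> [mf f2] [mg g2]; apply: (rint_le _ (rintD f2 g2)).
  exact: measurable_funM.
by move=> w; rewrite ler_norml; apply/andP; split; nra.
Qed.

Lemma sqintD f g : sqint f -> sqint g -> sqint (fun w => f w + g w).
Proof.
move=> sf sg; have [mf f2] := sf; have [mg g2] := sg.
split; first exact: measurable_funD.
apply: (rint_le _ (rintZ 2 (rintD f2 g2))).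
  by apply: measurable_funX; exact: measurable_funD.
move=> w; rewrite ger0_norm ?sqr_ge0//.
have := sqr_ge0 (f w - g w); nra.
Qed.

Lemma sqint_le f g : measurable_fun [set: T] f -> sqint g ->
  (forall w, `|f w| <= `|g w|) -> sqint f.
Proof.
move=> mf [mg g2] fg; split=> //; apply: (rint_le _ g2).
  exact: measurable_funX.
move=> w; rewrite ger0_norm ?sqr_ge0// -(real_normK (num_real (f w))).
by rewrite -(real_normK (num_real (g w))) lerXn2r ?nnegrE.
Qed.

Lemma sqintZ (c : R) f : sqint f -> sqint (fun w => c * f w).
Proof.
move=> [mf f2]; split; first by apply: measurable_funM.
by under eq_fun do rewrite exprMn; exact: rintZ.
Qed.

Lemma sqint_cst (c : R) : sqint (fun=> c).
Proof. by split=> //; exact: rint_cst. Qed.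

Lemma sqint_bounded f (c : R) : measurable_fun [set: T] f ->
  (forall w, `|f w| <= c) -> sqint f.
Proof.
move=> mf fc; apply: (sqint_le mf (sqint_cst c)) => w.
by apply: (le_trans (fc w)); exact: ler_norm.
Qed.

Lemma sqintB f g : sqint f -> sqint g -> sqint (fun w => f w - g w).
Proof.
move=> sf /(sqintZ (-1)) sg; have := sqintD sf sg.
by under eq_fun do rewrite mulN1r.
Qed.

Lemma sqint_sum n (F : 'I_n -> T -> R) : (forall i, sqint (F i)) ->
  sqint (fun w => \sum_(i < n) F i w).
Proof.
elim: n F => [|n IH] F IF.
  by under eq_fun do rewrite big_ord0; exact: sqint_cst.
by under eq_fun do rewrite big_ord_recr /=; apply: sqintD => //; exact: IH.
Qed.

Lemma sqint_rint f : sqint f -> rint f.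
Proof.
by move=> sf; have := rintM sf (sqint_cst 1); under eq_fun do rewrite mulr1.
Qed.

(** The weight [th] stays free because [mom2_add] is later used with a weight decaying geometrically
    in the scale, which makes its relative errors summable. *)
Lemma Ex_weighted_AMGM f g (th : R) : sqint f -> sqint g -> 0 < th ->
  Ex (fun w => 2 * `|f w * g w|)
  <= th * Ex (fun w => f w ^+ 2) + th^-1 * Ex (fun w => g w ^+ 2).
Proof.
move=> sf sg th0; have [mf f2] := sf; have [mg g2] := sg.
rewrite -!ExZ// -ExD; [|exact: rintZ..].
apply: Ex_le.
- by apply: rintZ; apply: rint_norm; exact: rintM.
- by apply: rintD; exact: rintZ.
move=> w; rewrite normrM -(real_normK (num_real (f w))).
rewrite -(real_normK (num_real (g w))).
have : 0 <= th^-1 * (th * `|f w| - `|g w|) ^+ 2.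
  by rewrite mulr_ge0 ?sqr_ge0// invr_ge0 ltW.
rewrite sqrrB mulrDr mulrBr exprMn.
have -> : th^-1 * (th ^+ 2 * `|f w| ^+ 2) = th * `|f w| ^+ 2.
  by field; rewrite gt_eqF.
have -> : th^-1 * (th * `|f w| * `|g w| *+ 2) = 2 * (`|f w| * `|g w|).
  by field; rewrite gt_eqF.
lra.
Qed.

Lemma Ex_CauchySchwarz f g : sqint f -> sqint g ->
  Ex (fun w => f w * g w) ^+ 2
  <= Ex (fun w => f w ^+ 2) * Ex (fun w => g w ^+ 2).
Proof.
move=> sf sg; have [mf f2] := sf; have [mg g2] := sg.
set a := Ex (fun w => f w ^+ 2); set b := Ex (fun w => g w ^+ 2).
set c := Ex _.
have a0 : 0 <= a by apply: Ex_ge0 => w; exact: sqr_ge0.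
have b0 : 0 <= b by apply: Ex_ge0 => w; exact: sqr_ge0.
have K th : 0 < th -> 2 * `|c| <= th * a + th^-1 * b.
  move=> th0; apply: le_trans (Ex_weighted_AMGM sf sg th0).
  rewrite ExZ; last by apply: rint_norm; exact: rintM.
  by rewrite ler_pM2l//; apply: Ex_norm; exact: rintM.
rewrite -(real_normK (num_real c)).
(* The optimal weight is a ratio of the two norms, which may vanish. Adding [e] to both second
   moments makes the ratio legitimate; [e] is removed at the end. *)
have K2 e : 0 < e -> `|c| <= Num.sqrt (a + e) * Num.sqrt (b + e).
  move=> e0; have ae : 0 < a + e by lra.
  have be : 0 < b + e by lra.
  set x := Num.sqrt (a + e); set y := Num.sqrt (b + e).
  have x0 : 0 < x by rewrite sqrtr_gt0.
  have y0 : 0 < y by rewrite sqrtr_gt0.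
  have x2 : x ^+ 2 = a + e by rewrite sqr_sqrtr// ltW.
  have y2 : y ^+ 2 = b + e by rewrite sqr_sqrtr// ltW.
  have := K (y / x) (divr_gt0 y0 x0); rewrite invf_div.
  have h1 : y / x * a <= y / x * x ^+ 2.
    by rewrite ler_wpM2l// ?divr_ge0 ?ltW// x2; lra.
  have h2 : x / y * b <= x / y * y ^+ 2.
    by rewrite ler_wpM2l// ?divr_ge0 ?ltW// y2; lra.
  have -> : x * y = (y / x * x ^+ 2 + x / y * y ^+ 2) / 2.
    by field; rewrite !gt_eqF.
  lra.
apply/ler_addgt0Pl => e e0.
(* Since [h <= 1], the product (a + h)(b + h) exceeds ab by at most h (a + b + 1), hence by at most
   [e]. *)
set h := Num.min 1 (e / (a + b + 1)).
have abp : 0 < a + b + 1 by lra.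
have h0 : 0 < h by rewrite lt_min ltr01 divr_gt0.
have h1 : h <= 1 by rewrite ge_min lexx.
have h2 : h * (a + b + 1) <= e.
  by rewrite -ler_pdivlMr// ge_min lexx orbT.
have ae : 0 <= a + h by lra.
have be : 0 <= b + h by lra.
apply: (@le_trans _ _ ((Num.sqrt (a + h) * Num.sqrt (b + h)) ^+ 2)).
  by rewrite lerXn2r ?nnegrE ?normr_ge0 ?mulr_ge0 ?sqrtr_ge0 ?K2.
rewrite exprMn !sqr_sqrtr//; nra.
Qed.

Lemma Ex_norm_sqrt f : sqint f ->
  Ex (fun w => `|f w|) <= Num.sqrt (Ex (fun w => f w ^+ 2)).
Proof.
move=> sf.
have sn : sqint (fun w => `|f w|).
  apply: (sqint_le _ sf); last by move=> w; rewrite normr_id.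
  exact/measurableT_comp/(proj1 sf).
have := Ex_CauchySchwarz sn (sqint_cst 1).
have -> : (fun w => `|f w| * 1) = (fun w => `|f w|).
  by apply/funext => w; rewrite mulr1.
have -> : (fun w => `|f w| ^+ 2) = (fun w => f w ^+ 2).
  by apply/funext => w; rewrite real_normK ?num_real.
rewrite expr1n Ex_cst mulr1 => H.
by rewrite -[leLHS]ger0_norm ?Ex_ge0// -sqrtr_sqr ler_wsqrtr.
Qed.

Lemma sqint_Lfun f : sqint f -> f \in Lfun P 2%:E.
Proof.
move=> [mf f2]; rewrite inE; apply/andP; split; rewrite inE//=.
rewrite /finite_norm unlock /=; apply: poweR_lty.
have /integrableP[_] := f2; apply: le_lt_trans.
rewrite le_eqVlt; apply/orP; left; apply/eqP; apply: eq_integral => w _ /=.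
by rewrite powR_mulrn// normrX.
Qed.

Lemma Lfun_sqint f : f \in Lfun P 2%:E -> sqint f.
Proof.
move=> f2; split; last exact: Lfun2_integrable_sqr.
by move: f2; rewrite inE => /andP[+ _]; rewrite inE.
Qed.

Lemma covariance_Ex f g : sqint f -> sqint g ->
  fine (covariance P f g) = Ex (fun w => f w * g w) - Ex f * Ex g.
Proof.
move=> sf sg.
have lf : f \in Lfun P 1 by apply/Lfun1_integrable; exact: sqint_rint.
have lg : g \in Lfun P 1 by apply/Lfun1_integrable; exact: sqint_rint.
have lfg : (f * g) \in Lfun P 1 by apply/Lfun1_integrable; exact: rintM.
rewrite covarianceE// -(EFin_Ex (sqint_rint sf)) -(EFin_Ex (sqint_rint sg)).
have -> : 'E_P[f * g]%E = (Ex (fun w => f w * g w))%:E.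
  by rewrite EFin_Ex//; exact: rintM.
by [].
Qed.

Lemma variance_Ex f : sqint f ->
  fine 'V_P[f]%E = Ex (fun w => f w ^+ 2) - Ex f ^+ 2.
Proof. by move=> sf; rewrite /variance covariance_Ex. Qed.

Lemma variance_Ex_center f g : sqint f -> sqint g ->
  Ex (fun w => (f w - Ex f) * (g w - Ex g))
  = Ex (fun w => f w * g w) - Ex f * Ex g.
Proof.
move=> sf sg.
have If := sqint_rint sf; have Ig := sqint_rint sg; have Ifg := rintM sf sg.
have -> : (fun w => (f w - Ex f) * (g w - Ex g)) =
    (fun w => (f w * g w - Ex g * f w) - (Ex f * g w - Ex f * Ex g)).
  by apply/funext => w; ring.
by rewrite !(ExB, ExZ, Ex_cst)//;
  rewrite ?[Ex g * Ex f]mulrC ?subrr ?subr0//;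
  do ?[apply: rintB|apply: rintZ|exact: rint_cst].
Qed.

End expectation.

(** * Block sums of a stationary sequence *)

Section block_sums.
Context {d : measure_display} {T : measurableType d} {R : realType}
  (P : probability T R).
Implicit Types (X : int -> {RV P >-> R}) (f g phi psi : R -> R).

Definition coords X k (t : 'I_k -> int) (w : T) : k.-tuple R :=
  [tuple X (t i) w | i < k].

Lemma measurable_coords X k (t : 'I_k -> int) :
  measurable_fun [set: T] (coords X t).
Proof.
apply/measurable_fun_tnthP => i.
apply: (eq_measurable_fun (X (t i))) => [w _ /=|]; last exact: measurable_funPT.
by rewrite tnth_mktuple.
Qed.

HB.instance Definition _ X k (t : 'I_k -> int) :=
  isMeasurableFun.Build _ _ _ _ (coords X t) (measurable_coords X t).

(** Both sides are integrals of [G] against the image laws of the coordinates, and strict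
    stationarity is the equality of these laws. *)
Lemma stationary_integral X k (t : 'I_k -> int) (h : int)
    (G : k.-tuple R -> \bar R) : strictly_stationary X ->
  measurable_fun setT G -> (forall x, 0 <= G x)%E ->
  (\int[P]_w G (coords X (fun i => (t i + h)%R) w) = \int[P]_w G (coords X t w))%E.
Proof.
move=> statX mG G0.
have E t' : (\int[P]_w G (coords X t' w) =
    \int[pushforward P (coords X t')]_y G y)%E.
  by rewrite (ge0_integral_pushforward (measurable_coords X t') P measurableT mG).
rewrite !E; apply: eq_measure_integral => A mA _; exact: statX.
Qed.

(** Positive and negative parts are transported separately, so integrability of [G] plays no part
    and later applications carry no side condition for it. *)
Lemma stationary_Ex X k (t : 'I_k -> int) (h : int) (G : k.-tuple R -> R) :
  strictly_stationary X -> measurable_fun setT G ->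
  Ex P (fun w => G (coords X (fun i => t i + h) w)) =
  Ex P (fun w => G (coords X t w)).
Proof.
move=> statX mG; rewrite /Ex /Rintegral; congr fine.
have mEG : measurable_fun setT (EFin \o G) by exact/measurable_EFinP.
have Ep t' : (\int[P]_w ((EFin \o G) \o coords X t')^\+ w =
    \int[P]_w (EFin \o G)^\+ (coords X t' w))%E by rewrite funepos_comp.
have En t' : (\int[P]_w ((EFin \o G) \o coords X t')^\- w =
    \int[P]_w (EFin \o G)^\- (coords X t' w))%E by rewrite funeneg_comp.
rewrite integralE [RHS]integralE; congr (_ - _)%E.
- apply: (etrans (Ep _)); apply: (etrans _ (esym (Ep _))).
  by apply: (@stationary_integral X k t h (EFin \o G)^\+%E) => //; exact: measurable_funepos.
- apply: (etrans (En _)); apply: (etrans _ (esym (En _))).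
  by apply: (@stationary_integral X k t h (EFin \o G)^\-%E) => //; exact: measurable_funeneg.
Qed.

(** The indices run from [a + 1] to [a + m]: blocks starting at [a] and at [a + m] are adjacent, and
    [bsum X id 0 n] is S_n. *)
Definition bsum X f (a : int) (m : nat) (w : T) : R :=
  \sum_(j < m) f (X (a + j.+1%:Z) w).

Lemma measurable_bsum X f a m : measurable_fun setT f ->
  measurable_fun setT (bsum X f a m).
Proof. by move=> mf; apply: measurable_sum => j; exact: measurableT_comp. Qed.

Lemma bsum_add X f a m p w :
  bsum X f a (m + p) w = bsum X f a m w + bsum X f (a + m%:Z) p w.
Proof.
rewrite /bsum big_split_ord /=; congr (_ + _); apply: eq_bigr => j _.
by congr (f (X _ w)); rewrite -addrA -PoszD addnS.
Qed.

Lemma bsum0 X f a w : bsum X f a 0 w = 0.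
Proof. by rewrite /bsum big_ord0. Qed.

Lemma norm_bsum_le X f a m (c : R) w : (forall x, `|f x| <= c) ->
  `|bsum X f a m w| <= m%:R * c.
Proof.
move=> fc; apply: (le_trans (ler_norm_sum _ _ _)).
rewrite -[X in X%:R * _](card_ord m) -sum1_card natr_sum mulr_suml.
by apply: ler_sum => j _; rewrite mul1r.
Qed.

Lemma rint_bsum_expn X f a m k (c : R) : measurable_fun setT f ->
  (forall x, `|f x| <= c) -> rint P (fun w => bsum X f a m w ^+ k).
Proof.
move=> mf fc; apply: (@rint_bounded _ _ _ P _ ((m%:R * c) ^+ k)).
  by apply: measurable_funX; exact: measurable_bsum.
move=> w; have h := norm_bsum_le X a m w fc.
by rewrite normrX lerXn2r ?nnegrE//; exact: le_trans h.
Qed.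

Lemma stationary_bsum2 X f g (a : int) m (b : int) p (h : int) (G : R -> R -> R) :
  strictly_stationary X -> measurable_fun setT f -> measurable_fun setT g ->
  measurable_fun setT (fun z : R * R => G z.1 z.2) ->
  Ex P (fun w => G (bsum X f (a + h) m w) (bsum X g (b + h) p w)) =
  Ex P (fun w => G (bsum X f a m w) (bsum X g b p w)).
Proof.
move=> statX mf mg mG.
(* A single finite family of times lists both blocks, so that stationarity of the finite-dimensional
   laws applies to the pair of block sums. *)
pose t (i : 'I_(m + p)) : int :=
  match fintype.split i with inl j => a + j.+1%:Z | inr j => b + j.+1%:Z end.
pose F (x : (m + p).-tuple R) := G (\sum_(j < m) f (tnth x (lshift p j)))
  (\sum_(j < p) g (tnth x (rshift m j))).
have mF : measurable_fun setT F.
  have mFp : measurable_fun setT (fun x : (m + p).-tuple R =>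
      (\sum_(j < m) f (tnth x (lshift p j)), \sum_(j < p) g (tnth x (rshift m j)))).
    apply: measurable_fun_pair => /=; apply: measurable_sum => j;
      exact: (measurableT_comp _ (measurable_tnth _)).
  exact: (measurableT_comp mG mFp).
have E h' w : F (coords X (fun i => t i + h') w) =
    G (bsum X f (a + h') m w) (bsum X g (b + h') p w).
  rewrite /F /bsum; congr (G _ _); apply: eq_bigr => j _.
    rewrite tnth_mktuple /t; case: split_ordP => k.
      by move/lshift_inj => <-; congr (f (X _ w)); ring.
    by move/eqP; rewrite eq_lrshift.
  rewrite tnth_mktuple /t; case: split_ordP => k.
    by move/eqP; rewrite eq_rlshift.
  by move/rshift_inj => <-; congr (g (X _ w)); ring.
have := stationary_Ex t h statX mF.
rewrite (_ : (fun w => F _) =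
  fun w => G (bsum X f (a + h) m w) (bsum X g (b + h) p w)); last exact/funext.
move=> ->; congr Ex; apply/funext => w; have := E 0 w.
rewrite !addr0 => <-; congr F; congr coords.
by apply/funext => i; rewrite addr0.
Qed.

Lemma stationary_bsum X f a m (phi : R -> R) :
  strictly_stationary X -> measurable_fun setT f ->
  measurable_fun setT phi ->
  Ex P (fun w => phi (bsum X f a m w)) = Ex P (fun w => phi (bsum X f 0 m w)).
Proof.
move=> statX mf mphi.
have := @stationary_bsum2 X f f 0 m 0 0 a (fun x _ => phi x) statX mf mf.
by rewrite !add0r; apply; exact: measurableT_comp.
Qed.


Lemma sqint_stationary X f t : strictly_stationary X -> measurable_fun setT f ->
  sqint P (fun w => f (X 0 w)) -> sqint P (fun w => f (X t w)).
Proof.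
move=> statX mf [mf0 /integrableP[_ If0]]; split; first exact: measurableT_comp.
apply/integrableP; split.
  by apply/measurable_EFinP/measurable_funX; exact: measurableT_comp.
(* Finiteness of the integral is what has to be transported, hence the extended-real version of
   stationarity, applied to the nonnegative integrand. *)
pose G (x : 1.-tuple R) : \bar R := `|(f (tnth x ord0) ^+ 2)%:E|%E.
have mG : measurable_fun setT G.
  apply: measurableT_comp => //; apply/measurable_EFinP/measurable_funX.
  exact: (measurableT_comp mf (measurable_tnth _)).
have G0 x : (0 <= G x)%E by exact: abse_ge0.
have := stationary_integral (fun=> 0) t statX mG G0.
under eq_integral do rewrite /G tnth_mktuple add0r.
under [in X in _ = X]eq_integral do rewrite /G tnth_mktuple.
by move=> /= ->.
Qed.

Lemma sqint_bsum X f a m : (forall t, sqint P (fun w => f (X t w))) ->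
  sqint P (bsum X f a m).
Proof. by move=> sf; apply: sqint_sum => j; exact: sf. Qed.

Lemma process_sigma_bsum X f (I : set int) a m phi :
  measurable_fun setT f -> measurable_fun setT phi ->
  (forall j, (j < m)%N -> I (a + j.+1%:Z)) ->
  preimage_set_system setT (fun w => phi (bsum X f a m w)) measurable
    `<=` process_sigma X I.
Proof.
move=> mf mphi aI.
(* Measurability is checked on [T] equipped with the sigma-algebra generated by [G], where the
   closure lemmas for measurable functions apply directly. *)
pose G : set (set T) := \bigcup_(t in I) preimage_set_system setT (X t) measurable.
have mXt t : I t ->
    measurable_fun [set: g_sigma_algebraType G] (X t : g_sigma_algebraType G -> R).
  move=> It _ A mA; apply: sub_sigma_algebra; exists t => //.
  by exists A => //; rewrite setTI.
have mb : measurable_fun [set: g_sigma_algebraType G]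
    ((fun w => phi (bsum X f a m w)) : g_sigma_algebraType G -> R).
  apply: (measurableT_comp mphi).
  apply: measurable_sum => j; apply: (measurableT_comp mf).
  by apply: mXt; exact: aI.
by move=> _ [A mA <-]; exact: (mb measurableT A mA).
Qed.

Lemma Ex_cov_rho X n (r : R) F H : (rho X n <= r%:E)%E ->
  L2 P (process_sigma X [set t | t <= 0]) F ->
  L2 P (process_sigma X [set t | n%:Z <= t]) H ->
  `|Ex P (fun w => F w * H w) - Ex P F * Ex P H|
  <= r * (Num.sqrt (Ex P (fun w => F w ^+ 2)) * Num.sqrt (Ex P (fun w => H w ^+ 2))).
Proof.
move=> rr LF LH.
have sF := Lfun_sqint (proj2 LF); have sH := Lfun_sqint (proj2 LH).
have : (`|corr P F H|%:E <= r%:E)%E.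
  by apply: le_trans rr; apply: ereal_sup_ubound; exists F, H; split.
rewrite lee_fin /corr covariance_Ex// !variance_Ex//.
set c := Ex P _ - _; set vF := _ - Ex P F ^+ 2; set vH := _ - Ex P H ^+ 2.
move=> cr; have r0 : 0 <= r by apply: le_trans cr.
have sqE G : sqint P G -> Ex P (fun w => G w ^+ 2) - Ex P G ^+ 2 =
    Ex P (fun w => (G w - Ex P G) ^+ 2).
  move=> sG; rewrite expr2 -[X in X - _]/(Ex P (fun w => G w * G w)).
  by rewrite -variance_Ex_center.
have c2 : c ^+ 2 <= vF * vH.
  rewrite /c /vF /vH -variance_Ex_center// !sqE//.
  by apply: Ex_CauchySchwarz; apply: sqintB => //; exact: sqint_cst.
have vF0 : 0 <= vF by rewrite /vF sqE//; apply: Ex_ge0 => w; exact: sqr_ge0.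
have vH0 : 0 <= vH by rewrite /vH sqE//; apply: Ex_ge0 => w; exact: sqr_ge0.
have sle : Num.sqrt vF * Num.sqrt vH <=
    Num.sqrt (Ex P (fun w => F w ^+ 2)) * Num.sqrt (Ex P (fun w => H w ^+ 2)).
  by apply: ler_pM; rewrite ?sqrtr_ge0// ler_wsqrtr// /vF /vH gerBl sqr_ge0.
apply: le_trans (ler_wpM2l r0 sle).
move: cr; set s := Num.sqrt vF * Num.sqrt vH => cr.
have s0 : 0 <= s by rewrite mulr_ge0 ?sqrtr_ge0.
(* When a variance vanishes, [corr] is 0 by the convention on division and gives no information;
   Cauchy-Schwarz then forces the covariance [c] to vanish. *)
have [s00|sn] := eqVneq s 0.
  have : c ^+ 2 <= 0.
    apply: (le_trans c2); rewrite -(sqr_sqrtr vF0) -(sqr_sqrtr vH0) -exprMn.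
    by rewrite -/s s00 expr0n.
  by rewrite exprn_even_le0//= => /eqP ->; rewrite normr0 mulr_ge0.
have sp : 0 < s by rewrite lt_def sn.
by rewrite -ler_pdivrMr// -[X in _ / X <= _](gtr0_norm sp) -normf_div.
Qed.

Lemma bsum_cov X f g (a : int) m (b : int) p phi psi n (r : R) :
  strictly_stationary X ->
  measurable_fun setT f -> measurable_fun setT g ->
  measurable_fun setT phi -> measurable_fun setT psi ->
  (forall c, sqint P (fun w => phi (bsum X f c m w))) ->
  (forall c, sqint P (fun w => psi (bsum X g c p w))) ->
  a + m%:Z + n%:Z <= b -> (rho X n <= r%:E)%E ->
  `|Ex P (fun w => phi (bsum X f a m w) * psi (bsum X g b p w)) -
    Ex P (fun w => phi (bsum X f a m w)) * Ex P (fun w => psi (bsum X g b p w))|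
  <= r * (Num.sqrt (Ex P (fun w => phi (bsum X f a m w) ^+ 2)) *
          Num.sqrt (Ex P (fun w => psi (bsum X g b p w) ^+ 2))).
Proof.
move=> statX mf mg mphi mpsi sphi spsi amb rr.
(* [rho] compares the past up to time 0 with the future from time [n]; this shift makes the left
   block end at 0. *)
pose h : int := - (a + m%:Z).
have S (G : R -> R -> R) : measurable_fun setT (fun z : R * R => G z.1 z.2) ->
  Ex P (fun w => G (bsum X f a m w) (bsum X g b p w)) =
  Ex P (fun w => G (bsum X f (a + h) m w) (bsum X g (b + h) p w)).
  by move=> mG; rewrite -(stationary_bsum2 a m b p h statX mf mg mG).
have m1 (u : R -> R) : measurable_fun setT u ->
    measurable_fun setT (fun z : R * R => u z.1).
  by move=> mu; exact: measurableT_comp.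
have m2 (u : R -> R) : measurable_fun setT u ->
    measurable_fun setT (fun z : R * R => u z.2).
  by move=> mu; exact: measurableT_comp.
rewrite (S (fun x y => phi x * psi y)); last by apply: measurable_funM; auto.
rewrite (S (fun x y => phi x)); last exact: m1.
rewrite (S (fun x y => psi y)); last exact: m2.
rewrite (S (fun x y => phi x ^+ 2)); last by apply: measurable_funX; exact: m1.
rewrite (S (fun x y => psi y ^+ 2)); last by apply: measurable_funX; exact: m2.
apply: (Ex_cov_rho rr); split.
- apply: process_sigma_bsum => // j jm; rewrite /= /h; lia.
- apply: sqint_Lfun; exact: sphi.
- apply: process_sigma_bsum => // j jm; rewrite /= /h; lia.
- apply: sqint_Lfun; exact: spsi.
Qed.

End block_sums.

(** * Growth of second and fourth moments *)

Section moments.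
Context {d : measure_display} {T : measurableType d} {R : realType}
  (P : probability T R) (X : int -> {RV P >-> R}).
Hypothesis statX : strictly_stationary X.
Implicit Types (f : R -> R).

Definition mom2 f m : R := Ex P (fun w => bsum X f 0 m w ^+ 2).

Definition mom4 f m : R := Ex P (fun w => bsum X f 0 m w ^+ 4).

Lemma mom2_ge0 f m : 0 <= mom2 f m.
Proof. by apply: Ex_ge0 => w; exact: sqr_ge0. Qed.

Lemma mom4_ge0 f m : 0 <= mom4 f m.
Proof. by apply: Ex_ge0 => w; rewrite exprn_even_ge0. Qed.

Lemma mom2_bsum f a m : measurable_fun setT f ->
  Ex P (fun w => bsum X f a m w ^+ 2) = mom2 f m.
Proof.
by move=> mf; apply: (@stationary_bsum _ _ _ P X f a m (fun x => x ^+ 2)).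
Qed.

Lemma mom4_bsum f a m : measurable_fun setT f ->
  Ex P (fun w => bsum X f a m w ^+ 4) = mom4 f m.
Proof.
by move=> mf; apply: (@stationary_bsum _ _ _ P X f a m (fun x => x ^+ 4)).
Qed.

Section second_moment.
Variable f : R -> R.
Hypotheses (mf : measurable_fun setT f) (sf : sqint P (fun w => f (X 0 w))).

Let sb a m : sqint P (bsum X f a m).
Proof. by apply: sqint_bsum => t; exact: (sqint_stationary t statX mf sf). Qed.

Let sb2 a m : rint P (fun w => bsum X f a m w ^+ 2).
Proof. exact: (proj2 (sb a m)). Qed.

Lemma mom2_1 : mom2 f 1 = Ex P (fun w => f (X 0 w) ^+ 2).
Proof.
rewrite -(mom2_bsum (- 1) 1 mf); congr Ex; apply/funext => w.
by rewrite /bsum big_ord1.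
Qed.

Lemma mom2S_le m : mom2 f m.+1 <= 2 * mom2 f m + 2 * mom2 f 1.
Proof.
rewrite -(mom2_bsum m%:Z 1 mf) /mom2 -!ExZ; [|exact: sb2..].
rewrite -ExD; [|by apply: rintZ; exact: sb2..].
apply: Ex_le; first exact: sb2.
  by apply: rintD; apply: rintZ; exact: sb2.
move=> w; rewrite -addn1 bsum_add add0r.
have := sqr_ge0 (bsum X f 0 m w - bsum X f m%:Z 1 w); nra.
Qed.

Lemma mom2_0 : mom2 f 0 = 0.
Proof.
rewrite /mom2; under eq_fun do rewrite bsum0 expr0n.
exact: Ex_cst.
Qed.

(** The growth is absurdly fast, but the bound serves only for lengths below a fixed threshold. What
    matters is that it depends on [f] through [mom2 f 1] alone. *)
Lemma mom2_le_exp m : mom2 f m <= 4 ^+ m * mom2 f 1.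
Proof.
have v1 := mom2_ge0 f 1.
elim: m => [|m IH]; first by rewrite mom2_0 expr0 mul1r.
apply: (le_trans (mom2S_le m)); rewrite exprS.
have : 1 <= 4 ^+ m :> R by rewrite exprn_ege1// ler1n.
nra.
Qed.

Lemma mom2_sub_le a p q th : (q <= p)%N -> 0 < th ->
  Ex P (fun w => bsum X f (a + q%:Z) (p - q) w ^+ 2) <=
  (1 + th) * mom2 f p + (1 + th^-1) * mom2 f q.
Proof.
move=> qp th0.
rewrite -(mom2_bsum a p mf) -(mom2_bsum a q mf).
rewrite -!ExZ; [|exact: sb2..].
rewrite -ExD; [|by apply: rintZ; exact: sb2..].
apply: Ex_le; first exact: sb2.
  by apply: rintD; apply: rintZ; exact: sb2.
move=> w; have -> : bsum X f a p w = bsum X f a q w + bsum X f (a + q%:Z) (p - q) w.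
  by rewrite -bsum_add subnKC.
set u := bsum X f a q w; set v := bsum _ _ _ _ w.
have : 0 <= th^-1 * ((1 + th) * u + th * v) ^+ 2.
  by rewrite mulr_ge0 ?sqr_ge0// invr_ge0 ltW.
have -> : th^-1 * ((1 + th) * u + th * v) ^+ 2 =
   (1 + th) * (u + v) ^+ 2 + (1 + th^-1) * u ^+ 2 - v ^+ 2.
  by field; rewrite gt_eqF.
by rewrite subr_ge0.
Qed.

Hypothesis f0 : Ex P (fun w => f (X 0 w)) = 0.

Lemma Ex_bsum a m : Ex P (bsum X f a m) = 0.
Proof.
have E t : Ex P (fun w => f (X t w)) = 0.
  rewrite -f0; have := stationary_bsum (t - 1) 1 statX mf (@measurable_id _ _ setT).
  have := stationary_bsum (- 1) 1 statX mf (@measurable_id _ _ setT).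
  have B (u : int) : (fun w => bsum X f (u - 1) 1 w) = (fun w => f (X u w)).
    by apply/funext => w; rewrite /bsum big_ord1 subrK.
  by have := B 0; rewrite sub0r => ->; rewrite B => -> ->.
elim: m => [|m IH].
  rewrite (_ : bsum X f a 0 = fun=> 0) ?Ex_cst//.
  by apply/funext => w; rewrite bsum0.
rewrite (_ : bsum X f a m.+1 = fun w => bsum X f a m w + f (X (a + m.+1%:Z) w)).
  rewrite ExD ?IH ?E ?addr0//; apply: sqint_rint; first exact: sb.
  exact: (sqint_stationary _ statX mf sf).
by apply/funext => w; rewrite /bsum big_ord_recr.
Qed.

(** The left side is twice the expectation of a product A B. The first [q] terms Q of B are
    separated off: A Q is bounded by the weighted inequality, and A B' by [rho X q], since A and B'
    are [q] apart. The coefficient of [r] is exactly 1, which is what makes doubling cost a factor 1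
    + rho per scale. *)
Lemma mom2_add m p q (r th : R) : (q <= p)%N -> (rho X q <= r%:E)%E ->
  0 <= r <= 1 -> 0 < th <= 1 ->
  `|mom2 f (m + p) - mom2 f m - mom2 f p| <=
  (r + th) * (mom2 f m + mom2 f p) + 3 / th * mom2 f q.
Proof.
move=> qp rr /andP[r0 r1] /andP[th0 th1].
pose A := bsum X f 0 m; pose B := bsum X f m%:Z p.
pose Q := bsum X f m%:Z q; pose B' := bsum X f (m%:Z + q%:Z) (p - q).
have sA : sqint P A by exact: sb.
have sB : sqint P B by exact: sb.
have sQ : sqint P Q by exact: sb.
have sB' : sqint P B' by exact: sb.
have -> : mom2 f (m + p) - mom2 f m - mom2 f p =
    2 * Ex P (fun w => A w * Q w) + 2 * Ex P (fun w => A w * B' w).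
  apply/eqP; rewrite subr_eq subr_eq; apply/eqP.
  rewrite -(mom2_bsum m%:Z p mf) /mom2.
  rewrite -!ExZ; [|exact: rintM..].
  have iQ : rint P (fun w => 2 * (A w * Q w)) by apply: rintZ; exact: rintM.
  have iB : rint P (fun w => 2 * (A w * B' w)) by apply: rintZ; exact: rintM.
  have i2 := rintD iQ iB; have i3 := rintD i2 (sb2 m%:Z p).
  rewrite -(ExD iQ iB) -(ExD i2 (sb2 m%:Z p)) -(ExD i3 (sb2 0 m)).
  congr Ex; apply/funext => w; rewrite bsum_add add0r.
  have -> : bsum X f m%:Z p w = Q w + B' w by rewrite -bsum_add subnKC.
  rewrite -/(A w); ring.
have vm := mom2_ge0 f m; have vp := mom2_ge0 f p; have vq := mom2_ge0 f q.
have hAQ : `|2 * Ex P (fun w => A w * Q w)| <= th * mom2 f m + th^-1 * mom2 f q.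
  rewrite -(mom2_bsum m%:Z q mf); apply: le_trans (Ex_weighted_AMGM sA sQ th0).
  rewrite -ExZ; last exact: rintM.
  apply: Ex_norm_le; first by apply: rintZ; exact: rintM.
    by apply: rintZ; apply: rint_norm; exact: rintM.
  by move=> w; rewrite !normrM ger0_norm.
set v' := Ex P (fun w => B' w ^+ 2).
have v'0 : 0 <= v' by apply: Ex_ge0 => w; exact: sqr_ge0.
have hv' : v' <= (1 + th) * mom2 f p + (1 + th^-1) * mom2 f q.
  exact: mom2_sub_le.
have hAB : `|2 * Ex P (fun w => A w * B' w)| <= r * (mom2 f m + v').
  have := @bsum_cov _ _ _ P X f f 0 m (m%:Z + q%:Z) (p - q) id id q r statX mf mf
    (@measurable_id _ _ setT) (@measurable_id _ _ setT) (sb ^~ m) (sb ^~ (p - q)%N).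
  rewrite add0r => /(_ (lexx _) rr).
  rewrite [X in `|_ - X * _|](Ex_bsum 0 m) mul0r subr0 normrM ger0_norm//.
  rewrite -/(mom2 f m) -/v' => h.
  have s2 : 2 * (Num.sqrt (mom2 f m) * Num.sqrt v') <= mom2 f m + v'.
    have := sqr_ge0 (Num.sqrt (mom2 f m) - Num.sqrt v').
    rewrite sqrrB !sqr_sqrtr//; lra.
  have := ler_wpM2l r0 s2; rewrite /A /B'; lra.
apply: (le_trans (ler_normD _ _)).
have t1 : 1 <= th^-1 by rewrite invf_ge1.
have : r * v' <= r * ((1 + th) * mom2 f p + (1 + th^-1) * mom2 f q).
  by rewrite ler_wpM2l.
have : r * th * mom2 f p <= th * mom2 f p.
  by rewrite ler_wpM2r// ler_piMl// ltW.
have : r * ((1 + th^-1) * mom2 f q) <= 1 * (2 * th^-1 * mom2 f q).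
  apply: ler_pM => //; first by rewrite mulr_ge0//; lra.
  by rewrite ler_wpM2r//; lra.
have : 0 <= th * mom2 f p by rewrite mulr_ge0// ltW.
lra.
Qed.

End second_moment.

(** The squares with 400 absorb the odd terms 4 x^3 y and 4 x y^3 at the price of 800 x^2 y^2 each,
    and 1606 = 2 * 800 + 6. The leading coefficient must stay near 1 so that doubling multiplies
    fourth moments by little more than 2. *)
Lemma expr4_add_le (x y : R) :
  (x + y) ^+ 4 <= 201/200 * (x ^+ 4 + y ^+ 4) + 1606 * (x ^+ 2 * y ^+ 2).
Proof.
rewrite -subr_ge0.
have -> : 201/200 * (x ^+ 4 + y ^+ 4) + 1606 * (x ^+ 2 * y ^+ 2) - (x + y) ^+ 4 =
  1/200 * (x * (x - 400 * y)) ^+ 2 + 1/200 * (y * (y - 400 * x)) ^+ 2.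
  by field.
have h : (0 : R) <= 1/200 by lra.
by apply: addr_ge0; apply: (mulr_ge0 h); exact: sqr_ge0.
Qed.

Lemma expr4_add_le_pert (x y : R) :
  (x + y) ^+ 4 <= 202/200 * x ^+ 4 + (50 * 1606 ^+ 2 + 2) * y ^+ 4.
Proof.
apply: (le_trans (expr4_add_le x y)).
have := sqr_ge0 (x ^+ 2 - 100 * 1606 * y ^+ 2).
have : 0 <= y ^+ 4 by rewrite exprn_even_ge0.
move: (1606 : R) => s; nra.
Qed.

(** Decorrelating A^2 from B'^2 costs [r] times fourth moments, so a fixed small [r] is enough; the
    odd products, whose decorrelation would need sixth moments, are absorbed beforehand. Leaving out
    the gap costs at most (q c)^4 because [f] is bounded. The factor is about 1.01 * 1.005 * 2.01,
    plus about 0.02 from [r], below 21/10. *)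
Lemma mom4_double f m q (c r : R) : measurable_fun setT f ->
  (forall x, `|f x| <= c) -> (q <= m)%N -> (rho X q <= r%:E)%E ->
  0 <= r <= 10 ^- 5 ->
  mom4 f (m + m) <= 21/10 * mom4 f m +
    10 ^+ 4 * (mom2 f m ^+ 2 + mom2 f q ^+ 2) + 10 ^+ 9 * (q%:R * c) ^+ 4.
Proof.
move=> mf fc qm rr /andP[r0 r1].
have bb a n w : `|bsum X f a n w| <= n%:R * c by exact: norm_bsum_le.
have I4 a n : rint P (fun w => bsum X f a n w ^+ 4) by exact: rint_bsum_expn mf fc.
have s2 a n : sqint P (fun w => bsum X f a n w ^+ 2).
  apply: (@sqint_bounded _ _ _ P _ ((n%:R * c) ^+ 2)).
    by apply: measurable_funX; exact: measurable_bsum.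
  by move=> w; rewrite normrX lerXn2r ?nnegrE//; exact: (le_trans _ (bb a n w)).
have sf : sqint P (fun w => f (X 0 w)).
  by apply: (@sqint_bounded _ _ _ P _ c) => //; exact: measurableT_comp.
pose A := bsum X f 0 m; pose B := bsum X f m%:Z m.
pose Q := bsum X f m%:Z q; pose B' := bsum X f (m%:Z + q%:Z) (m - q).
have BQ w : B w = Q w + B' w by rewrite /B /Q /B' -bsum_add subnKC.
set a4 := mom4 f m; have a40 : 0 <= a4 := mom4_ge0 f m.
set Q4 := Ex P (fun w => Q w ^+ 4).
have Q4le : 0 <= Q4 <= (q%:R * c) ^+ 4.
  apply/andP; split; first by apply: Ex_ge0 => w; rewrite exprn_even_ge0.
  rewrite -[leRHS](Ex_cst P); apply: Ex_le; [exact: I4|exact: rint_cst|].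
  move=> w; rewrite -[leLHS]ger0_norm ?exprn_even_ge0// normrX.
  by rewrite lerXn2r ?nnegrE ?bb//; exact: (le_trans _ (bb 0 q w)).
have /andP[Q40 {}Q4le] := Q4le.
set b4 := Ex P (fun w => B' w ^+ 4).
have b40 : 0 <= b4 by apply: Ex_ge0 => w; rewrite exprn_even_ge0.
have hb4 : b4 <= 202/200 * a4 + (50 * 1606 ^+ 2 + 2) * Q4.
  rewrite /a4 -(mom4_bsum m%:Z m mf) -!ExZ; [|exact: I4..].
  rewrite -ExD; [|by apply: rintZ; exact: I4..].
  apply: Ex_le; [exact: I4|by apply: rintD; apply: rintZ; exact: I4|].
  move=> w; rewrite -/(B w) BQ; have := expr4_add_le_pert (Q w + B' w) (- Q w).
  rewrite addrAC subrr add0r (_ : (- Q w) ^+ 4 = Q w ^+ 4)//.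
  by rewrite !exprS expr0; ring.
set v' := Ex P (fun w => B' w ^+ 2).
have v'0 : 0 <= v' by apply: Ex_ge0 => w; exact: sqr_ge0.
have hv' : v' <= 2 * mom2 f m + 2 * mom2 f q.
  have := mom2_sub_le mf sf m%:Z qm (ltr01 : 0 < 1 :> R).
  by rewrite invr1 -/v'; lra.
set cr := Ex P (fun w => A w ^+ 2 * B' w ^+ 2).
have hcr : cr <= mom2 f m * v' + r * ((a4 + b4) / 2).
  have := @bsum_cov _ _ _ P X f f 0 m (m%:Z + q%:Z) (m - q) (fun x => x ^+ 2)
    (fun x => x ^+ 2) q r statX mf mf (exprn_measurable 2)
    (exprn_measurable 2) (s2 ^~ m) (s2 ^~ (m - q)%N).
  rewrite add0r => /(_ (lexx _) rr).
  have E4 a n : (fun w => (bsum X f a n w ^+ 2) ^+ 2) = (fun w => bsum X f a n w ^+ 4).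
    by apply/funext => w; rewrite -exprM.
  rewrite !E4 -/(mom2 f m) -/(mom4 f m) -/a4 -/b4 -/v' -/cr => h.
  have h2 : Num.sqrt a4 * Num.sqrt b4 <= (a4 + b4) / 2.
    have := sqr_ge0 (Num.sqrt a4 - Num.sqrt b4).
    rewrite sqrrB !sqr_sqrtr//; lra.
  have := ler_wpM2l r0 h2; have := ler_norm (cr - mom2 f m * v'); lra.
have hS : mom4 f (m + m) <= 202/200 * (201/200 * (a4 + b4) + 1606 * cr)
    + (50 * 1606 ^+ 2 + 2) * Q4.
  have iAB : rint P (fun w => A w ^+ 2 * B' w ^+ 2) by apply: rintM; exact: s2.
  rewrite /a4 /mom4 /b4 /cr /Q4.
  have i1 := rintD (I4 0 m) (I4 (m%:Z + q%:Z) (m - q)%N).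
  have i2 := rintZ (201/200) i1; have i3 := rintZ 1606 iAB.
  have i4 := rintD i2 i3; have i5 := rintZ (202/200) i4.
  have i6 := rintZ (50 * 1606 ^+ 2 + 2) (I4 m%:Z q).
  rewrite -(ExD (I4 0 m) (I4 (m%:Z + q%:Z) (m - q)%N)) -(ExZ (201/200) i1).
  rewrite -(ExZ 1606 iAB) -(ExD i2 i3) -(ExZ (202/200) i4).
  rewrite -(ExZ (50 * 1606 ^+ 2 + 2) (I4 m%:Z q)) -(ExD i5 i6).
  apply: Ex_le; [exact: I4|exact: rintD|move=> w].
  rewrite bsum_add add0r -/(A w) -/(B w) BQ addrCA addrC.
  apply: (le_trans (expr4_add_le_pert _ _)).
  have h : (0 : R) <= 202/200 by rewrite divr_ge0.
  by rewrite lerD2r; apply: (ler_wpM2l h); exact: expr4_add_le.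
set K := 50 * 1606 ^+ 2 + 2 in hb4 hS.
have K1 : K <= 13 * 10 ^+ 7 by rewrite /K; lra.
have K0 : 0 <= K by rewrite /K; lra.
clearbody K.
have vm := mom2_ge0 f m; have vq := mom2_ge0 f q.
have e5 : (10 : R) ^- 5 = 1/100 * (1/1000) by field.
have c1 : mom2 f m * v' <= 3 * mom2 f m ^+ 2 + mom2 f q ^+ 2.
  have := ler_wpM2l vm hv'; have := sqr_ge0 (mom2 f m - mom2 f q); nra.
have c2 : r * (a4 + b4) <= 1/100 * (1/1000) * (a4 + b4).
  by rewrite ler_wpM2r -?e5// addr_ge0.
have c3 : K * Q4 <= 13 * 10 ^+ 7 * (q%:R * c) ^+ 4 by rewrite ler_pM.
have c4 := sqr_ge0 (mom2 f m); have c5 := sqr_ge0 (mom2 f q).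
have c6 : 0 <= (q%:R * c) ^+ 4 by apply: le_trans Q4le.
rewrite -/a4; set z := (q%:R * c) ^+ 4 in c3 c6 *.
have -> : (10 : R) ^+ 9 = 100 * 10 ^+ 7 by rewrite !exprS expr0; ring.
have : 0 <= (10 : R) ^+ 7 by rewrite exprn_ge0.
move: (10 ^+ 7) c3 => t c3 t0.
have tz : 0 <= t * z by rewrite mulr_ge0.
have c3' : K * Q4 <= 13 * (t * z) by rewrite mulrA.
rewrite -(mulrA 100); move: (t * z) (K * Q4) tz c3' hb4 hS => tz KQ; lra.
Qed.

End moments.

(** * Elementary bounds for powers and exponentials *)

Section real_sequences.
Variable R : realType.
Implicit Types (a b x y : R).

Lemma geometric_sum_le x n : 0 <= x < 1 -> \sum_(j < n) x ^+ j <= (1 - x)^-1.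
Proof.
move=> /andP[x0 x1]; have h : 0 < 1 - x by rewrite subr_gt0.
rewrite -[leRHS]mul1r ler_pdivlMr// -(big_mkord xpredT (fun j => x ^+ j)).
have -> : (\sum_(0 <= j < n) x ^+ j) * (1 - x) = 1 - x ^+ n.
  elim: n => [|n IH]; first by rewrite big_geq// mul0r expr0 subrr.
  by rewrite big_nat_recr//= mulrDl IH exprS; ring.
by rewrite gerBl exprn_ge0.
Qed.

(* [21/10 <= (182/100) ^ (5/4)] *)
Lemma exprn_four_fifths i : (21/10 : R) ^+ ((4 * i) %/ 5) <= (182/100) ^+ i.
Proof.
have p1 : 0 <= (21/10 : R) by lra.
have p2 : 0 <= (182/100 : R) by lra.
rewrite -(@ler_pXn2r _ 5)// ?nnegrE ?exprn_ge0// -!exprM.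
apply: (@le_trans _ _ ((21/10) ^+ (4 * i))).
  by apply: ler_weXn2l; [lra | lia].
rewrite (mulnC i) !exprM lerXn2r ?nnegrE ?exprn_ge0//.
by rewrite !exprS !expr0; lra.
Qed.

Lemma exprn_cvgn_small x e : 0 <= x < 1 -> 0 < e ->
  exists N, forall n, (N <= n)%N -> x ^+ n <= e.
Proof.
move=> /andP[x0 x1] e0.
have /cvgrPdist_le /(_ e e0)[N _ NP] : (fun n => x ^+ n) @ \oo --> 0.
  by apply: cvg_expr; rewrite ger0_norm.
by exists N => n /NP; rewrite sub0r normrN ger0_norm ?exprn_ge0.
Qed.

(** By exp u >= 1 + u it suffices that (1 - x)(1 + 1.01 x) >= 1, which holds for x up to 1/101. This
    is the origin of the coefficient 101/100 in the lower variance bound. *)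
Lemma expR_1Bx_ge x : 0 <= x <= 9/1000 -> expR (- (101/100 * x)) <= 1 - x.
Proof.
move=> /andP[x0 x1]; rewrite expRN.
have h : 1 + 101/100 * x <= expR (101/100 * x) by exact: expR_ge1Dx.
have p : 0 < 1 + 101/100 * x by lra.
apply: (@le_trans _ _ (1 + 101/100 * x)^-1).
  by rewrite lef_pV2 ?posrE ?expR_gt0.
rewrite -[leLHS]mul1r ler_pdivrMr//; nra.
Qed.

End real_sequences.

(** * Variance growth along powers of two *)

Section growth.
Context {d : measure_display} {T : measurableType d} {R : realType}
  (P : probability T R) (X : int -> {RV P >-> R}).
Hypothesis statX : strictly_stationary X.
Hypothesis rho0 : rho X n @[n --> \oo] --> 0%E.
Implicit Types (f : R -> R).

Definition centered f := [/\ measurable_fun setT f,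
  sqint P (fun w => f (X 0 w)) & Ex P (fun w => f (X 0 w)) = 0].

Definition fine_rho n : R := fine (rho X n).

Lemma rho_ge0 n : (0 <= rho X n)%E.
Proof.
have L0 I : L2 P (process_sigma X I) (fun=> 0).
  split; last by apply: sqint_Lfun; exact: sqint_cst.
  move=> _ [A mA <-]; rewrite setTI.
  have := @process_sigma_bsum _ _ _ P X id I 0 0 id (@measurable_id _ _ _) (@measurable_id _ _ _).
  move=> /(_ (fun j => _)) H.
  apply: H => //; exists A => //; rewrite setTI.
  by apply/seteqP; split => w /=; rewrite bsum0.
apply: le_trans (_ : `|corr P (fun=> 0) (fun=> 0)|%:E <= _)%E.
  by rewrite lee_fin.
by apply: ereal_sup_ubound; exists (fun=> 0), (fun=> 0); split.
Qed.

Lemma fine_rho_ge0 n : 0 <= fine_rho n.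
Proof. by apply: fine_ge0; exact: rho_ge0. Qed.

(** Finiteness of [rho X n] is extracted from the convergence itself, which is why it is asserted
    only for large [n]. *)
Lemma rho_small (e : R) : 0 < e -> exists N, forall n, (N <= n)%N ->
  rho X n = (fine_rho n)%:E /\ fine_rho n <= e.
Proof.
move=> e0; have /fine_cvgP[[N1 _ F1]] := rho0.
move=> /cvgrPdist_le /(_ e e0)[N2 _ F2].
exists (maxn N1 N2) => n; rewrite geq_max => /andP[/F1 h1 /F2 h2].
split; first by rewrite /fine_rho fineK.
by move: h2; rewrite /= sub0r normrN; apply: le_trans; exact: ler_norm.
Qed.

(** A fixed gap with r = th = 1/40 gives the factor 2 + 4/40 = 21/10 at each doubling. The bound
    serves to show that the gap blocks are negligible in the sharp recursions; its constant must not
    depend on [f]. *)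
Lemma mom2_pow_crude : exists2 C : R, 0 <= C & forall f, centered f ->
  forall i, mom2 X f (2 ^ i) <= C * (21/10) ^+ i * mom2 X f 1.
Proof.
have [q qP] : exists N, forall n, (N <= n)%N ->
    rho X n = (fine_rho n)%:E /\ fine_rho n <= 1/40.
  by apply: rho_small; lra.
have [rq rqle] := qP q (leqnn _).
pose D : R := 4 ^+ (2 ^ q).
have D0 : 0 <= D by rewrite exprn_ge0.
exists (111 * D) => [|f [mf sf f0] i]; first by rewrite mulr_ge0.
set F := mom2 X f 1; have F0 : 0 <= F := mom2_ge0 X f 1.
have DF : 0 <= D * F by rewrite mulr_ge0.
have small j : (j <= q)%N -> mom2 X f (2 ^ j) <= D * F.
  move=> jq; apply: (le_trans (mom2_le_exp statX mf sf _)).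
  rewrite ler_wpM2r// ler_weXn2l ?ler1n//.
  by rewrite leq_exp2l.
(* The added constant turns v' <= 2.1 v + 120 D F into a purely multiplicative recursion: 110 works
   because 2.1 * 110 >= 120 + 110. *)
suff : mom2 X f (2 ^ i) + 110 * (D * F) <= 111 * D * (21/10) ^+ i * F by lra.
have [iq|/ltnW qi] := leqP i q.
  have := small i iq; have : 1 <= (21/10 : R) ^+ i by rewrite exprn_ege1//; lra.
  nra.
elim: i qi => [|i IH].
  by rewrite leqn0 => /eqP q0; have := small 0; rewrite q0 expr0 => /(_ (leqnn _)); lra.
rewrite leq_eqVlt => /predU1P[<-|].
  have := small q (leqnn _); have : 1 <= (21/10 : R) ^+ q by rewrite exprn_ege1//; lra.
  nra.
rewrite ltnS => qi; have {}IH := IH qi.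
have q2i : (q <= 2 ^ i)%N by rewrite (leq_trans qi)// ltnW// ltn_expl.
have := @mom2_add _ _ _ P X statX f mf sf f0 (2 ^ i) (2 ^ i) q (1/40) (1/40) q2i.
rewrite rq lee_fin => /(_ rqle).
have -> : (0 <= (1/40 : R) <= 1) by lra.
have -> : (0 < (1/40 : R) <= 1) by lra.
move=> /(_ isT isT); rewrite addnn -mul2n -expnS => h.
have {}h := le_trans (ler_norm _) h.
have hq : mom2 X f q <= D * F.
  apply: (le_trans (mom2_le_exp statX mf sf _)); rewrite ler_wpM2r//.
  by rewrite ler_weXn2l ?ler1n// ltnW// ltn_expl.
rewrite exprS; lra.
Qed.

Lemma mom2_lower_ratio f : centered f ->
  (forall A : R, exists N, forall i, (N <= i)%N -> A <= mom2 X f (2 ^ i)) ->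
  exists N, forall i, (N <= i)%N ->
    0 < mom2 X f (2 ^ i) /\ 195/100 * mom2 X f (2 ^ i) <= mom2 X f (2 ^ i.+1).
Proof.
move=> [mf sf f0] vy.
have [q qP] : exists N, forall n, (N <= n)%N ->
    rho X n = (fine_rho n)%:E /\ fine_rho n <= 1/100.
  by apply: rho_small; lra.
have [rq rqle] := qP q (leqnn _).
(* With r = th = 1/100 the doubling loses 0.04 v and 300 v_q; this threshold makes the latter at
   most 0.01 v, whence 2 - 0.05 = 1.95. *)
have [N NP] := vy (1 + 100 * 300 * mom2 X f q).
have vq := mom2_ge0 X f q.
exists (maxn N q) => i; rewrite geq_max => /andP[/NP Ni qi].
split; first by lra.
have q2i : (q <= 2 ^ i)%N by rewrite (leq_trans qi)// ltnW// ltn_expl.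
have := @mom2_add _ _ _ P X statX f mf sf f0 (2 ^ i) (2 ^ i) q (1/100) (1/100) q2i.
rewrite rq lee_fin => /(_ rqle).
have -> : (0 <= (1/100 : R) <= 1) by lra.
have -> : (0 < (1/100 : R) <= 1) by lra.
move=> /(_ isT isT); rewrite addnn -mul2n -expnS ler_norml => /andP[h _].
lra.
Qed.

End growth.

Section sharp_growth.
Context {d : measure_display} {T : measurableType d} {R : realType}
  (P : probability T R) (X : int -> {RV P >-> R}).
Hypothesis statX : strictly_stationary X.
Hypothesis rho0 : rho X n @[n --> \oo] --> 0%E.
Implicit Types (f : R -> R).

(** The power 4/5 of the block length 2^i. It is small enough that even the crude growth 2.1^(4i/5)
    <= 1.82^i stays geometrically below 1.95^i, and large enough that the resulting factor 5/4 in
    the sum of the rates is compensated by ln 2. *)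
Definition gap i := (2 ^ ((4 * i) %/ 5))%N.

Definition rho_gap i : R := fine_rho X (gap i).

Definition rho_gap_sum i : R := \sum_(j < i) rho_gap j.

Lemma rho_gap_ge0 i : 0 <= rho_gap i.
Proof. exact: fine_rho_ge0. Qed.

Lemma rho_gap_sumS i : rho_gap_sum i.+1 = rho_gap_sum i + rho_gap i.
Proof. by rewrite /rho_gap_sum big_ord_recr. Qed.

Lemma rho_gap_sum_le i j : (i <= j)%N -> rho_gap_sum i <= rho_gap_sum j.
Proof.
move=> /subnK <-; elim: (j - i)%N => // k IH.
by rewrite addSn rho_gap_sumS (le_trans IH)// lerDl rho_gap_ge0.
Qed.

Lemma gap_le i : (gap i <= 2 ^ i)%N.
Proof. by rewrite leq_exp2l//; lia. Qed.

Lemma gap_ge N : exists M, forall i, (M <= i)%N -> (N <= gap i)%N.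
Proof.
exists (2 * N)%N => i Ni; apply: (leq_trans (ltnW (ltn_expl N (ltnSn 1)))).
by rewrite leq_exp2l//; lia.
Qed.

Lemma rho_gap_small (e : R) : 0 < e -> exists N, forall i, (N <= i)%N ->
  rho X (gap i) = (rho_gap i)%:E /\ rho_gap i <= e.
Proof.
move=> /(rho_small rho0)[N NP]; have [M MP] := gap_ge N.
by exists M => i /MP /NP.
Qed.

Lemma mom2_double_gap : exists N, forall i, (N <= i)%N ->
  forall f (th : R), centered X f -> 0 < th <= 1 ->
  `|mom2 X f (2 ^ i.+1) - 2 * mom2 X f (2 ^ i)| <=
  2 * (rho_gap i + th) * mom2 X f (2 ^ i) + 3 / th * mom2 X f (gap i).
Proof.
have [N NP] := rho_gap_small ltr01.
exists N => i /NP [rq rq1] f th [mf sf f0] th01.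
have := @mom2_add _ _ _ P X statX f mf sf f0 (2 ^ i) (2 ^ i) (gap i) (rho_gap i)
  th (gap_le i).
rewrite rq lexx => /(_ isT); rewrite rho_gap_ge0 rq1 => /(_ isT th01).
rewrite addnn -mul2n -expnS.
have -> : mom2 X f (2 ^ i.+1) - mom2 X f (2 ^ i) - mom2 X f (2 ^ i) =
  mom2 X f (2 ^ i.+1) - 2 * mom2 X f (2 ^ i) by ring.
lra.
Qed.

(** With th = 0.95^i each doubling multiplies by at most 2 exp (rho_gap i + th), up to the gap term;
    [S] collects the weights and [B] the gap terms, both bounded. Uniformity in [f] is essential:
    the bound is applied to high parts whose truncation level changes with [i]. *)
Lemma mom2_pow_upper : exists2 C : R, 0 < C & forall f, centered X f ->
  forall i, mom2 X f (2 ^ i) <= C * 2 ^+ i * expR (rho_gap_sum i) * mom2 X f 1.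
Proof.
have p95 : 0 < 95/100 :> R by lra.
have q95 : 95/100 <= 1 :> R by lra.
have [N NP] := mom2_double_gap.
have [C1 C10 crude] := mom2_pow_crude statX rho0.
(* The gap term is of order (1.82 / 0.95)^i; dividing by the growth 2^i leaves [x ^+ i] with [x] <
   1. *)
pose x : R := 182/100 / (2 * (95/100)).
have x01 : 0 <= x < 1 by rewrite /x; lra.
have th01 : 0 <= (95/100 : R) < 1 by lra.
pose S i : R := \sum_(j < i) (95/100) ^+ j.
pose B i : R := \sum_(j < i) x ^+ j.
pose D : R := 4 ^+ (2 ^ N).
have D0 : 0 < D by rewrite exprn_gt0.
have Sge0 i : 0 <= S i by apply: sumr_ge0 => j _; rewrite exprn_ge0//; lra.
have Bge0 i : 0 <= B i by apply: sumr_ge0 => j _; rewrite exprn_ge0//; lra.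
have K f : centered X f -> forall i, mom2 X f (2 ^ i) <=
    expR (S i) * (D + 2 * C1 * B i) * (2 ^+ i * expR (rho_gap_sum i) * mom2 X f 1).
  move=> cf; have [mf sf f0] := cf; set F := mom2 X f 1.
  have F0 : 0 <= F := mom2_ge0 X f 1.
  have eS i : 1 <= expR (S i) by rewrite -expR0 ler_expR.
  have eR i : 1 <= expR (rho_gap_sum i).
    by rewrite -expR0 ler_expR sumr_ge0// => j _; exact: rho_gap_ge0.
  have base i : (i <= N)%N -> mom2 X f (2 ^ i) <=
      expR (S i) * (D + 2 * C1 * B i) * (2 ^+ i * expR (rho_gap_sum i) * F).
    move=> iN; apply: (@le_trans _ _ (D * F)).
      apply: (le_trans (mom2_le_exp statX mf sf _)).
      by rewrite ler_wpM2r// ler_weXn2l ?ler1n// leq_exp2l.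
    have p2 : 1 <= (2 : R) ^+ i by rewrite exprn_ege1// ler1n.
    apply: ler_pM => //; first exact: ltW.
      rewrite -[leLHS]mul1r; apply: ler_pM => //; first exact: ltW.
      by rewrite lerDl !mulr_ge0.
    by rewrite -[leLHS]mul1r ler_wpM2r// mulr_ege1.
  move=> i; have [/base//|/ltnW Ni] := leqP i N.
  elim: i Ni => [|i IH Ni]; first by rewrite leqn0 => /eqP N0; apply: base.
  move: Ni; rewrite leq_eqVlt => /predU1P[NE|]; first by apply: base; rewrite NE.
  rewrite ltnS => Ni; have {}IH := IH Ni.
  pose th : R := (95/100) ^+ i.
  have th0 : 0 < th := exprn_gt0 i p95.
  have th1 : th <= 1 by apply: exprn_ile1 q95; exact: ltW.
  have := NP i Ni f th cf; rewrite th0 th1 => /(_ isT) h.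
  have {}h := le_trans (ler_norm _) h.
  have hg : 3 / th * mom2 X f (gap i) <= 3 * C1 * (2 * x) ^+ i * F.
    have -> : (2 * x) ^+ i = (182/100) ^+ i / th.
      by rewrite /th -expr_div_n; congr (_ ^+ i); rewrite /x; field.
    have := crude f cf ((4 * i) %/ 5)%N; rewrite -/(gap i) -/F => h1.
    have h2 := exprn_four_fifths R i.
    have h3 : mom2 X f (gap i) <= C1 * (182/100) ^+ i * F.
      by apply: (le_trans h1); rewrite ler_wpM2r// ler_wpM2l.
    have -> : 3 * C1 * ((182/100) ^+ i / th) * F =
      3 / th * (C1 * (182/100) ^+ i * F) by ring.
    by rewrite ler_wpM2l// divr_ge0// ltW.
  have vi := mom2_ge0 X f (2 ^ i).
  have e1 : 1 + (rho_gap i + th) <= expR (rho_gap i + th) by exact: expR_ge1Dx.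
  have h4 : mom2 X f (2 ^ i.+1) <=
    2 * expR (rho_gap i + th) * mom2 X f (2 ^ i) + 3 * C1 * (2 * x) ^+ i * F.
    have := ler_wpM2r vi e1; lra.
  apply: (le_trans h4).
  have -> : S i.+1 = S i + th by rewrite /S big_ord_recr.
  have -> : B i.+1 = B i + x ^+ i by rewrite /B big_ord_recr.
  rewrite rho_gap_sumS !expRD exprS.
  set eSi := expR (S i) in IH *; set eRi := expR (rho_gap_sum i) in IH *.
  set a := expR (rho_gap i) in e1 *; set b := expR th.
  have a1 : 1 <= a by rewrite -expR0 ler_expR rho_gap_ge0.
  have b1 : 1 <= b by rewrite -expR0 ler_expR ltW.
  have ab0 : 0 <= 2 * (a * b) by rewrite mulr_ge0// mulr_ge0// expR_ge0.
  have := ler_wpM2l ab0 IH => h5.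
  have xi : 0 <= x ^+ i by rewrite exprn_ge0//; lra.
  have p2 : 0 <= (2 : R) ^+ i by rewrite exprn_ge0.
  have h6 : 3 * C1 * (2 * x) ^+ i * F <=
      (eSi * b) * (2 * C1 * x ^+ i) * (2 * 2 ^+ i * (eRi * a) * F).
    rewrite exprMn.
    have -> : (eSi * b) * (2 * C1 * x ^+ i) * (2 * 2 ^+ i * (eRi * a) * F) =
      (eSi * b * (eRi * a)) * (4 * C1 * (2 ^+ i * x ^+ i) * F) by ring.
    have -> : 3 * C1 * (2 ^+ i * x ^+ i) * F = 1 * (3 * C1 * (2 ^+ i * x ^+ i) * F) by ring.
    apply: ler_pM => //.
    - by rewrite !mulr_ge0.
    - have := eS i; have := eR i; rewrite -/eSi -/eRi => *.
      by rewrite -[leLHS]mulr1 ler_pM// -[leLHS]mulr1 ler_pM.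
    - rewrite ler_wpM2r// ler_wpM2r ?mulr_ge0// ler_wpM2r//; lra.
  apply: (le_trans (lerD h5 h6)); rewrite le_eqVlt; apply/orP; left; apply/eqP; ring.
exists (expR (1 - 95/100)^-1 * (D + 2 * C1 * (1 - x)^-1)).
  have x1 : 0 <= (1 - x)^-1 by rewrite invr_ge0; lra.
  by rewrite mulr_gt0 ?expR_gt0// ltr_wpDr// !mulr_ge0.
move=> f cf i; apply: (le_trans (K f cf i)).
rewrite !mulrA ler_wpM2r ?mom2_ge0// ler_wpM2r ?expR_ge0//.
rewrite ler_wpM2r ?exprn_ge0//; apply: ler_pM => //.
- by rewrite addr_ge0 ?(ltW D0)// !mulr_ge0.
- by rewrite ler_expR geometric_sum_le.
- by rewrite lerD2l ler_wpM2l ?mulr_ge0// geometric_sum_le.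
Qed.

(** The second bound is proved first: the gap term has to be compared with the variance itself, and
    the rough growth 1.95^i already suffices for that. The sharp bound then follows by iterating 1 -
    x >= exp (- 1.01 x). *)
Lemma mom2_pow_lower f : centered X f ->
  (forall A : R, exists N, forall i, (N <= i)%N -> A <= mom2 X f (2 ^ i)) ->
  exists2 c : R, 0 < c & exists N, forall i, (N <= i)%N ->
    c * 2 ^+ i * expR (- (101/100 * rho_gap_sum i)) <= mom2 X f (2 ^ i) /\
    c * (195/100) ^+ i <= mom2 X f (2 ^ i).
Proof.
have p95 : 0 < 95/100 :> R by lra.
have q95 : 95/100 <= 1 :> R by lra.
have p195 : 0 < 195/100 :> R by lra.
move=> cf vy; have [mf sf f0] := cf; set F := mom2 X f 1.
have F0 : 0 <= F := mom2_ge0 X f 1.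
have [N1 N1P] := mom2_double_gap.
have [C1 C10 crude] := mom2_pow_crude statX rho0.
have [N2 N2P] := mom2_lower_ratio statX rho0 cf vy.
pose c1 : R := mom2 X f (2 ^ N2) / (195/100) ^+ N2.
have c1_gt0 : 0 < c1 := divr_gt0 (proj1 (N2P _ (leqnn _))) (exprn_gt0 _ p195).
have low i : (N2 <= i)%N -> c1 * (195/100) ^+ i <= mom2 X f (2 ^ i).
  elim: i => [|i IH].
    by rewrite leqn0 => /eqP N20; rewrite /c1 N20 !expr0 divr1 mulr1.
  rewrite leq_eqVlt => /predU1P[<-|].
    by rewrite /c1 (divfK (lt0r_neq0 (exprn_gt0 _ p195))) lexx.
  rewrite ltnS => Ni; have := IH Ni; have := proj2 (N2P i Ni).
  by rewrite exprS; lra.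
(* Ratio of the gap term 1.82^i / 0.95^i to the rough lower growth 1.95^i; it is about 0.98. *)
pose y : R := 182/100 / (95/100 * (195/100)).
have y01 : 0 <= y < 1 by rewrite /y; lra.
have th01 : 0 <= (95/100 : R) < 1 by lra.
(* Chosen so that 3 / th times the crude bound of the gap block equals 2 K y^i times the lower bound
   c1 1.95^i. *)
pose K : R := 3/2 * (C1 * F / c1).
have K0 : 0 <= K by rewrite /K !mulr_ge0// ?invr_ge0 ltW//; lra.
pose e i : R := (95/100) ^+ i + K * y ^+ i.
have y0 : 0 <= y by case/andP: y01.
have e0 i : 0 <= e i.
  by rewrite /e; apply: addr_ge0; [apply: exprn_ge0; lra|rewrite mulr_ge0 ?exprn_ge0].
have [N3 N3P] : exists N, forall i, (N <= i)%N -> rho_gap i + e i <= 9/1000.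
  have [Na NaP] := rho_gap_small (ltac:(lra) : 0 < 1/1000 :> R).
  have [Nb NbP] := exprn_cvgn_small th01 (ltac:(lra) : 0 < 1/1000 :> R).
  have K1 : 0 < K + 1 by rewrite ltr_wpDl.
  have m3 : 0 < 1/1000 :> R by lra.
  have q : 0 < 1/1000 / (K + 1) by rewrite divr_gt0.
  have [Nc NcP] := exprn_cvgn_small y01 q.
  exists (maxn Na (maxn Nb Nc)) => i; rewrite !geq_max => /and3P[/NaP[_ ra] /NbP rb /NcP rc].
  have rK : K * y ^+ i <= 1/1000.
    apply: (@le_trans _ _ ((K + 1) * (1/1000 / (K + 1)))).
      by apply: ler_pM; rewrite ?exprn_ge0 ?lerDl.
    by rewrite mulrC divfK// gt_eqF.
  rewrite /e; clear -P X statX rho0 ra rb rK; lra.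
pose N := maxn N1 (maxn N2 N3).
have NN1 : (N1 <= N)%N by rewrite leq_max leqnn.
have NN2 : (N2 <= N)%N by rewrite !leq_max leqnn orbT.
have NN3 : (N3 <= N)%N by rewrite !leq_max leqnn !orbT.
pose E i : R := \sum_(j < i) e j.
have E0 i : 0 <= E i by apply: sumr_ge0.
pose Eb : R := (1 - 95/100)^-1 + K * (1 - y)^-1.
have EEb i : E i <= Eb.
  rewrite /E /e big_split /= -mulr_sumr lerD ?geometric_sum_le//.
  by rewrite ler_wpM2l// geometric_sum_le.
pose c0 : R := mom2 X f (2 ^ N) / 2 ^+ N.
have c00 : 0 < c0.
  by rewrite divr_gt0 ?exprn_gt0// (proj1 (N2P N NN2)).
have main i : (N <= i)%N ->
    c0 * 2 ^+ i * expR (- (101/100 * (rho_gap_sum i + E i))) <= mom2 X f (2 ^ i).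
  have base : c0 * 2 ^+ N * expR (- (101/100 * (rho_gap_sum N + E N))) <= mom2 X f (2 ^ N).
    rewrite /c0 divfK; last by rewrite gt_eqF// exprn_gt0.
    rewrite ler_piMr ?mom2_ge0// -expR0 ler_expR oppr_le0 mulr_ge0//.
    by rewrite addr_ge0// sumr_ge0// => j _; exact: rho_gap_ge0.
  elim: i => [|i IH].
    by rewrite leqn0 => /eqP N0; move: base; rewrite N0.
  rewrite leq_eqVlt => /predU1P[<-//|]; rewrite ltnS => Ni.
  have {}IH := IH Ni.
  pose th : R := (95/100) ^+ i.
  have th0 : 0 < th := exprn_gt0 i p95.
  have th1 : th <= 1 by apply: exprn_ile1 q95; exact: ltW.
  have := N1P i (leq_trans NN1 Ni) f th cf; rewrite th0 th1 => /(_ isT).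
  rewrite ler_norml => /andP[h _].
  have vi := mom2_ge0 X f (2 ^ i).
  have hlow := low i (leq_trans NN2 Ni).
  have hg : 3 / th * mom2 X f (gap i) <= 2 * (K * y ^+ i) * mom2 X f (2 ^ i).
    have h1 := crude f cf ((4 * i) %/ 5)%N; rewrite -/(gap i) -/F in h1.
    have h2 := exprn_four_fifths R i.
    have h3 : mom2 X f (gap i) <= C1 * (182/100) ^+ i * F.
      by apply: (le_trans h1); rewrite ler_wpM2r// ler_wpM2l.
    apply: (@le_trans _ _ (2 * (K * y ^+ i) * (c1 * (195/100) ^+ i))); last first.
      by apply: ler_wpM2l => //; rewrite mulr_ge0// mulr_ge0// exprn_ge0.
    have p195i := lt0r_neq0 (exprn_gt0 i p195).
    have -> : 2 * (K * y ^+ i) * (c1 * (195/100) ^+ i) =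
        3 / th * (C1 * (182/100) ^+ i * F).
      have -> : y ^+ i = (182/100) ^+ i / ((95/100) ^+ i * (195/100) ^+ i).
        by rewrite /y -exprMn -expr_div_n.
      rewrite /K /th; move: th0; rewrite /th => /lt0r_neq0.
      move: p195i (lt0r_neq0 c1_gt0); clearbody c1.
      move: ((182/100) ^+ i) ((95/100) ^+ i) ((195/100) ^+ i) => x1 x2 x3 p1 p2 p3.
      by field; rewrite p1 p2 p3.
    by rewrite ler_wpM2l// divr_ge0// ltW.
  have hx : 0 <= rho_gap i + e i <= 9/1000.
    by rewrite addr_ge0 ?rho_gap_ge0//= N3P// (leq_trans NN3 Ni).
  have hexp := expR_1Bx_ge hx.
  have -> : E i.+1 = E i + e i by rewrite /E big_ord_recr.
  have -> : - (101/100 * (rho_gap_sum i.+1 + (E i + e i))) =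
     - (101/100 * (rho_gap_sum i + E i)) + - (101/100 * (rho_gap i + e i)).
    by rewrite rho_gap_sumS; ring.
  rewrite expRD exprS.
  set w := expR (- (101/100 * (rho_gap_sum i + E i))) in IH *.
  set z := expR (- (101/100 * (rho_gap i + e i))) in hexp *.
  have z0 : 0 <= z by exact: expR_ge0.
  have h7 : c0 * (2 * 2 ^+ i) * (w * z) <= 2 * z * mom2 X f (2 ^ i).
    have := ler_wpM2l z0 IH; move: (mom2 X f (2 ^ i)) => mm h9.
    rewrite (_ : c0 * (2 * 2 ^+ i) * (w * z) = 2 * (z * (c0 * 2 ^+ i * w))); last by ring.
    by rewrite -[leRHS]mulrA ler_pM2l.
  apply: (le_trans h7).
  have h8 := ler_wpM2r vi hexp.
  move: h8; rewrite /e -/th; clear -P X statX rho0 h hg; lra.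
exists (Num.min (c0 * expR (- (101/100 * Eb))) c1).
  by rewrite lt_min c1_gt0 mulr_gt0 ?expR_gt0.
exists N => i Ni; split.
  apply: le_trans (main i Ni).
  have -> : - (101/100 * (rho_gap_sum i + E i)) =
     - (101/100 * E i) + - (101/100 * rho_gap_sum i) by ring.
  rewrite expRD mulrA ler_wpM2r ?expR_ge0// [in leRHS]mulrAC ler_wpM2r ?exprn_ge0//.
  rewrite ge_min; apply/orP; left; rewrite ler_wpM2l ?(ltW c00)//.
  by rewrite ler_expR lerN2 ler_wpM2l//; lra.
apply: le_trans (low i (leq_trans NN2 Ni)).
by apply: ler_wpM2r; [exact: ltW (exprn_gt0 i p195)|rewrite ge_min lexx orbT].
Qed.

End sharp_growth.

(** * Truncation *)

Section truncation.
Context {d : measure_display} {T : measurableType d} {R : realType}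
  (P : probability T R) (X : int -> {RV P >-> R}).
Hypothesis statX : strictly_stationary X.
Hypothesis rho0 : rho X n @[n --> \oo] --> 0%E.
Hypothesis sqX : sqint P (X 0).
Hypothesis EX0 : Ex P (X 0) = 0.
Hypothesis vy : forall A : R, exists N, forall i, (N <= i)%N ->
  A <= mom2 X id (2 ^ i).

Definition trunc (c x : R) : R := if `|x| <= c then x else 0.

Definition trunc_mean c : R := Ex P (fun w => trunc c (X 0 w)).

Definition low_part c x : R := trunc c x - trunc_mean c.

Definition high_part c x : R := x - low_part c x.

Definition tail2 c : R := Ex P (fun w => (X 0 w - trunc c (X 0 w)) ^+ 2).

Lemma norm_trunc c x : `|trunc c x| <= `|x|.
Proof. by rewrite /trunc; case: ifP => // _; rewrite normr0. Qed.

Lemma norm_trunc_le c x : 0 <= c -> `|trunc c x| <= c.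
Proof. by rewrite /trunc; case: ifP => // _ c0; rewrite normr0. Qed.

Lemma measurable_trunc c : measurable_fun setT (trunc c).
Proof.
apply: measurable_fun_ifT => //; apply: measurable_fun_ler => //.
Qed.

Let mX : measurable_fun setT (X 0 : T -> R).
Proof. exact: (proj1 sqX). Qed.

Let mtX c : measurable_fun setT (fun w => trunc c (X 0 w)).
Proof. exact: (measurableT_comp (measurable_trunc c) mX). Qed.

Let stX c : sqint P (fun w => trunc c (X 0 w)).
Proof. by apply: (sqint_le (mtX c) sqX) => w; exact: norm_trunc. Qed.

Lemma centered_id : centered X id.
Proof. by split => //; exact: measurable_id. Qed.

Lemma measurable_low_part c : measurable_fun setT (low_part c).
Proof. by apply: measurable_funB => //; exact: measurable_trunc. Qed.

Lemma centered_low_part c : centered X (low_part c).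
Proof.
split; first exact: measurable_low_part.
  by apply: sqintB; [exact: stX|exact: sqint_cst].
rewrite /low_part ExB ?Ex_cst ?subrr//; [exact: sqint_rint|exact: rint_cst].
Qed.

Lemma centered_high_part c : centered X (high_part c).
Proof.
have [m1 s1 e1] := centered_low_part c.
split; first by apply: measurable_funB.
  exact: sqintB.
rewrite /high_part ExB; [|exact: sqint_rint..].
by rewrite e1 subr0.
Qed.

Lemma norm_low_part c x : 0 <= c -> `|low_part c x| <= 2 * c.
Proof.
move=> c0; apply: (le_trans (ler_normB _ _)).
have h1 := norm_trunc_le x c0.
have h2 : `|trunc_mean c| <= c.
  rewrite -[leRHS](Ex_cst P); apply: Ex_norm_le.
  - exact: sqint_rint.
  - exact: rint_cst.
  - by move=> w; exact: norm_trunc_le.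
lra.
Qed.

Lemma tail2_ge0 c : 0 <= tail2 c.
Proof. by apply: Ex_ge0 => w; exact: sqr_ge0. Qed.

(** The high part is the discarded part of X_0 recentred at its mean, because E X_0 = 0; its second
    moment is thus a variance. *)
Lemma mom2_high_part1 c : mom2 X (high_part c) 1 <= tail2 c.
Proof.
have [m1 s1 _] := centered_high_part c.
rewrite (mom2_1 statX m1).
have sY : sqint P (fun w => X 0 w - trunc c (X 0 w)) by exact: sqintB.
have EY : Ex P (fun w => X 0 w - trunc c (X 0 w)) = - trunc_mean c.
  by rewrite ExB; [rewrite EX0 sub0r|exact: sqint_rint..].
have -> : (fun w => high_part c (X 0 w) ^+ 2) =
  fun w => (X 0 w - trunc c (X 0 w) - Ex P (fun w => X 0 w - trunc c (X 0 w))) *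
           (X 0 w - trunc c (X 0 w) - Ex P (fun w => X 0 w - trunc c (X 0 w))).
  by apply/funext => w; rewrite EY /high_part /low_part -expr2; congr (_ ^+ 2); ring.
rewrite (variance_Ex_center sY sY).
by rewrite /tail2 -expr2 gerBl sqr_ge0.
Qed.

Lemma bsum_low_high c a m w :
  bsum X id a m w = bsum X (low_part c) a m w + bsum X (high_part c) a m w.
Proof.
rewrite /bsum -big_split /=; apply: eq_bigr => j _.
by rewrite /high_part addrC subrK.
Qed.

Lemma mom2_low_le c m :
  mom2 X (low_part c) m <= 2 * mom2 X id m + 2 * mom2 X (high_part c) m.
Proof.
have S f : centered X f -> sqint P (bsum X f 0 m).
  by move=> [mf sf _]; apply: sqint_bsum => t; exact: (sqint_stationary t statX mf sf).
have i1 := proj2 (S _ centered_id); have i2 := proj2 (S _ (centered_high_part c)).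
rewrite /mom2 -!ExZ// -ExD; [|exact: rintZ..].
apply: Ex_le; first exact: (proj2 (S _ (centered_low_part c))).
  by apply: rintD; exact: rintZ.
move=> w; rewrite (bsum_low_high c).
have := sqr_ge0 (bsum X (low_part c) 0 m w + 2 * bsum X (high_part c) 0 m w).
lra.
Qed.

(** 20/39 is the inverse of the doubling ratio 195/100, iterated down from scale [i] to scale
    [j]. *)
Lemma mom2_id_ratio : exists2 K : R, 0 < K & exists N, forall i, (N <= i)%N ->
  0 < mom2 X id (2 ^ i) /\ forall j, (j <= i)%N ->
  mom2 X id (2 ^ j) <= K * (20/39) ^+ (i - j) * mom2 X id (2 ^ i).
Proof.
have [N NP] := mom2_lower_ratio statX rho0 centered_id vy.
pose v i := mom2 X id (2 ^ i).
have v0 i : 0 <= v i by exact: mom2_ge0.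
have p2039 : 0 <= (20/39 : R) by lra.
have p195 : 0 <= 195/100 :> R by lra.
have up j k : (N <= j)%N -> v j <= (20/39) ^+ k * v (j + k)%N.
  move=> Nj; elim: k => [|k IH]; first by rewrite expr0 mul1r addn0.
  apply: (le_trans IH); rewrite exprSr -mulrA ler_wpM2l ?exprn_ge0//.
  have := proj2 (NP (j + k)%N (leq_trans Nj (leq_addr _ _))).
  by rewrite -/(v _) -/(v _) addnS; lra.
have vN : 0 < v N := proj1 (NP N (leqnn _)).
pose D := \sum_(j < N) v j.
have D0 : 0 <= D by apply: sumr_ge0.
pose K1 := D * (195/100) ^+ N / v N.
have K10 : 0 <= K1 := divr_ge0 (mulr_ge0 D0 (exprn_ge0 N p195)) (ltW vN).
exists (1 + K1); first by lra.
exists N => i Ni; split; first exact: (proj1 (NP i Ni)).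
move=> j ji; have [Nj|jN] := leqP N j.
  have := up j (i - j)%N Nj; rewrite subnKC// => h; apply: (le_trans h).
  by rewrite -/(v i) ler_wpM2r// ler_peMl ?exprn_ge0//; lra.
have vjD : v j <= D.
  by rewrite /D (bigD1 (Ordinal jN))//= lerDl sumr_ge0.
have := up N (i - N)%N (leqnn _); rewrite subnKC// => h.
have E : (20/39 : R) ^+ (i - j) * (195/100) ^+ N >= (20/39) ^+ (i - N).
  have -> : (i - j = (i - N) + (N - j))%N by lia.
  rewrite exprD -mulrA ler_peMr ?exprn_ge0//.
  have -> : (195/100 : R) ^+ N = (195/100) ^+ (N - j) * (195/100) ^+ j.
    by rewrite -exprD subnK// ltnW.
  rewrite mulrA -exprMn.
  have -> : (20/39 * (195/100) : R) = 1 by lra.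
  by rewrite expr1n mul1r exprn_ege1//; lra.
apply: (@le_trans _ _ (K1 * (20/39) ^+ (i - j) * v i)); last first.
  by rewrite ler_wpM2r// ler_wpM2r ?exprn_ge0//; lra.
apply: (@le_trans _ _ (D / v N * v N)); first by rewrite divfK ?gt_eqF.
apply: (@le_trans _ _ (D / v N * ((20/39) ^+ (i - N) * v i))).
  by rewrite ler_wpM2l// divr_ge0.
have -> : K1 * (20/39) ^+ (i - j) * v i =
    D / v N * ((20/39) ^+ (i - j) * (195/100) ^+ N * v i) by rewrite /K1; ring.
rewrite ler_wpM2l ?divr_ge0//; exact: ler_wpM2r.
Qed.

(** Exponential in [i], so that the iterated logarithm of the level is log i up to a constant, yet
    slow enough that 2.1 * 1.1^4 <= 1.95^2: the fourth power of the level times the loss 2.1^i stays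
    below the squared variance. *)
Definition level i : R := (11/10) ^+ i.

Lemma level_ge0 i : 0 <= level i.
Proof. by rewrite exprn_ge0//; lra. Qed.

(** The upper bound for the high part is divided by the lower bound for X itself; the exponents 1
    and 101/100 of the two add up to 201/100. *)
Lemma mom2_high_le : exists2 K : R, 0 < K & exists N, forall i, (N <= i)%N ->
  forall j, (j <= i)%N -> mom2 X (high_part (level i)) (2 ^ j) <=
  K * (expR (201/100 * rho_gap_sum X i) * tail2 (level i)) *
   ((1/2) ^+ (i - j) * mom2 X id (2 ^ i)).
Proof.
have [C C0 up] := mom2_pow_upper statX rho0.
have [c c0 [N NP]] := mom2_pow_lower statX rho0 centered_id vy.
exists (C / c); first by rewrite divr_gt0.
exists N => i /NP[low _] j ji.
have t0 := tail2_ge0 (level i).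
apply: (le_trans (up _ (centered_high_part _) j)).
apply: (@le_trans _ _ (C * 2 ^+ j * expR (rho_gap_sum X i) * tail2 (level i))).
  apply: ler_pM; rewrite ?mom2_ge0 ?mom2_high_part1//.
    by rewrite !mulr_ge0 ?expR_ge0 ?exprn_ge0// ltW.
  rewrite ler_wpM2l ?ler_expR ?rho_gap_sum_le// mulr_ge0 ?exprn_ge0// ltW//.
have -> : (2 : R) ^+ j = (1/2) ^+ (i - j) * 2 ^+ i.
  have -> : (2 : R) ^+ i = 2 ^+ (i - j) * 2 ^+ j by rewrite -exprD subnK.
  rewrite mulrA -exprMn.
  have -> : (1/2 * 2 : R) = 1 by lra.
  by rewrite expr1n mul1r.
have -> : expR (rho_gap_sum X i) =
    expR (201/100 * rho_gap_sum X i) * expR (- (101/100 * rho_gap_sum X i)).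
  by rewrite -expRD; congr expR; lra.
set E := expR (201/100 * _); set E' := expR (- _) in low *.
set v := mom2 X id (2 ^ i) in low *.
have -> : C * ((1/2) ^+ (i - j) * 2 ^+ i) * (E * E') * tail2 (level i) =
  C / c * (E * tail2 (level i)) * ((1/2) ^+ (i - j) * (c * 2 ^+ i * E')).
  by field; rewrite gt_eqF.
rewrite ler_wpM2l//; last by rewrite ler_wpM2l// exprn_ge0.
by rewrite mulr_ge0 ?divr_ge0 ?mulr_ge0 ?expR_ge0// ltW.
Qed.

(** Supplied by [tail_condition]; the mixing rate and the strengthened moment act on the limit
    theorem only through this property. *)
Hypothesis tailX : forall e : R, 0 < e -> exists N, forall i, (N <= i)%N ->
  expR (201/100 * rho_gap_sum X i) * tail2 (level i) <= e.

Lemma mom2_high_small (e : R) : 0 < e -> exists N, forall i, (N <= i)%N ->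
  mom2 X (high_part (level i)) (2 ^ i) <= e * mom2 X id (2 ^ i).
Proof.
move=> e0; have [K K0 [N1 N1P]] := mom2_high_le.
have [N2 N2P] := tailX (divr_gt0 e0 K0).
exists (maxn N1 N2) => i; rewrite geq_max => /andP[/N1P h /N2P h2].
apply: (le_trans (h i (leqnn _))); rewrite subnn expr0 mul1r.
rewrite ler_wpM2r ?mom2_ge0//.
by apply: (le_trans (ler_wpM2l (ltW K0) h2)); rewrite mulrC divfK// gt_eqF.
Qed.

(** The fourth moment recursion runs over all scales [j <= i] while the truncation level stays that
    of [i], hence a bound at every smaller scale. The high part decays like 2^(-(i - j)), faster
    than required. *)
Lemma mom2_low_decay : exists2 K : R, 0 < K & exists N, forall i, (N <= i)%N ->
  forall j, (j <= i)%N -> mom2 X (low_part (level i)) (2 ^ j) <=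
  K * ((20/39) ^+ (i - j) * mom2 X id (2 ^ i)).
Proof.
have [K1 K10 [N1 N1P]] := mom2_high_le.
have [N2 N2P] := tailX ltr01.
have [K2 K20 [N3 N3P]] := mom2_id_ratio.
exists (2 * K1 + 2 * K2); first by lra.
exists (maxn N1 (maxn N2 N3)) => i; rewrite !geq_max => /and3P[n1 n2 n3] j ji.
apply: (le_trans (mom2_low_le _ _)).
have := N1P i n1 j ji; have := N2P i n2; have := proj2 (N3P i n3) j ji.
have v0 := mom2_ge0 X id (2 ^ i).
set E := expR _ * _; have E0 : 0 <= E by rewrite mulr_ge0 ?expR_ge0 ?tail2_ge0.
move=> h1 h2 h3.
have h4 : (1/2 : R) ^+ (i - j) <= (20/39) ^+ (i - j).
  by apply: lerXn2r; rewrite ?nnegrE; lra.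
have h5 : K1 * E * ((1/2) ^+ (i - j) * mom2 X id (2 ^ i)) <=
    K1 * ((20/39) ^+ (i - j) * mom2 X id (2 ^ i)).
  apply: ler_pM.
  - by rewrite mulr_ge0// ltW.
  - by rewrite mulr_ge0// exprn_ge0//; lra.
  - by rewrite ler_piMr// ltW.
  - by rewrite ler_wpM2r.
lra.
Qed.

(** Squared variances more than triple at each doubling, fourth moments are multiplied by only 21/10
    plus a source term; so the source at the top scale dominates. The contribution of the initial
    scale is 2.1^i times the fourth power of the level, which the choice of the level keeps below
    the squared variance. *)
Lemma mom4_low_le : exists2 C : R, 0 < C & exists N, forall i, (N <= i)%N ->
  mom4 X (low_part (level i)) (2 ^ i) <= C * mom2 X id (2 ^ i) ^+ 2.
Proof.
have [K K0 [N1 N1P]] := mom2_low_decay.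
have [c c0 [N2 N2P]] := mom2_pow_lower statX rho0 centered_id vy.
have e5 : 0 < (10 : R) ^- 5 by rewrite invr_gt0 exprn_gt0.
have [q qP] := rho_small rho0 e5.
have [rq rqle] := qP q (leqnn _).
pose G0 : R := 10 ^+ 4 + 10 ^+ 9; pose Q : R := (2 ^+ q * 2) ^+ 4.
have G00 : 1 <= G0.
  have h4 : 0 <= (10 : R) ^+ 9 by rewrite exprn_ge0.
  have : 1 <= (10 : R) ^+ 4 by rewrite exprn_ege1//; lra.
  rewrite /G0; lra.
have Q0 : 0 <= Q by rewrite exprn_ge0// mulr_ge0// exprn_ge0.
pose A : R := 10 ^+ 4 * K ^+ 2.
have A0 : 0 <= A by rewrite mulr_ge0 ?exprn_ge0// ltW.
exists (2 * G0 * Q / c ^+ 2 + A + 1).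
  by rewrite ltr_wpDl// addr_ge0// divr_ge0 ?exprn_ge0 ?(ltW c0)// !mulr_ge0//; lra.
exists (maxn q (maxn N1 N2)) => i; rewrite !geq_max => /and3P[qi i1 i2].
set V := mom2 X id (2 ^ i); set f := low_part (level i).
have V0 : 0 <= V := mom2_ge0 X id (2 ^ i).
have mf : measurable_fun setT f by exact: measurable_low_part.
have fc x : `|f x| <= 2 * level i by rewrite norm_low_part// level_ge0.
pose M := Q * level i ^+ 4.
have M0 : 0 <= M by rewrite mulr_ge0// exprn_ge0// level_ge0.
have bb a n w : `|bsum X f a n w| <= n%:R * (2 * level i) by exact: norm_bsum_le.
have l0 := level_ge0 i.
have nM n : (n <= 2 ^ q)%N -> (n%:R * (2 * level i)) ^+ 4 <= M.
  move=> n2; have -> : M = ((2 ^ q)%:R * (2 * level i)) ^+ 4.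
    by rewrite /M /Q natrX -exprMn -mulrA.
  apply: lerXn2r; rewrite ?nnegrE ?mulr_ge0//.
  by rewrite ler_wpM2r ?ler_nat// mulr_ge0.
have m4 : mom4 X f (2 ^ q) <= M.
  apply: le_trans (nM (2 ^ q)%N (leqnn _)).
  rewrite -[leRHS](Ex_cst P); apply: Ex_le.
  - exact: rint_bsum_expn mf fc.
  - exact: rint_cst.
  - move=> w; rewrite -[leLHS]ger0_norm ?exprn_even_ge0// normrX.
    by rewrite lerXn2r ?nnegrE ?bb ?mulr_ge0.
have m2q : mom2 X f q ^+ 2 <= M.
  apply: le_trans (nM q _); last exact: ltnW (ltn_expl _ _).
  have -> : (q%:R * (2 * level i)) ^+ 4 = ((q%:R * (2 * level i)) ^+ 2) ^+ 2.
    by rewrite -exprM.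
  apply: lerXn2r; rewrite ?nnegrE ?mom2_ge0 ?sqr_ge0//.
  rewrite -[leRHS](Ex_cst P); apply: Ex_le.
  - exact: rint_bsum_expn mf fc.
  - exact: rint_cst.
  - move=> w; rewrite -[leLHS]ger0_norm ?sqr_ge0// normrX.
    by rewrite lerXn2r ?nnegrE ?bb ?mulr_ge0.
have step j : (q <= j)%N -> (j <= i)%N -> mom4 X f (2 ^ j.+1) <=
    21/10 * mom4 X f (2 ^ j) + A * ((20/39) ^+ (i - j) * V) ^+ 2 + G0 * M.
  move=> qj ji.
  have q2j : (q <= 2 ^ j)%N by rewrite (leq_trans qj)// ltnW// ltn_expl.
  have := @mom4_double _ _ _ P X statX f (2 ^ j) q (2 * level i) (10 ^- 5) mf fc q2j.
  rewrite rq lee_fin => /(_ rqle); rewrite lexx (ltW e5) => /(_ isT).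
  rewrite addnn -mul2n -expnS => h; apply: (le_trans h).
  have h1 : mom2 X f (2 ^ j) ^+ 2 <= K ^+ 2 * ((20/39) ^+ (i - j) * V) ^+ 2.
    rewrite -exprMn; apply: lerXn2r; rewrite ?nnegrE ?mom2_ge0//; last exact: N1P.
    by rewrite !mulr_ge0 ?exprn_ge0 ?(ltW K0)//; lra.
  have h2 := nM q (ltnW (ltn_expl _ (ltnSn _))).
  rewrite /A /G0.
  have t4 : 0 <= (10 : R) ^+ 4 by rewrite exprn_ge0.
  have t9 : 0 <= (10 : R) ^+ 9 by rewrite exprn_ge0.
  have := ler_wpM2l t9 h2; have := ler_wpM2l t4 h1; have := ler_wpM2l t4 m2q.
  move: (10 ^+ 4) (10 ^+ 9) => u w; lra.
have G1 : 0 <= G0 * M by rewrite mulr_ge0//; lra.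
have GM : M <= G0 * M by rewrite ler_peMl.
(* Adding [G0 * M] absorbs the constant source term, since 2 <= 21/10. The last summand on the right
   is the source accumulated so far. *)
have main j : (q <= j)%N -> (j <= i)%N -> mom4 X f (2 ^ j) + G0 * M <=
    (21/10) ^+ j * (2 * (G0 * M)) + A * ((20/39) ^+ (i - j) * V) ^+ 2.
  have p21 k : 1 <= (21/10 : R) ^+ k by rewrite exprn_ege1//; lra.
  have pA k : 0 <= A * ((20/39) ^+ k * V) ^+ 2 by rewrite mulr_ge0 ?sqr_ge0.
  have base : mom4 X f (2 ^ q) + G0 * M <=
      (21/10) ^+ q * (2 * (G0 * M)) + A * ((20/39) ^+ (i - q) * V) ^+ 2.
    have := p21 q; have := pA (i - q)%N.
    have : 1 * (2 * (G0 * M)) <= (21/10) ^+ q * (2 * (G0 * M)).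
      by rewrite ler_wpM2r ?p21// mulr_ge0.
    lra.
  elim: j => [|j IH]; first by rewrite leqn0 => /eqP q0 _; move: base; rewrite q0.
  rewrite leq_eqVlt => /predU1P[<-//|]; rewrite ltnS => qj ji.
  have {IH}h := IH qj (ltnW ji); have {}step := step j qj (ltnW ji).
  rewrite exprS.
  have pB := pA (i - j.+1)%N.
  set y : R := (20/39) ^+ (i - j.+1) in pB *.
  have yj : (20/39 : R) ^+ (i - j) = 20/39 * y.
    by rewrite /y -exprS subnSK.
  have yV : (20/39 * y * V) ^+ 2 = (20/39) ^+ 2 * (y * V) ^+ 2 by ring.
  rewrite yj yV in step h; clear yV.
  move: ((y * V) ^+ 2) pB step h => s pB step h.
  (* 31/10 = 21/10 + 1 counts the propagated source and the new one; both are measured at scale j,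
     smaller by (20/39)^2 than at scale j + 1. *)
  have pB2 : 0 <= A * s * (1 - 31/10 * (20/39) ^+ 2).
    by rewrite mulr_ge0//; lra.
  move: ((21/10) ^+ j) (G0 * M) G1 step h => t g g0 step h; lra.
have := main i qi (leqnn _); rewrite subnn expr0 mul1r => h.
have p195 : 0 <= 195/100 :> R by lra.
have lowV : c * (195/100) ^+ i <= V := proj2 (N2P i i2).
have lowV2 : c ^+ 2 * ((195/100) ^+ 2) ^+ i <= V ^+ 2.
  rewrite -exprM mulnC exprM -exprMn; apply: lerXn2r; rewrite ?nnegrE//.
  exact: mulr_ge0 (ltW c0) (exprn_ge0 i p195).
have pow : (21/10) ^+ i * level i ^+ 4 <= ((195/100 : R) ^+ 2) ^+ i.
  rewrite /level [X in _ * X]exprAC -exprMn; apply: lerXn2r; rewrite ?nnegrE.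
  - by rewrite mulr_ge0 ?exprn_ge0//; lra.
  - exact: exprn_ge0 p195.
  - by rewrite !exprS !expr0; lra.
have c20 : 0 < c ^+ 2 by rewrite exprn_gt0.
have fin : (21/10) ^+ i * (2 * (G0 * M)) <= 2 * G0 * Q / c ^+ 2 * V ^+ 2.
  have -> : (21/10) ^+ i * (2 * (G0 * M)) =
     2 * G0 * Q / c ^+ 2 * (c ^+ 2 * ((21/10) ^+ i * level i ^+ 4)).
    by rewrite /M; field; rewrite gt_eqF.
  rewrite ler_wpM2l//.
    by rewrite divr_ge0 ?(ltW c20)// !mulr_ge0//; lra.
  by apply: le_trans lowV2; rewrite ler_wpM2l ?(ltW c20).
have V20 := sqr_ge0 V; lra.
Qed.

End truncation.

(** * Mixing rates and tails *)

Section dominated.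
Context {d : measure_display} {T : measurableType d} {R : realType}
  (P : probability T R).

Lemma Ex_dominated_cvg (F : nat -> T -> R) (f g : T -> R) :
  (forall n, measurable_fun setT (F n)) -> rint P g ->
  (forall n w, `|F n w| <= g w) -> (forall w, F n w @[n --> \oo] --> f w) ->
  Ex P (F n) @[n --> \oo] --> Ex P f.
Proof.
move=> mF Ig Fg Ff.
have mf : measurable_fun setT f.
  by apply: (measurable_fun_cvg (h := F)) => // w _; exact: Ff.
have mEF n : measurable_fun setT (EFin \o F n) by exact/measurable_EFinP.
have mEf : measurable_fun setT (EFin \o f) by exact/measurable_EFinP.
have ae1 : \forall w \ae P, setT w -> (EFin \o F n) w @[n --> \oo] --> (EFin \o f) w.
  by apply: aeW => w _; apply: cvg_EFin; [exact: nearW|exact: Ff].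
have ae2 : \forall w \ae P, forall n : nat, setT w ->
    (`|(EFin \o F n) w| <= (EFin \o g) w)%E.
  by apply: aeW => w n _ /=; rewrite lee_fin.
have [If _ cv] := dominated_convergence measurableT mEF mEf ae1 Ig ae2.
by apply: fine_cvg; rewrite fineK ?integrable_fin_num.
Qed.

End dominated.

Section rates.
Variable R : realType.
Implicit Types x y : R.

Lemma ln2_gt0 : 0 < ln 2 :> R.
Proof. by rewrite ln_gt0// ltr1n. Qed.

Lemma ln2_le : ln 2 <= 3/4 :> R.
Proof.
rewrite -ler_expR lnK ?posrE//.
(* exp (3/4) >= (1 + 3/32)^8, and this rational number exceeds 2. *)
have -> : (3/4 : R) = 8%:R * (3/32) by lra.
rewrite expRM_natl; apply: (@le_trans _ _ ((1 + 3/32) ^+ 8)).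
  by rewrite !exprS expr0; lra.
apply: lerXn2r; rewrite ?nnegrE ?expR_ge0//.
exact: expR_ge1Dx.
Qed.

Lemma log2_exp2 n : log2 ((2 ^ n)%:R : R) = n%:R.
Proof.
by rewrite /log2 natrX lnXn// -[ln 2 *+ n]mulr_natr mulrAC divff ?mul1r// gt_eqF// ln2_gt0.
Qed.

Lemma log2_le x y : 0 < x -> x <= y -> log2 x <= log2 y.
Proof.
move=> x0 xy; rewrite /log2 ler_pM2r ?invr_gt0 ?ln2_gt0// ler_ln//.
by rewrite posrE (lt_le_trans x0).
Qed.

Lemma log2M x y : 0 < x -> 0 < y -> log2 (x * y) = log2 x + log2 y.
Proof. by move=> x0 y0; rewrite /log2 lnM ?posrE// mulrDl. Qed.

Lemma is_derive_log2 x : 0 < x -> is_derive x 1 (@log2 R) (x^-1 / ln 2).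
Proof.
move=> x0; have -> : @log2 R = (ln 2)^-1 *: (@ln R).
  by apply/funext => y; rewrite /log2 mulrC.
by rewrite mulrC; exact: (is_deriveZ _ (is_derive1_ln x0)).
Qed.

Lemma log2_large (A : R) : exists N, forall n, (N <= n)%N -> A <= log2 (n%:R : R).
Proof.
exists (2 ^ (Num.bound `|A|))%N => n An.
apply: (@le_trans _ _ (log2 (2 ^ (Num.bound `|A|))%:R)).
  by rewrite log2_exp2 (le_trans (ler_norm _))// ltW// archi_boundP.
by apply: log2_le; rewrite ?ltr0n ?expn_gt0// ler_nat.
Qed.


(* The base 2 logarithms leave room for the factor 201/200 and for the gaps:
   with [j = log2 m], [(5/4) * ln 2 < 87/100], where 5/4 comes from [4 * j / 5]. *)
Lemma powR_log_increment (beta : R) (G : R -> R) : beta <= 1 ->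
  (forall y : R, 0 < y -> is_derive y 1 G (y `^ (- beta))) ->
  exists N, forall j, (N <= j)%N ->
  201/200 * (((4 * j) %/ 5)%N%:R^-1 * log2 ((4 * j) %/ 5)%N%:R `^ (- beta)) <=
  96/100 * (G (log2 j.+1%:R) - G (log2 j%:R)).
Proof.
move=> b1 dG; have [N0 N0P] := log2_large 100.
exists (maxn 1000 (2 * N0)) => j; rewrite geq_max => /andP[j1000 jN].
set l := ((4 * j) %/ 5)%N.
have lj : (4 * j <= 5 * l + 4)%N by rewrite /l; lia.
have l2 : (j.+1 <= 2 * l)%N by lia.
have jl : (l <= j)%N by rewrite /l; lia.
have Nl : (N0 <= l)%N by lia.
have ljR : 4 * (j%:R : R) <= 5 * l%:R + 4.
  by rewrite -!natrM -natrD ler_nat.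
have jR : 1000 <= (j%:R : R) by rewrite ler_nat.
have l0 : 0 < (l%:R : R) by lra.
have a100 : 100 <= log2 (l%:R : R) := N0P l Nl.
have dF x : 1 < x -> is_derive x 1 (G \o @log2 R) (log2 x `^ (- beta) * (x^-1 / ln 2)).
  move=> x1; have x0 : 0 < x by lra.
  apply: is_derive1_comp; last exact: is_derive_log2.
  by apply: dG; rewrite /log2 divr_gt0 ?ln2_gt0// ln_gt0.
have jj : (j%:R : R) < j.+1%:R by rewrite ltr_nat.
have [x||x] := @MVT R (G \o @log2 R) (fun x => log2 x `^ (- beta) * (x^-1 / ln 2)) _ _ jj.
- by rewrite in_itv /= => /andP[jx _]; apply: dF; lra.
- apply: derivable_within_continuous => x; rewrite in_itv /= => /andP[jx _].
  by have [|? _] := dF x; first by lra.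
rewrite in_itv /= => /andP[jx xj] ->.
have -> : (j.+1%:R - j%:R : R) = 1 by rewrite -natr1; ring.
rewrite mulr1.
have xS : x <= j%:R + 1 by rewrite natr1 ltW.
have lx : l%:R <= x by rewrite (le_trans _ (ltW jx))// ler_nat.
have x0 : 0 < x by lra.
set a := log2 l%:R in a100 *; set b := log2 x.
have ab : a <= b by exact: log2_le.
have ba : b <= a + 1.
  have -> : (1 : R) = log2 2 by rewrite /log2 divff// gt_eqF// ln2_gt0.
  rewrite /a -log2M//; apply: log2_le => //; rewrite -natrM.
  by apply: (le_trans (ltW xj)); rewrite ler_nat mulnC.
have a0 : 0 < a by apply: lt_le_trans a100; lra.
have b0 : 0 < b by exact: lt_le_trans ab.
(* Monotonicity of y^(1 - beta) compares the two weights whatever the sign of beta: u <= (b / a) v,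
   with b / a at most 101/100 because a >= 100 and b <= a + 1. *)
have pw : a * a `^ (- beta) <= b * b `^ (- beta).
  have E y : 0 < y -> y * y `^ (- beta) = y `^ (1 - beta).
    move=> y0.
    have h : (1 + - beta == 0) ==> (y != 0) by rewrite (gt_eqF y0) implybT.
    by rewrite (powRD h) powRr1// ltW.
  rewrite !E//; apply: ge0_ler_powR; rewrite ?nnegrE ?subr_ge0 ?(ltW a0) ?(ltW b0)//.
set u := a `^ (- beta) in pw *; set v := b `^ (- beta) in pw *.
have v0 : 0 < v by rewrite powR_gt0.
have uv : u <= 101/100 * v.
  rewrite -(ler_pM2l a0); apply: (le_trans pw).
  rewrite mulrA ler_wpM2r ?(ltW v0)//; lra.
have L0 := ln2_gt0; have L1 := ln2_le.
(* With ln 2 <= 3/4 the left coefficient is about 0.761, against 0.96 * 4/5 = 0.768 on the right; j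
   >= 1000 covers the rounding in [l] and the unit step in [x]. *)
have key : 201/200 * (101/100) * (x * ln 2) <= 96/100 * l%:R.
  have : x * ln 2 <= x * (3/4) by rewrite ler_wpM2l// ltW.
  lra.
have xL0 : 0 < x * ln 2 by rewrite mulr_gt0.
have -> : v * (x^-1 / ln 2) = v / (x * ln 2) by rewrite invfM mulrA.
rewrite [leRHS]mulrA ler_pdivlMr//.
apply: (@le_trans _ _ (201/200 * (l%:R^-1 * (101/100 * v)) * (x * ln 2))).
  have p201 : 0 <= 201/200 :> R := divr_ge0 (ler0n R 201) (ler0n R 200).
  by apply: (ler_wpM2r (ltW xL0)); apply: (ler_wpM2l p201); rewrite ler_wpM2l// invr_ge0 ltW.
have -> : 201/200 * (l%:R^-1 * (101/100 * v)) * (x * ln 2) =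
  l%:R^-1 * v * (201/200 * (101/100) * (x * ln 2)) by ring.
apply: (@le_trans _ _ (l%:R^-1 * v * (96/100 * l%:R))).
  by rewrite ler_wpM2l// mulr_ge0 ?invr_ge0 ?(ltW l0) ?(ltW v0).
rewrite le_eqVlt; apply/orP; left; apply/eqP.
by field; rewrite gt_eqF.
Qed.

End rates.

Section tails.
Context {d : measure_display} {T : measurableType d} {R : realType}
  (P : probability T R) (X : int -> {RV P >-> R}).

(** The increments of [G] telescope. The function [G] treats both rates at once: it is the logarithm
    for beta = 1 and y^(1 - beta) / (1 - beta) for beta < 1. *)
Lemma rho_gap_sum_bound (alpha beta : R) (G : R -> R) : 0 < alpha -> beta <= 1 ->
  (forall y : R, 0 < y -> is_derive y 1 G (y `^ (- beta))) ->
  rho X n @[n --> \oo] --> 0%E ->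
  (\forall n \near \oo, (rho X n <=
    (alpha * (log2 n%:R)^-1 * log2 (log2 n%:R) `^ (- beta))%:E)%E) ->
  exists C N, forall i, (N <= i)%N ->
    201/100 * rho_gap_sum X i <= C + 2 * (96/100 * alpha) * G (log2 i%:R).
Proof.
move=> al0 b1 dG rho0 [N1 _ N1P].
have [N2 N2P] := rho_gap_small rho0 ltr01.
have [N3 N3P] := gap_ge N1.
have [N4 N4P] := powR_log_increment b1 dG.
pose N := maxn N2 (maxn N3 N4).
have step i : (N <= i)%N -> 201/200 * rho_gap X i <=
    96/100 * alpha * (G (log2 i.+1%:R) - G (log2 i%:R)).
  rewrite !geq_max => /and3P[/N2P[rE _] /N3P /N1P /= rle /N4P inc].
  move: rle; rewrite rE lee_fin /gap log2_exp2 => rle.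
  have := ler_wpM2l (ltW al0) inc; lra.
exists (201/100 * rho_gap_sum X N - 2 * (96/100 * alpha) * G (log2 N%:R)), N => i.
elim: i => [|i IH].
  by rewrite leqn0 => /eqP ->; lra.
rewrite leq_eqVlt => /predU1P[<-|]; first by lra.
by rewrite ltnS => Ni; have := IH Ni; have := step i Ni; rewrite rho_gap_sumS; lra.
Qed.

(** Beyond the level the exponential is at most C Phi, so the product is bounded by the integral of
    |C| X_0^2 Phi (X_0) over |X_0| > level, which vanishes by dominated convergence. *)
Lemma tail2_small (Phi : R -> R) (C : R) :
  measurable_fun setT (X 0 : T -> R) -> measurable_fun setT Phi ->
  (forall x, 0 <= Phi x) -> rint P (fun w => X 0 w ^+ 2 * Phi (X 0 w)) ->
  (exists N, forall i, (N <= i)%N -> forall x, level i < `|x| ->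
     expR (201/100 * rho_gap_sum X i) <= C * Phi x) ->
  forall e : R, 0 < e -> exists N, forall i, (N <= i)%N ->
  expR (201/100 * rho_gap_sum X i) * tail2 X (level i) <= e.
Proof.
move=> mX mPhi Phi0 IPhi [N0 N0P] e e0.
pose h w := X 0 w ^+ 2 * Phi (X 0 w).
pose F i w := `|C| * (if `|X 0 w| <= level i then 0 else h w).
have h0 w : 0 <= h w by rewrite mulr_ge0 ?sqr_ge0.
have mh : measurable_fun setT h by exact: rint_measurable IPhi.
have mF i : measurable_fun setT (F i).
  apply: measurable_funM => //; apply: measurable_fun_ifT => //.
  apply: measurable_fun_ler; last exact: measurable_cst.
  exact: (measurableT_comp _ mX).
have Fh i w : `|F i w| <= `|C| * h w.
  by rewrite /F normrM normr_id ler_wpM2l//; case: ifP => _; rewrite ?normr0 ?(ger0_norm (h0 w)).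
have lev (x : R) : exists N, forall i, (N <= i)%N -> x <= level i.
  have x01 : 0 <= (10/11 : R) < 1 by lra.
  have y0 : 0 < (`|x| + 1)^-1 by rewrite invr_gt0 ltr_wpDl.
  have [N NP] := exprn_cvgn_small x01 y0.
  exists N => i /NP; have -> : (10/11 : R) ^+ i = (level i)^-1.
    by rewrite /level -exprVn; congr (_ ^+ _); lra.
  rewrite lef_pV2 ?posrE ?ltr_wpDl//; last by rewrite exprn_gt0//; lra.
  have := ler_norm x; lra.
have cF w : F n w @[n --> \oo] --> (fun=> 0 : R) w.
  apply: cvg_near_cst; have [N NP] := lev `|X 0 w|.
  by exists N => // i /= /NP hi; rewrite /F hi mulr0.
have := Ex_dominated_cvg mF (rintZ `|C| IPhi) Fh cF.
rewrite Ex_cst => /cvgrPdist_le /(_ e e0)[N1 _ N1P].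
exists (maxn N0 N1) => i; rewrite geq_max => /andP[/N0P hi /N1P /=].
rewrite sub0r normrN => hF.
have IF : rint P (F i) by exact: (rint_le (mF i) (rintZ `|C| IPhi) (Fh i)).
apply: le_trans hF; apply: le_trans (ler_norm _).
set E := expR _ in hi *.
have E0 : 0 < E by exact: expR_gt0.
have bnd w : E * (X 0 w - trunc (level i) (X 0 w)) ^+ 2 <= F i w.
  rewrite /trunc /F; case: ifPn => [_|]; first by rewrite subrr expr0n mulr0 mulr0.
  rewrite -ltNge subr0 => /hi hw.
  rewrite /h [leRHS]mulrCA [leLHS]mulrC ler_wpM2l ?sqr_ge0//.
  by apply: (le_trans hw); rewrite ler_wpM2r// ler_norm.
have mtr : measurable_fun setT (fun w => (X 0 w - trunc (level i) (X 0 w)) ^+ 2).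
  apply: measurable_funX; apply: measurable_funB => //.
  exact: (measurableT_comp (measurable_trunc _) mX).
have Itr : rint P (fun w => (X 0 w - trunc (level i) (X 0 w)) ^+ 2).
  apply: (rint_le mtr (rintZ E^-1 IF)) => w.
  by rewrite ger0_norm ?sqr_ge0// mulrC ler_pdivlMr// mulrC.
by rewrite /tail2 -ExZ//; apply: Ex_le => //; exact: rintZ.
Qed.

End tails.

Section moment_conditions.
Context {d : measure_display} {T : measurableType d} {R : realType}
  (P : probability T R) (X : int -> {RV P >-> R}).

(** As (11/10)^8 >= 2, the logarithm of the level is at least i / 8, and 3 = log 8. *)
Lemma loglog_level i (x : R) : (8 <= i)%N -> level i < `|x| ->
  log2 i%:R - 3 <= log2p (log2p `|x|).
Proof.
move=> i8 xi; have i80 : 8 <= (i%:R : R) by rewrite ler_nat.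
have l0 : 0 < level i :> R by rewrite exprn_gt0//; lra.
have x0 : 0 < `|x| by exact: lt_trans xi.
have h1 : 1/8 <= log2 (11/10 : R).
  have := @log2_le R 2 ((11/10) ^+ 8) (ltac:(lra)) (ltac:(rewrite !exprS expr0; lra)).
  rewrite /log2 lnXn; last by lra.
  rewrite divff ?gt_eqF ?ln2_gt0// -[_ *+ 8]mulr_natr mulrAC; lra.
have h2 : i%:R / 8 <= log2p `|x|.
  apply: (@le_trans _ _ (log2 (level i))).
    rewrite /level /log2 lnXn; last by lra.
    by rewrite -[_ *+ i]mulr_natr mulrAC; move: h1; rewrite /log2; nra.
  by apply: log2_le => //; rewrite le_max (ltW xi).
have i0 : 0 < (i%:R / 8 : R) by lra.
apply: (@le_trans _ _ (log2 (i%:R / 8))); last first.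
  by apply: log2_le => //; rewrite le_max h2.
have e3 : log2 (8%:R : R) = 3 by rewrite -[8%N]/(2 ^ 3)%N log2_exp2.
have -> : log2 (i%:R : R) = log2 (i%:R / 8) + 3.
  by rewrite -e3 -log2M// divfK.
lra.
Qed.

(** The factor 96/100 left over from summing the rate absorbs the shift by 3 in the iterated
    logarithm. The formula for [Phi] is required only at positive arguments, since a power of 0 is
    not the exponential of a multiple of the conventional logarithm of 0. *)
Lemma exp_rho_gap_sum_le (alpha beta : R) (G Phi : R -> R) :
  0 < alpha -> beta <= 1 ->
  (forall y : R, 0 < y -> is_derive y 1 G (y `^ (- beta))) ->
  (forall x y, 0 < x -> x <= y -> G x <= G y) ->
  (exists Y, forall y, Y <= y -> 96/100 * G y <= G (y - 3)) ->
  (forall x, 0 < log2p (log2p `|x|) ->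
     Phi x = expR (2 * alpha * G (log2p (log2p `|x|)))) ->
  rho X n @[n --> \oo] --> 0%E ->
  (\forall n \near \oo, (rho X n <=
    (alpha * (log2 n%:R)^-1 * log2 (log2 n%:R) `^ (- beta))%:E)%E) ->
  exists C, exists N, forall i, (N <= i)%N -> forall x, level i < `|x| ->
    expR (201/100 * rho_gap_sum X i) <= C * Phi x.
Proof.
move=> al0 b1 dG mG [Y GY] PhiE rho0 rrho.
have [C [N1 N1P]] := rho_gap_sum_bound al0 b1 dG rho0 rrho.
have [N2 N2P] := log2_large (Num.max Y 4).
exists (expR C), (maxn 8 (maxn N1 N2)) => i.
rewrite !geq_max => /and3P[i8 /N1P hR /N2P]; rewrite ge_max => /andP[hY h4] x xi.
have hL := loglog_level i8 xi.
have L0 : 0 < log2p (log2p `|x|) by lra.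
rewrite PhiE// -expRD ler_expR (le_trans hR)// lerD2l.
have h1 := GY _ hY.
have h2 : G (log2 i%:R - 3) <= G (log2p (log2p `|x|)) by apply: mG => //; lra.
have : 96/100 * G (log2 i%:R) <= G (log2p (log2p `|x|)) by lra.
move=> /(ler_wpM2l (ltW al0)); lra.
Qed.

Lemma measurable_log2p : measurable_fun setT (@log2p R).
Proof.
apply: measurable_funM => //; apply: (measurableT_comp (@measurable_ln R)).
exact: measurable_maxr.
Qed.

Let mLL : measurable_fun setT (fun x : R => log2p (log2p `|x|)).
Proof.
apply: (measurableT_comp measurable_log2p).
exact: (measurableT_comp measurable_log2p).
Qed.

Lemma rint_lty (f : T -> R) : measurable_fun setT f -> (forall w, 0 <= f w) ->
  ('E_P[f] < +oo)%E -> rint P f.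
Proof.
move=> mf f0 Ef; apply/integrableP; split; first exact/measurable_EFinP.
under eq_integral do rewrite /= ger0_norm//.
by move: Ef; rewrite unlock.
Qed.

Lemma tail_condition (alpha beta : R) : measurable_fun setT (X 0 : T -> R) ->
  rho X n @[n --> \oo] --> 0%E -> 0 < alpha -> beta < 1 ->
  (('E_P[fun w => (X 0 w ^+ 2 *
        log2p (log2p `|X 0 w|) `^ (2 * alpha))%R] < +oo)%E /\
   \forall n \near \oo, (rho X n <=
     (alpha * (log2 n%:R)^-1 * (log2 (log2 n%:R))^-1)%:E)%E)
  \/
  (('E_P[fun w => (X 0 w ^+ 2 *
        expR (2 * alpha * log2p (log2p `|X 0 w|) `^ (1 - beta)
              / (1 - beta)))%R] < +oo)%E /\
   \forall n \near \oo, (rho X n <=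
     (alpha * (log2 n%:R)^-1 * log2 (log2 n%:R) `^ (- beta))%:E)%E) ->
  forall e : R, 0 < e -> exists N, forall i, (N <= i)%N ->
  expR (201/100 * rho_gap_sum X i) * tail2 X (level i) <= e.
Proof.
move=> mX rho0 al0 b1 [] [Emom rrho].
- pose Phi (x : R) := log2p (log2p `|x|) `^ (2 * alpha).
  have mPhi : measurable_fun setT Phi by exact: (measurableT_comp (measurable_powR _)).
  have Phi0 x : 0 <= Phi x by exact: powR_ge0.
  have [||||||C [N CP]] := @exp_rho_gap_sum_le alpha 1 (@ln R) Phi al0 (lexx _).
  + by move=> y y0; rewrite powR_inv1 ?(ltW y0)//; exact: is_derive1_ln.
  + by move=> x y x0 xy; rewrite ler_ln// posrE// (lt_le_trans x0).
  (* ln (y - 3) >= ln y - ln 2, and ln 2 <= (ln y) / 25 from here on; 24/25 = 96/100. *)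
  + exists (2 ^+ 25) => y y25.
    have p25 : 32 <= (2 : R) ^+ 25.
      apply: (@le_trans _ _ (2 ^+ 5)); first by rewrite !exprS expr0; lra.
      by apply: ler_weXn2l => //; lra.
    have y0 : 0 < y by lra.
    have h1 : ln y - ln 2 <= ln (y - 3).
      rewrite -ln_div ?posrE// ler_ln ?posrE//; lra.
    have h2 : ln 2 *+ 25 <= ln y.
      by rewrite -lnXn// ler_ln ?posrE// exprn_gt0.
    rewrite -[ln 2 *+ 25]mulr_natr in h2; lra.
  + by move=> x x0; rewrite /Phi /powR gt_eqF.
  + exact: rho0.
  (* [powR_inv1] needs a nonnegative base: the iterated logarithm is nonnegative for n >= 4. *)
  + apply: filterS2 rrho (nbhs_infty_ge 4) => n h n4; apply: (le_trans h).
    rewrite lee_fin powR_inv1// /log2 divr_ge0 ?(ltW (ln2_gt0 R))//.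
    have n4R : 4 <= (n%:R : R) by rewrite ler_nat.
    apply: ln_ge0; rewrite ler_pdivlMr ?ln2_gt0// mul1r ler_ln ?posrE//; lra.
  apply: (tail2_small (Phi := Phi) (C := C)) => //; last by exists N.
  apply: rint_lty => //; last by move=> w; rewrite mulr_ge0 ?sqr_ge0.
  apply: measurable_funM; first exact: measurable_funX.
  exact: (measurableT_comp mPhi mX).
- pose G (y : R) := y `^ (1 - beta) / (1 - beta).
  have g0 : 0 < 1 - beta by rewrite subr_gt0.
  pose Phi (x : R) := expR (2 * alpha * log2p (log2p `|x|) `^ (1 - beta) / (1 - beta)).
  have mPhi : measurable_fun setT Phi.
    apply: (measurableT_comp (@measurable_expR R)); apply: measurable_funM => //.
    apply: measurable_funM => //.
    exact: (measurableT_comp (measurable_powR _)).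
  have Phi0 x : 0 <= Phi x by exact: expR_ge0.
  have [||||||C [N CP]] := @exp_rho_gap_sum_le alpha beta G Phi al0 (ltW b1).
  + move=> y y0.
    have -> : G = (1 - beta)^-1 *: (@powR R ^~ (1 - beta)).
      by apply/funext => z; rewrite /G mulrC.
    apply: (is_derive_eq (is_deriveZ (1 - beta)^-1 (is_derive1_powR (1 - beta) y0))).
    rewrite -[LHS]/((1 - beta)^-1 * ((1 - beta) * y `^ (1 - beta - 1))).
    by rewrite mulKf ?gt_eqF//; congr (_ `^ _); ring.
  + move=> x y x0 xy; rewrite /G ler_pM2r ?invr_gt0//.
    by apply: ge0_ler_powR; rewrite ?nnegrE ?(ltW g0)//; lra.
  (* [s] is the dilation with s^(1 - beta) = 96/100; since s < 1, the shift by 3 is eventually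
     weaker than it. *)
  + pose s : R := (96/100) `^ (1 - beta)^-1.
    have s0 : 0 < s by rewrite powR_gt0//; lra.
    have s1 : s < 1.
      have one : (1 : R) `^ (1 - beta)^-1 = 1 by rewrite powR1.
      by rewrite -[ltRHS]one; apply: gt0_ltr_powR; rewrite ?nnegrE ?invr_gt0//; lra.
    exists (3 / (1 - s)) => y ys.
    have y0 : 0 < y by apply: lt_le_trans ys; rewrite divr_gt0 ?subr_gt0.
    have sy : s * y <= y - 3.
      by move: ys; rewrite ler_pdivrMr ?subr_gt0//; lra.
    rewrite /G mulrA ler_pM2r ?invr_gt0//.
    have -> : (96/100 : R) = s `^ (1 - beta).
      by rewrite /s -powRrM mulVf ?gt_eqF// powRr1//; lra.
    rewrite -powRM ?(ltW s0) ?(ltW y0)//.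
    have sy0 : 0 < s * y by rewrite mulr_gt0.
    by apply: ge0_ler_powR; rewrite ?nnegrE ?(ltW g0) ?(ltW sy0)//; lra.
  + by move=> x x0; rewrite /Phi /G mulrA.
  + exact: rho0.
  + exact: rrho.
  apply: (tail2_small (Phi := Phi) (C := C)) => //; last by exists N.
  apply: rint_lty => //; last by move=> w; rewrite mulr_ge0 ?sqr_ge0.
  apply: measurable_funM; first exact: measurable_funX.
  exact: (measurableT_comp mPhi mX).
Qed.

End moment_conditions.

(** * Cosine transforms of block sums *)

Section trigonometric_bounds.
Variable R : realType.
Implicit Types x y a b c : R.

Lemma lipschitz1_derive (f df : R -> R) : (forall x, is_derive x 1 f (df x)) ->
  (forall x, `|df x| <= 1) -> forall x y, `|f x - f y| <= `|x - y|.
Proof.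
move=> Hf df1; have K x y : x < y -> `|f y - f x| <= `|y - x|.
  move=> xy; have [|z _ ->] := @MVT R f df _ _ xy.
    by apply: derivable_within_continuous => z _; have [] := Hf z.
  by rewrite normrM ler_piMl.
move=> x y; have [xy|yx|->] := ltgtP x y; last by rewrite !subrr.
- by rewrite distrC [leRHS]distrC; exact: K.
- exact: K.
Qed.

Lemma sin_lipschitz x y : `|sin x - sin y| <= `|x - y|.
Proof. exact: (lipschitz1_derive (@is_derive_sin R) (@cos_max R)). Qed.

Lemma cos_lipschitz x y : `|cos x - cos y| <= `|x - y|.
Proof.
apply: (lipschitz1_derive (@is_derive_cos R)) => z.
by rewrite normrN; exact: sin_max.
Qed.

Lemma norm_sin_le x : `|sin x| <= `|x|.
Proof. by have := sin_lipschitz x 0; rewrite sin0 !subr0. Qed.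

Lemma one_sub_cos x : 1 - cos x = 2 * sin (x / 2) ^+ 2.
Proof.
have {1}-> : x = (x / 2) *+ 2 by rewrite -mulr_natr; field.
by rewrite cos_mulr2n sin2cos2; ring.
Qed.

Lemma one_sub_cos_le x : 0 <= 1 - cos x <= x ^+ 2 / 2.
Proof.
rewrite one_sub_cos mulr_ge0 ?sqr_ge0//=.
have : sin (x / 2) ^+ 2 <= (x / 2) ^+ 2.
  rewrite -(real_normK (num_real (sin _))) -(real_normK (num_real (x / 2))).
  by rewrite lerXn2r ?nnegrE ?norm_sin_le.
rewrite expr_div_n; lra.
Qed.

Lemma sin_sub_id_le x : `|sin x - x| <= `|x| ^+ 3 / 2.
Proof.
have dF (z : R) : is_derive z 1 (fun u : R => sin u - u) (cos z - 1).
  by apply: is_deriveB.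
have K y : 0 < y -> `|sin y - y| <= y ^+ 3 / 2.
  move=> y0; have [|z] := @MVT R (fun u : R => sin u - u) (fun u => cos u - 1) _ _ y0.
    by apply: derivable_within_continuous => z _; have [] := dF z.
  rewrite in_itv /= => /andP[z0 zy]; rewrite sin0 !subr0 => ->.
  have /andP[h1 h2] := one_sub_cos_le z.
  rewrite normrM [`|y|]gtr0_norm// distrC ger0_norm//.
  have : z ^+ 2 <= y ^+ 2 by rewrite lerXn2r ?nnegrE ?ltW.
  rewrite exprS; nra.
have [x0|x0|->] := ltgtP x 0.
- have := K (- x); rewrite oppr_gt0 => /(_ x0).
  by rewrite sinN -opprD normrN (ltr0_norm x0).
- by rewrite (gtr0_norm x0); exact: K.
- by rewrite sin0 subrr normr0 expr0n mul0r.
Qed.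

(* Splitting [x = a + b] into a moderate part [a] and a small part [b], the
   remainders need a fourth, resp. third, moment of [a] but only a second
   moment of [b]. *)
Lemma cos_taylor2_split a b :
  `|cos (a + b) - 1 + (a + b) ^+ 2 / 2| <= 2 * a ^+ 4 + 2 * b ^+ 2.
Proof.
set x := a + b.
have /andP[c0 c1] := one_sub_cos_le x.
have g0 : 0 <= cos x - 1 + x ^+ 2 / 2 by lra.
rewrite ger0_norm//.
have g4 : cos x - 1 + x ^+ 2 / 2 <= x ^+ 4 / 8.
  (* By the half-angle formula the remainder is a difference of two squares, so the cubic bound on
     sin suffices. *)
  have -> : cos x - 1 + x ^+ 2 / 2 = 2 * ((x / 2 - sin (x / 2)) * (x / 2 + sin (x / 2))).
    have := one_sub_cos x; rewrite expr2 => h.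
    have -> : cos x = 1 - 2 * (sin (x / 2) * sin (x / 2)) by lra.
    by field.
  have h1 : `|(x / 2 - sin (x / 2)) * (x / 2 + sin (x / 2))| <=
      (`|x / 2| ^+ 3 / 2) * (2 * `|x / 2|).
    rewrite normrM; apply: ler_pM => //.
      by rewrite distrC sin_sub_id_le.
    by apply: (le_trans (ler_normD _ _)); have := norm_sin_le (x / 2); lra.
  have h2 := le_trans (ler_norm _) h1.
  have h3 : `|x / 2| ^+ 3 / 2 * (2 * `|x / 2|) = x ^+ 4 / 16.
    have -> : `|x / 2| ^+ 3 / 2 * (2 * `|x / 2|) = `|x / 2| ^+ 4 by field.
    by rewrite -normrX ger0_norm ?exprn_even_ge0//; field.
  rewrite h3 in h2; lra.
have [ab|ab] := lerP (a ^+ 2) (b ^+ 2).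
  have : x ^+ 2 <= 4 * b ^+ 2 by rewrite /x; have := sqr_ge0 (a - b); nra.
  have : 0 <= a ^+ 4 by rewrite exprn_even_ge0.
  lra.
have x2 : x ^+ 2 <= 4 * a ^+ 2 by rewrite /x; have := sqr_ge0 (a - b); nra.
have : x ^+ 4 <= 16 * a ^+ 4.
  have -> : x ^+ 4 = (x ^+ 2) ^+ 2 by rewrite -exprM.
  have -> : 16 * a ^+ 4 = (4 * a ^+ 2) ^+ 2 by ring.
  by rewrite lerXn2r ?nnegrE ?sqr_ge0// mulr_ge0 ?sqr_ge0.
have := sqr_ge0 b; lra.
Qed.

Lemma sin_taylor1_split a b :
  `|sin (a + b) - (a + b)| <= 4 * `|a| ^+ 3 + 4 * b ^+ 2.
Proof.
set x := a + b.
have h1 := sin_sub_id_le x.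
have h2 : `|sin x - x| <= 2 * `|x|.
  by apply: (le_trans (ler_normB _ _)); have := norm_sin_le x; lra.
have x0 := normr_ge0 x; have a0 := normr_ge0 a; have b0 := normr_ge0 b.
have xab : `|x| <= `|a| + `|b| by exact: ler_normD.
rewrite -(real_normK (num_real b)).
move: h1 h2 x0 a0 b0 xab.
move: (`|sin x - x|) `|x| `|a| `|b| => s y u v h1 h2 y0 u0 v0 yuv.
have u3 : 0 <= u ^+ 3 by rewrite exprn_ge0.
have [uv|vu] := lerP u v.
  have sy : s <= y ^+ 2.
    have [y2|y2] := lerP y 2; last by nra.
    by apply: (le_trans h1); rewrite exprS; nra.
  have : y ^+ 2 <= (2 * v) ^+ 2 by rewrite lerXn2r ?nnegrE; lra.
  rewrite exprMn; lra.
have : y ^+ 3 <= (2 * u) ^+ 3 by rewrite lerXn2r ?nnegrE; lra.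
have := sqr_ge0 v; rewrite exprMn !exprS expr0; lra.
Qed.

Lemma expR_taylor1 x : 0 <= x -> `|1 - x - expR (- x)| <= x ^+ 2.
Proof.
move=> x0; have h1 := expR_ge1Dx (- x); have h2 := expR_ge1Dx x.
have p : 0 < 1 + x by lra.
rewrite ler0_norm; last by lra.
have : expR (- x) <= (1 + x)^-1.
  by rewrite expRN lef_pV2 ?posrE ?expR_gt0.
have : (1 + x)^-1 <= 1 - x + x ^+ 2.
  rewrite -[leLHS]mul1r ler_pdivrMr//; nra.
lra.
Qed.

Lemma measurable_cos : measurable_fun setT (@cos R).
Proof. by apply: continuous_measurable_fun; exact: continuous_cos. Qed.

Lemma measurable_sin : measurable_fun setT (@sin R).
Proof. by apply: continuous_measurable_fun; exact: continuous_sin. Qed.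

End trigonometric_bounds.

Section block_characteristic.
Context {d : measure_display} {T : measurableType d} {R : realType}
  (P : probability T R) (X : int -> {RV P >-> R}).
Hypothesis statX : strictly_stationary X.
Hypothesis sqX : sqint P (X 0).
Hypothesis EX0 : Ex P (X 0) = 0.

Local Notation S := (bsum X id).

Let mid : measurable_fun setT (@id R).
Proof. exact: measurable_id. Qed.

Let sS a m : sqint P (S a m).
Proof. by apply: sqint_bsum => t; exact: (sqint_stationary t statX mid sqX). Qed.

Let mS a m : measurable_fun setT (S a m).
Proof. exact: (proj1 (sS a m)). Qed.

Let mcos (f : T -> R) : measurable_fun setT f -> measurable_fun setT (fun w => cos (f w)).
Proof. by move=> mf; exact: (measurableT_comp (@measurable_cos R) mf). Qed.

Let msin (f : T -> R) : measurable_fun setT f -> measurable_fun setT (fun w => sin (f w)).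
Proof. by move=> mf; exact: (measurableT_comp (@measurable_sin R) mf). Qed.

Lemma rint_cos (f : T -> R) : measurable_fun setT f -> rint P (fun w => cos (f w)).
Proof.
by move=> /mcos mf; exact: (@rint_bounded _ _ _ P _ 1 mf (fun w => cos_max _)).
Qed.

Lemma rint_sin (f : T -> R) : measurable_fun setT f -> rint P (fun w => sin (f w)).
Proof.
by move=> /msin mf; exact: (@rint_bounded _ _ _ P _ 1 mf (fun w => sin_max _)).
Qed.

(** After scaling, the low part has fourth moment at most C tau^4 and the high part second moment at
    most e tau^2, as the split Taylor bounds demand; the linear term of sin vanishes because the
    block is centred. With tau = t / sqrt k, summing [eta] over k blocks leaves O(t^3 / sqrt k) +
    O(e t^2). *)
Lemma single_block (f g : R -> R) m (s tau e C : R) :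
  centered X f -> centered X g -> (forall x, x = f x + g x) -> 0 < s -> 0 <= tau <= 1 ->
  rint P (fun w => bsum X f 0 m w ^+ 4) ->
  s ^+ 2 = mom2 X id m -> mom2 X g m <= e * s ^+ 2 -> mom4 X f m <= C * s ^+ 4 ->
  let eta := 4 * (1 + C) * tau ^+ 3 + 4 * e * tau ^+ 2 in
  `|Ex P (fun w => cos (tau / s * S 0 m w)) - (1 - tau ^+ 2 / 2)| <= eta /\
  `|Ex P (fun w => sin (tau / s * S 0 m w))| <= eta.
Proof.
move=> [mf sf _] [mg sg _] fg s0 /andP[t0 t1] i4 s2 hg hf eta.
pose A w := tau / s * bsum X f 0 m w; pose B w := tau / s * bsum X g 0 m w.
have sb h : measurable_fun setT h -> sqint P (fun w => h (X 0 w)) -> sqint P (bsum X h 0 m).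
  by move=> mh sh; apply: sqint_bsum => t; exact: (sqint_stationary t statX mh sh).
have sA : sqint P A by exact: sqintZ (sb f mf sf).
have sB : sqint P B by exact: sqintZ (sb g mg sg).
have AB w : tau / s * S 0 m w = A w + B w.
  rewrite -mulrDr; congr (_ * _); rewrite /bsum -big_split /=.
  by apply: eq_bigr => j _; rewrite -fg.
have sn : s != 0 by rewrite gt_eqF.
have EB2 : Ex P (fun w => B w ^+ 2) <= e * tau ^+ 2.
  rewrite (_ : (fun w => B w ^+ 2) = fun w => (tau / s) ^+ 2 * bsum X g 0 m w ^+ 2); last first.
    by apply/funext => w; rewrite exprMn.
  rewrite ExZ; last exact: (proj2 (sb g mg sg)).
  have -> : e * tau ^+ 2 = (tau / s) ^+ 2 * (e * s ^+ 2) by field.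
  by rewrite ler_wpM2l ?sqr_ge0.
have IB2 : rint P (fun w => B w ^+ 2) by exact: (proj2 sB).
have IA4 : rint P (fun w => A w ^+ 4).
  rewrite (_ : (fun w => A w ^+ 4) = fun w => (tau / s) ^+ 4 * bsum X f 0 m w ^+ 4).
    exact: rintZ.
  by apply/funext => w; rewrite exprMn.
have EA4 : Ex P (fun w => A w ^+ 4) <= C * tau ^+ 4.
  rewrite (_ : (fun w => A w ^+ 4) = fun w => (tau / s) ^+ 4 * bsum X f 0 m w ^+ 4).
    rewrite ExZ//; have -> : C * tau ^+ 4 = (tau / s) ^+ 4 * (C * s ^+ 4) by field.
    by rewrite ler_wpM2l// exprn_even_ge0.
  by apply/funext => w; rewrite exprMn.
have C0 : 0 <= C.
  have := le_trans (mom4_ge0 X f m) hf; rewrite pmulr_lge0//.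
  by rewrite exprn_gt0.
have V1 : Ex P (fun w => (tau / s * S 0 m w) ^+ 2) = tau ^+ 2.
  rewrite (_ : (fun w => _) = fun w => (tau / s) ^+ 2 * S 0 m w ^+ 2); last first.
    by apply/funext => w; rewrite exprMn.
  rewrite ExZ; last exact: (proj2 (sS 0 m)).
  rewrite -[Ex P _]/(mom2 X id m) -s2; field; exact: sn.
have sV : sqint P (fun w => tau / s * S 0 m w) by exact: sqintZ.
have tau43 : tau ^+ 4 <= tau ^+ 3 by rewrite exprS ler_piMl// exprn_ge0.
have tau3 : 0 <= tau ^+ 3 by rewrite exprn_ge0.
have tau2 : 0 <= tau ^+ 2 by rewrite exprn_ge0.
have eB : 0 <= e * tau ^+ 2.
  by apply: le_trans EB2; apply: Ex_ge0 => w; exact: sqr_ge0.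
split.
- have I1 := rint_cos (proj1 sV).
  have I2 : rint P (fun w => (tau / s * S 0 m w) ^+ 2 / 2).
    rewrite (_ : (fun w => _) = fun w => 2^-1 * (tau / s * S 0 m w) ^+ 2).
      exact: (rintZ 2^-1 (proj2 sV)).
    by apply/funext => w; rewrite mulrC.
  have E2 : Ex P (fun w => (tau / s * S 0 m w) ^+ 2 / 2) = tau ^+ 2 / 2.
    rewrite (_ : (fun w => _) = fun w => 2^-1 * (tau / s * S 0 m w) ^+ 2).
      by rewrite (ExZ _ (proj2 sV)) V1 mulrC.
    by apply/funext => w; rewrite mulrC.
  have -> : Ex P (fun w => cos (tau / s * S 0 m w)) - (1 - tau ^+ 2 / 2) =
    Ex P (fun w => cos (tau / s * S 0 m w) - 1 + (tau / s * S 0 m w) ^+ 2 / 2).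
    rewrite ExD//; last by apply: rintB => //; exact: rint_cst.
    by rewrite ExB// ?Ex_cst ?E2; [ring|exact: rint_cst].
  apply: (@le_trans _ _ (Ex P (fun w => 2 * A w ^+ 4 + 2 * B w ^+ 2))).
    apply: Ex_norm_le.
    + by apply: rintD => //; apply: rintB => //; exact: rint_cst.
    + by apply: rintD; exact: rintZ.
    + by move=> w; rewrite AB; exact: cos_taylor2_split.
  rewrite ExD; [|exact: rintZ..]; rewrite !ExZ//.
  have := ler_wpM2l C0 tau43; rewrite /eta; nra.
- have I1 := rint_sin (proj1 sV).
  have I0 : rint P (fun w => tau / s * S 0 m w) by exact: sqint_rint.
  have E0 : Ex P (fun w => tau / s * S 0 m w) = 0.
    rewrite ExZ; last exact: sqint_rint.
    by rewrite (Ex_bsum statX mid sqX EX0) mulr0.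
  have -> : Ex P (fun w => sin (tau / s * S 0 m w)) =
    Ex P (fun w => sin (tau / s * S 0 m w) - tau / s * S 0 m w).
    by rewrite ExB// E0 subr0.
  pose y w := s^-1 * bsum X f 0 m w.
  have y4E : (fun w => y w ^+ 4) = fun w => s^-1 ^+ 4 * bsum X f 0 m w ^+ 4.
    by apply/funext => w; rewrite exprMn.
  have Iy : rint P (fun w => y w ^+ 4) by rewrite y4E; exact: rintZ.
  have Ey : Ex P (fun w => y w ^+ 4) <= C.
    rewrite y4E ExZ// -[Ex P _]/(mom4 X f m).
    have -> : C = s^-1 ^+ 4 * (C * s ^+ 4) by field.
    by rewrite ler_wpM2l// exprn_ge0// invr_ge0 ltW.
  have t3 w : `|A w| ^+ 3 <= tau ^+ 3 * (1 + y w ^+ 4).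
    have -> : A w = tau * y w by rewrite /A /y mulrA.
    rewrite normrM exprMn (ger0_norm t0) ler_wpM2l//.
    have -> : y w ^+ 4 = `|y w| ^+ 4 by rewrite -normrX ger0_norm ?exprn_even_ge0.
    have [y1|y1] := lerP `|y w| 1.
      by rewrite ler_wpDr ?exprn_ge0// exprn_ile1.
    by rewrite ler_wpDl// ler_weXn2l// ltW.
  have I1y : rint P (fun w => 1 + y w ^+ 4) by apply: rintD => //; exact: rint_cst.
  have It := rintZ (tau ^+ 3) I1y; have I4t := rintZ 4 It; have I4B := rintZ 4 IB2.
  apply: (@le_trans _ _ (Ex P (fun w => 4 * (tau ^+ 3 * (1 + y w ^+ 4)) + 4 * B w ^+ 2))).
    apply: Ex_norm_le; [exact: rintB|exact: rintD|move=> w].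
    rewrite AB; apply: (le_trans (sin_taylor1_split _ _)).
    by rewrite lerD2r ler_wpM2l.
  rewrite (ExD I4t I4B) (ExZ 4 It) (ExZ _ I1y) (ExZ 4 IB2) ExD//; last exact: rint_cst.
  rewrite Ex_cst /eta.
  have := ler_wpM2l tau3 Ey; nra.
Qed.

End block_characteristic.

Section block_iteration.
Context {d : measure_display} {T : measurableType d} {R : realType}
  (P : probability T R) (X : int -> {RV P >-> R}).
Hypothesis statX : strictly_stationary X.
Hypothesis sqX : sqint P (X 0).

Local Notation S := (bsum X id).

Let mid : measurable_fun setT (@id R).
Proof. exact: measurable_id. Qed.

Let sS a m : sqint P (S a m).
Proof. by apply: sqint_bsum => t; exact: (sqint_stationary t statX mid sqX). Qed.

Let mS a m : measurable_fun setT (S a m).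
Proof. exact: (proj1 (sS a m)). Qed.

Lemma bounded_bsum_cov (a : int) m (b : int) p (phi psi : R -> R) n (r : R) :
  measurable_fun setT phi -> measurable_fun setT psi ->
  (forall x, `|phi x| <= 1) -> (forall x, `|psi x| <= 1) ->
  a + m%:Z + n%:Z <= b -> (rho X n <= r%:E)%E ->
  `|Ex P (fun w => phi (S a m w) * psi (S b p w)) -
    Ex P (fun w => phi (S a m w)) * Ex P (fun w => psi (S b p w))| <= r.
Proof.
move=> mphi mpsi phi1 psi1 amb rr.
have r0 : 0 <= r by rewrite -lee_fin (le_trans _ rr)// rho_ge0.
have sq (u : R -> R) k c : measurable_fun setT u -> (forall x, `|u x| <= 1) ->
    sqint P (fun w => u (S c k w)).
  move=> mu u1; apply: (@sqint_bounded _ _ _ P _ 1) => [|w]; last exact: u1.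
  exact: (measurableT_comp mu (mS c k)).
have sq1 (u : R -> R) k c : measurable_fun setT u -> (forall x, `|u x| <= 1) ->
    Num.sqrt (Ex P (fun w => u (S c k w) ^+ 2)) <= 1.
  move=> mu u1; rewrite -[leRHS]sqrtr1 ler_wsqrtr// -[leRHS](Ex_cst P).
  apply: Ex_le; [exact: (proj2 (sq u k c mu u1))|exact: rint_cst|move=> w].
  by rewrite -(real_normK (num_real _)) exprn_ile1.
apply: (le_trans (bsum_cov statX mid mid mphi mpsi (fun c => sq phi m c mphi phi1)
  (fun c => sq psi p c mpsi psi1) amb rr)).
rewrite ler_piMr//; apply: mulr_ile1; rewrite ?sqrtr_ge0//; exact: sq1.
Qed.

Lemma Ex_lipschitz_diff (f g h : T -> R) (u : R -> R) :
  (forall x y, `|u x - u y| <= `|x - y|) -> (forall w, `|f w - g w| <= `|h w|) ->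
  rint P (fun w => u (f w)) -> rint P (fun w => u (g w)) -> sqint P h ->
  `|Ex P (fun w => u (f w)) - Ex P (fun w => u (g w))| <=
  Num.sqrt (Ex P (fun w => h w ^+ 2)).
Proof.
move=> lu fgh If Ig sh; rewrite -ExB//; apply: le_trans (Ex_norm_sqrt sh).
apply: Ex_norm_le; first exact: rintB.
  by apply: rint_norm; exact: sqint_rint.
by move=> w; apply: (le_trans (lu _ _)); exact: fgh.
Qed.

(** After removal of the gap, the addition formula and decorrelation give E cos (A - c) E cos B' - E
    sin (A - c) E sin B', whose second product is small. The gap is removed once from the joint sum
    and put back once in each of the two factors, hence the coefficient 3; [eta] and [r] occur once
    for cos and once for sin. *)
Lemma block_step (c a kap eta r : R) m p q : (q <= p)%N ->
  (rho X q <= r%:E)%E -> 0 <= a ->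
  `|Ex P (fun w => cos (a * S 0 p w)) - kap| <= eta ->
  `|Ex P (fun w => sin (a * S 0 p w))| <= eta ->
  `|Ex P (fun w => cos (a * S 0 (m + p) w - c)) -
    kap * Ex P (fun w => cos (a * S 0 m w - c))|
  <= 2 * eta + 2 * r + 3 * (a * Num.sqrt (mom2 X id q)).
Proof.
move=> qp rr a0 hcos hsin.
pose B' := S (m%:Z + q%:Z) (p - q).
have maf (f : T -> R) : measurable_fun setT f -> measurable_fun setT (fun w => a * f w).
  by move=> mf; exact: measurable_funM.
have mac (f : T -> R) : measurable_fun setT f -> measurable_fun setT (fun w => a * f w - c).
  by move=> mf; apply: measurable_funB => //; exact: maf.
have maR : measurable_fun setT (fun x : R => a * x) by exact: measurable_funM.
have macR : measurable_fun setT (fun x : R => a * x - c) by exact: measurable_funB.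
have mcosR (u : R -> R) : measurable_fun setT u -> measurable_fun setT (fun x : R => cos (u x)).
  by move=> mu; exact: (measurableT_comp (@measurable_cos R) mu).
have msinR (u : R -> R) : measurable_fun setT u -> measurable_fun setT (fun x : R => sin (u x)).
  by move=> mu; exact: (measurableT_comp (@measurable_sin R) mu).
have split2 n : S 0 (m + n) = fun w => S 0 m w + S m%:Z n w.
  by apply/funext => w; rewrite bsum_add add0r.
have splitB w : S m%:Z p w = S m%:Z q w + B' w by rewrite /B' -bsum_add subnKC.
have sQ b : Num.sqrt (Ex P (fun w => (a * S b q w) ^+ 2)) = a * Num.sqrt (mom2 X id q).
  have -> : (fun w => (a * S b q w) ^+ 2) = fun w => a ^+ 2 * S b q w ^+ 2.
    by apply/funext => w; rewrite exprMn.
  rewrite ExZ; last exact: (proj2 (sS b q)).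
  by rewrite (mom2_bsum statX b q mid) sqrtrM ?sqr_ge0// sqrtr_sqr ger0_norm.
have saQ b : sqint P (fun w => a * S b q w) by exact: sqintZ.
set D := a * Num.sqrt (mom2 X id q) in sQ *.
have mu := mS 0 m; have mB := mS m%:Z p; have mB' : measurable_fun setT B' by exact: mS.
set E0 := Ex P (fun w => cos (a * S 0 m w - c)).
have h1 : `|Ex P (fun w => cos (a * S 0 (m + p) w - c)) -
    Ex P (fun w => cos ((a * S 0 m w - c) + a * B' w))| <= D.
  rewrite -(sQ m%:Z); apply: (Ex_lipschitz_diff (@cos_lipschitz R)).
  - move=> w; rewrite split2 /= splitB.
    by rewrite (_ : _ - _ = a * S m%:Z q w)//; ring.
  - by apply: rint_cos; exact: (mac _ (mS 0 (m + p)%N)).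
  - by apply: rint_cos; apply: measurable_funD; [exact: mac|exact: maf].
  - exact: saQ.
have h2 : `|Ex P (fun w => cos (a * B' w)) - Ex P (fun w => cos (a * S m%:Z p w))| <= D.
  rewrite -(sQ m%:Z); apply: (Ex_lipschitz_diff (@cos_lipschitz R)).
  - move=> w; rewrite splitB distrC (_ : _ - _ = a * S m%:Z q w)//; ring.
  - by apply: rint_cos; exact: maf.
  - by apply: rint_cos; exact: maf.
  - exact: saQ.
have h3 : `|Ex P (fun w => sin (a * B' w)) - Ex P (fun w => sin (a * S m%:Z p w))| <= D.
  rewrite -(sQ m%:Z); apply: (Ex_lipschitz_diff (@sin_lipschitz R)).
  - move=> w; rewrite splitB distrC (_ : _ - _ = a * S m%:Z q w)//; ring.
  - by apply: rint_sin; exact: maf.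
  - by apply: rint_sin; exact: maf.
  - exact: saQ.
have c1 : `|Ex P (fun w => cos (a * S 0 m w - c) * cos (a * B' w)) -
    E0 * Ex P (fun w => cos (a * B' w))| <= r.
  apply: (@bounded_bsum_cov 0 m (m%:Z + q%:Z) (p - q) (fun x => cos (a * x - c))
    (fun x => cos (a * x)) q r) => //; [exact: mcosR|exact: mcosR|..];
    by move=> x; exact: cos_max.
have c2 : `|Ex P (fun w => sin (a * S 0 m w - c) * sin (a * B' w)) -
    Ex P (fun w => sin (a * S 0 m w - c)) * Ex P (fun w => sin (a * B' w))| <= r.
  apply: (@bounded_bsum_cov 0 m (m%:Z + q%:Z) (p - q) (fun x => sin (a * x - c))
    (fun x => sin (a * x)) q r) => //; [exact: msinR|exact: msinR|..];
    by move=> x; exact: sin_max.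
have Icc : rint P (fun w => cos (a * S 0 m w - c) * cos (a * B' w)).
  apply: (@rint_bounded _ _ _ P _ 1).
    by apply: measurable_funM; apply: (measurableT_comp (@measurable_cos R));
      [exact: mac|exact: maf].
  by move=> w; rewrite normrM mulr_ile1 ?cos_max.
have Iss : rint P (fun w => sin (a * S 0 m w - c) * sin (a * B' w)).
  apply: (@rint_bounded _ _ _ P _ 1).
    by apply: measurable_funM; apply: (measurableT_comp (@measurable_sin R));
      [exact: mac|exact: maf].
  by move=> w; rewrite normrM mulr_ile1 ?sin_max.
have ED : Ex P (fun w => cos ((a * S 0 m w - c) + a * B' w)) =
    Ex P (fun w => cos (a * S 0 m w - c) * cos (a * B' w)) -
    Ex P (fun w => sin (a * S 0 m w - c) * sin (a * B' w)).
  by rewrite -ExB//; congr Ex; apply/funext => w; rewrite cosD.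
have le1 f (u : R -> R) : rint P (fun w => u (f w)) -> (forall x, `|u x| <= 1) ->
    `|Ex P (fun w => u (f w))| <= 1.
  move=> Iu u1; rewrite -[leRHS](Ex_cst P).
  by apply: Ex_norm_le => //; exact: rint_cst.
have E01 : `|E0| <= 1.
  by apply: le1; [apply: rint_cos; exact: mac|exact: cos_max].
have F01 : `|Ex P (fun w => sin (a * S 0 m w - c))| <= 1.
  by apply: le1; [apply: rint_sin; exact: mac|exact: sin_max].
set F0 := Ex P (fun w => sin (a * S 0 m w - c)) in c2 F01.
have stc : Ex P (fun w => cos (a * S m%:Z p w)) = Ex P (fun w => cos (a * S 0 p w)).
  exact: (stationary_bsum m%:Z p statX mid (mcosR _ maR)).
have sts : Ex P (fun w => sin (a * S m%:Z p w)) = Ex P (fun w => sin (a * S 0 p w)).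
  exact: (stationary_bsum m%:Z p statX mid (msinR _ maR)).
rewrite ED in h1; rewrite stc in h2; rewrite sts in h3.
set Cc := Ex P (fun w => cos (a * B' w)) in h2 c1.
set Ss := Ex P (fun w => sin (a * B' w)) in h3 c2.
set x1 := Ex P (fun w => cos (a * S 0 p w)) in hcos h2.
set y1 := Ex P (fun w => sin (a * S 0 p w)) in hsin h3.
have k1 : `|E0 * Cc - kap * E0| <= D + eta.
  rewrite [kap * E0]mulrC -mulrBr normrM.
  apply: (@le_trans _ _ (1 * `|Cc - kap|)); first by rewrite ler_wpM2r.
  rewrite mul1r (_ : Cc - kap = (Cc - x1) + (x1 - kap)); last by ring.
  by apply: (le_trans (ler_normD _ _)); exact: lerD.
have k2 : `|F0 * Ss| <= D + eta.
  rewrite normrM; apply: (@le_trans _ _ (1 * `|Ss|)); first by rewrite ler_wpM2r.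
  rewrite mul1r (_ : Ss = (Ss - y1) + y1); last by ring.
  by apply: (le_trans (ler_normD _ _)); exact: lerD.
move: h1 c1 c2 k1 k2; rewrite !ler_norml => /andP[? ?] /andP[? ?] /andP[? ?] /andP[? ?] /andP[? ?].
by apply/andP; split; lra.
Qed.

(** The multiplier 1 - tau^2 / 2 lies in [0, 1], so errors add up linearly over the blocks;
    replacing it by an exponential costs tau^4 / 4 per block. *)
Lemma blocks_cos (c a tau eta r : R) p q k : (q <= p)%N ->
  (rho X q <= r%:E)%E -> 0 <= a -> 0 <= tau <= 1 ->
  `|Ex P (fun w => cos (a * S 0 p w)) - (1 - tau ^+ 2 / 2)| <= eta ->
  `|Ex P (fun w => sin (a * S 0 p w))| <= eta ->
  `|Ex P (fun w => cos (a * S 0 (k * p) w - c)) - expR (- (k%:R * (tau ^+ 2 / 2))) * cos c|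
  <= k%:R * (2 * eta + 2 * r + 3 * (a * Num.sqrt (mom2 X id q)) + tau ^+ 4 / 4).
Proof.
move=> qp rr a0 /andP[t0 t1] hcos hsin.
have tau2 : 0 <= tau ^+ 2 / 2 by rewrite divr_ge0 ?sqr_ge0.
have tau21 : tau ^+ 2 / 2 <= 1 by have := exprn_ile1 2 t0 t1; lra.
elim: k => [|k IH].
  rewrite mul0n mul0r oppr0 expR0 mul1r.
  have -> : (fun w => cos (a * S 0 0 w - c)) = fun=> cos c.
    by apply/funext => w; rewrite bsum0 mulr0 sub0r cosN.
  by rewrite Ex_cst subrr normr0 mul0r.
have hs := block_step c (k * p) qp rr a0 hcos hsin.
rewrite mulSn addnC.
set E1 := Ex P _ in hs *; set E0 := Ex P _ in hs IH.
have hexp := expR_taylor1 tau2.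
rewrite -natr1.
have -> : - ((k%:R + 1) * (tau ^+ 2 / 2)) = - (k%:R * (tau ^+ 2 / 2)) + - (tau ^+ 2 / 2).
  by ring.
rewrite expRD.
set e1 := expR (- (k%:R * (tau ^+ 2 / 2))) in IH *.
set e2 := expR (- (tau ^+ 2 / 2)) in hexp *.
have e11 : 0 <= e1 <= 1.
  by rewrite expR_ge0/= -expR0 ler_expR oppr_le0 mulr_ge0.
have h2 : `|(1 - tau ^+ 2 / 2) * (E0 - e1 * cos c)| <=
   k%:R * (2 * eta + 2 * r + 3 * (a * Num.sqrt (mom2 X id q)) + tau ^+ 4 / 4).
  apply: le_trans IH; rewrite normrM ler_piMl// ger0_norm; lra.
have h3 : `|(1 - tau ^+ 2 / 2 - e2) * (e1 * cos c)| <= tau ^+ 4 / 4.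
  have -> : tau ^+ 4 / 4 = (tau ^+ 2 / 2) ^+ 2 * 1 by field.
  rewrite normrM; apply: ler_pM => //; rewrite normrM.
  by case/andP: e11 => e10 e11; rewrite mulr_ile1 ?cos_max// ger0_norm.
have -> : E1 - e1 * e2 * cos c = (E1 - (1 - tau ^+ 2 / 2) * E0) +
   (1 - tau ^+ 2 / 2) * (E0 - e1 * cos c) + (1 - tau ^+ 2 / 2 - e2) * (e1 * cos c) by ring.
apply: (le_trans (ler_normD _ _)).
have := ler_normD (E1 - (1 - tau ^+ 2 / 2) * E0) ((1 - tau ^+ 2 / 2) * (E0 - e1 * cos c)).
lra.
Qed.

End block_iteration.

(** * Variance of concatenated blocks and the limit of the cosine transforms *)

Section cosine_limit.
Context {d : measure_display} {T : measurableType d} {R : realType}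
  (P : probability T R) (X : int -> {RV P >-> R}).
Hypothesis statX : strictly_stationary X.
Hypothesis rho0 : rho X n @[n --> \oo] --> 0%E.
Hypothesis sqX : sqint P (X 0).
Hypothesis EX0 : Ex P (X 0) = 0.
Hypothesis vy : forall A : R, exists N, forall i, (N <= i)%N ->
  A <= mom2 X id (2 ^ i).
Hypothesis tailX : forall e : R, 0 < e -> exists N, forall i, (N <= i)%N ->
  expR (201/100 * rho_gap_sum X i) * tail2 X (level i) <= e.

Local Notation S := (bsum X id).

Let mid : measurable_fun setT (@id R).
Proof. exact: measurable_id. Qed.

Let sS a m : sqint P (S a m).
Proof. by apply: sqint_bsum => t; exact: (sqint_stationary t statX mid sqX). Qed.

Let mS a m : measurable_fun setT (S a m).
Proof. exact: (proj1 (sS a m)). Qed.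

Lemma mom2_add_le m p (th : R) : 0 < th ->
  mom2 X id (m + p) <= (1 + th) * mom2 X id m + (1 + th^-1) * mom2 X id p.
Proof.
move=> th0; rewrite -(mom2_bsum statX m%:Z p mid) /mom2.
have i1 := rintZ (1 + th) (proj2 (sS 0 m)).
have i2 := rintZ (1 + th^-1) (proj2 (sS m%:Z p)).
rewrite -(ExZ (1 + th) (proj2 (sS 0 m))) -(ExZ (1 + th^-1) (proj2 (sS m%:Z p))).
rewrite -(ExD i1 i2); apply: Ex_le; [exact: (proj2 (sS _ _))|exact: rintD|move=> w].
rewrite bsum_add add0r; set u := S 0 m w; set v := S m%:Z p w.
have : 0 <= th^-1 * (th * u - v) ^+ 2.
  by rewrite mulr_ge0 ?sqr_ge0// invr_ge0 ltW.
have -> : th^-1 * (th * u - v) ^+ 2 =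
   (1 + th) * u ^+ 2 + (1 + th^-1) * v ^+ 2 - (u + v) ^+ 2.
  by field; rewrite gt_eqF.
by rewrite subr_ge0.
Qed.

Lemma mom2_le_add m p (th : R) : 0 < th ->
  mom2 X id m <= (1 + th) * mom2 X id (m + p) + (1 + th^-1) * mom2 X id p.
Proof.
move=> th0; rewrite -(mom2_bsum statX m%:Z p mid) /mom2.
have i1 := rintZ (1 + th) (proj2 (sS 0 (m + p)%N)).
have i2 := rintZ (1 + th^-1) (proj2 (sS m%:Z p)).
rewrite -(ExZ (1 + th) (proj2 (sS 0 (m + p)%N))) -(ExZ (1 + th^-1) (proj2 (sS m%:Z p))).
rewrite -(ExD i1 i2); apply: Ex_le; [exact: (proj2 (sS _ _))|exact: rintD|move=> w].
rewrite bsum_add add0r.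
set u := S 0 m w; set v := S m%:Z p w.
have : 0 <= th^-1 * (th * u + (1 + th) * v) ^+ 2.
  by rewrite mulr_ge0 ?sqr_ge0// invr_ge0 ltW.
have -> : th^-1 * (th * u + (1 + th) * v) ^+ 2 =
   (1 + th) * (u + v) ^+ 2 + (1 + th^-1) * v ^+ 2 - u ^+ 2.
  by field; rewrite gt_eqF.
by rewrite subr_ge0.
Qed.

(** For fixed [k] the variance is asymptotically additive by a gap of fixed length; the divergence
    of the variances makes its contribution negligible. *)
Lemma mom2_blocks k (e : R) : 0 < e -> exists N, forall i, (N <= i)%N ->
  `|mom2 X id (k * 2 ^ i) - k%:R * mom2 X id (2 ^ i)| <= e * mom2 X id (2 ^ i).
Proof.
elim: k e => [|k IH] e e0.
  exists 0 => i _; rewrite mul0n mul0r subr0 (mom2_0 X id) normr0.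
  by rewrite mulr_ge0 ?mom2_ge0// ltW.
have e40 : 0 < e / 4 by rewrite divr_gt0.
have [N1 N1P] := IH _ e40.
(* Makes the relative error 2 h (u + v) at most (e / 4) v, where u is at most (k + e) v by the
   induction hypothesis. *)
pose h : R := Num.min 1 (e / (8 * (k%:R + e + 1))).
have k0 : 0 <= (k%:R : R) by [].
have den : 0 < 8 * (k%:R + e + 1) by lra.
have h0 : 0 < h by rewrite lt_min ltr01 divr_gt0.
have h1 : h <= 1 by rewrite ge_min lexx.
have h2 : h * (8 * (k%:R + e + 1)) <= e.
  by rewrite -ler_pdivlMr// ge_min lexx orbT.
have [q qP] := rho_small rho0 h0; have [rq rqle] := qP q (leqnn _).
have [N2 N2P] := vy (4 / e * (3 / h * mom2 X id q)).
exists (maxn q (maxn N1 N2)) => i; rewrite !geq_max => /and3P[qi /N1P hk /N2P hv].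
have q2i : (q <= 2 ^ i)%N by rewrite (leq_trans qi)// ltnW// ltn_expl.
have v0 := mom2_ge0 X id (2 ^ i); have w0 := mom2_ge0 X id (k * 2 ^ i).
have := @mom2_add _ _ _ P X statX id mid sqX EX0 (k * 2 ^ i) (2 ^ i) q h h q2i.
rewrite rq lee_fin => /(_ rqle); rewrite (ltW h0) h0 h1 => /(_ isT isT).
rewrite mulSn (addnC (2 ^ i)%N) -[k.+1%:R]natr1.
set v := mom2 X id (2 ^ i) in hk hv v0 *; set u := mom2 X id (k * 2 ^ i) in hk w0 *.
set z := 3 / h * mom2 X id q in hv *; set y := mom2 _ _ _.
have hz : z <= e / 4 * v.
  have : e / 4 * (4 / e * z) <= e / 4 * v by rewrite ler_wpM2l// ltW.
  by have -> : e / 4 * (4 / e * z) = z by field; rewrite gt_eqF.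
move: hk; rewrite !ler_norml => /andP[a1 a2] /andP[b1 b2].
have hu : (h + h) * (u + v) <= e / 4 * v.
  apply: (@le_trans _ _ ((h + h) * ((k%:R + e + 1) * v))).
    by rewrite ler_wpM2l// ?addr_ge0 ?(ltW h0)//; have := mulr_ge0 (ltW e0) v0; lra.
  by have := ler_wpM2r v0 h2; lra.
by apply/andP; split; lra.
Qed.

Lemma mom2_blocks_uniform M (e : R) : 0 < e -> exists N, forall i, (N <= i)%N ->
  forall k, (k < M)%N ->
  `|mom2 X id (k * 2 ^ i) - k%:R * mom2 X id (2 ^ i)| <= e * mom2 X id (2 ^ i).
Proof.
move=> e0; elim: M => [|M [N1 N1P]]; first by exists 0.
have [N2 N2P] := mom2_blocks M e0.
exists (maxn N1 N2) => i; rewrite geq_max => /andP[/N1P h1 /N2P h2] k.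
by rewrite ltnS leq_eqVlt => /predU1P[->//|]; exact: h1.
Qed.

(** The binary digits of [r] are stripped off from the top. Each step costs 3/2 of the old bound
    plus 3 K times the scale variance, and the constant 7 satisfies 3/2 * 7 + 3 <= 39/20 * 7. *)
Lemma mom2_remainder : exists2 K : R, 0 < K & exists N, forall i, (N <= i)%N ->
  forall r, (r < 2 ^ i)%N -> mom2 X id r <= K * mom2 X id (2 ^ i).
Proof.
have [K K0 [N NP]] := mom2_id_ratio statX rho0 sqX EX0 vy.
exists (7 * K); first by lra.
exists N => i /NP[v0 hK].
set v := mom2 X id (2 ^ i) in v0 hK *.
have main j : (j <= i)%N -> forall r, (r < 2 ^ j)%N ->
    mom2 X id r <= 7 * K * (20/39) ^+ (i - j) * v.
  elim: j => [|j IH] ji r.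
    rewrite expn0 ltnS leqn0 => /eqP ->; rewrite (mom2_0 X id).
    by rewrite !mulr_ge0// ?exprn_ge0// ltW.
  have hj := hK j (ltnW ji); have {IH}hr := IH (ltnW ji).
  have -> : (20/39 : R) ^+ (i - j.+1) = 39/20 * (20/39) ^+ (i - j).
    by rewrite -(subnSK ji) exprS mulrA (_ : 39/20 * (20/39) = 1 :> R) ?mul1r//; field.
  have y0 : 0 <= K * ((20/39) ^+ (i - j) * v).
    by rewrite !mulr_ge0 ?exprn_ge0// ltW.
  have [/hr rj _|jr] := ltnP r (2 ^ j); first by lra.
  rewrite expnS => rj.
  have {hr}hr := hr (r - 2 ^ j)%N ltac:(lia).
  have := mom2_add_le (r - 2 ^ j) (2 ^ j) (ltac:(lra) : 0 < 1/2 :> R).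
  rewrite subnK// (_ : (1/2)^-1 = 2 :> R); last by field.
  lra.
move=> r ri; have := main i (leqnn _) r ri.
by rewrite subnn expr0 mulr1.
Qed.

(** Passing to the normalisation [b] changes the argument by a relative 4 dl in L^2, dropping the
    remainder by a further dl, and cosine is 1-Lipschitz. The remainder is required to be of order
    dl^2 because comparing the variances with weight dl multiplies it by 1 / dl. *)
Lemma normalized_cos_diff (t c b dl : R) m r : 0 <= t -> 0 < b -> 0 < dl <= 1/10 ->
  `|mom2 X id m - b ^+ 2| <= dl * b ^+ 2 -> mom2 X id r <= dl ^+ 2 * b ^+ 2 ->
  `|Ex P (fun w => cos (t / Num.sqrt (mom2 X id (m + r)) * S 0 (m + r) w - c)) -
    Ex P (fun w => cos (t / b * S 0 m w - c))| <= t * (5 * dl).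
Proof.
move=> t0 b0 /andP[d0 d1] hm hr.
set V := mom2 X id (m + r); set s := Num.sqrt V.
have V0 : 0 <= V := mom2_ge0 X id (m + r).
have s2 : s ^+ 2 = V by rewrite sqr_sqrtr.
have b20 : 0 < b ^+ 2 by rewrite exprn_gt0.
have dn : dl != 0 by rewrite gt_eqF.
have hr2 : (1 + dl^-1) * mom2 X id r <= (dl + dl ^+ 2) * b ^+ 2.
  have -> : (dl + dl ^+ 2) * b ^+ 2 = (1 + dl^-1) * (dl ^+ 2 * b ^+ 2) by field.
  by rewrite ler_wpM2l// addr_ge0// invr_ge0 ltW.
move: hm; rewrite ler_norml => /andP[m1 m2].
have d2 : dl ^+ 2 <= 1/10 * dl by rewrite expr2 ler_wpM2r// ltW.
have up : V <= (1 + 4 * dl) * b ^+ 2.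
  have := mom2_add_le m r d0; rewrite -/V => h.
  have h' : (1 + dl) * mom2 X id m <= (1 + dl) * ((1 + dl) * b ^+ 2).
    by rewrite ler_wpM2l//; lra.
  have := ler_wpM2r (ltW b20) d2; nra.
have lo : (1 - 4 * dl) * b ^+ 2 <= V.
  have := mom2_le_add m r d0; rewrite -/V => h.
  have : (1 - 2 * dl - dl ^+ 2) * b ^+ 2 <= (1 + dl) * V by lra.
  have h3 : (1 + dl) * ((1 - 4 * dl) * b ^+ 2) <= (1 - 2 * dl - dl ^+ 2) * b ^+ 2.
    rewrite mulrA ler_wpM2r ?(ltW b20)//; nra.
  move=> h4; rewrite -(@ler_pM2l _ (1 + dl)); last by lra.
  exact: le_trans h3 h4.
have s0 : 0 < s.
  rewrite sqrtr_gt0; apply: lt_le_trans lo; rewrite mulr_gt0//; lra.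
have sb : `|1 - s / b| <= 4 * dl.
  have -> : 1 - s / b = (b ^+ 2 - s ^+ 2) / (b * (b + s)).
    by field; rewrite !gt_eqF// addr_gt0.
  have bs : 0 < b * (b + s) by rewrite mulr_gt0// addr_gt0.
  rewrite normf_div [`|b * _|]gtr0_norm// ler_pdivrMr//.
  apply: (@le_trans _ _ (4 * dl * b ^+ 2)).
    by rewrite s2 ler_norml; apply/andP; split; lra.
  rewrite ler_wpM2l ?mulr_ge0 ?(ltW d0)// expr2 ler_wpM2l ?(ltW b0)//; lra.
have mac (x : R) (f : T -> R) : measurable_fun setT f ->
    rint P (fun w => cos (x * f w - c)).
  by move=> mf; apply: rint_cos; apply: measurable_funB => //; exact: measurable_funM.
have sqZ (x : R) a n : Num.sqrt (Ex P (fun w => (x * S a n w) ^+ 2)) =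
    `|x| * Num.sqrt (mom2 X id n).
  have -> : (fun w => (x * S a n w) ^+ 2) = fun w => x ^+ 2 * S a n w ^+ 2.
    by apply/funext => w; rewrite exprMn.
  rewrite ExZ; last exact: (proj2 (sS a n)).
  by rewrite (mom2_bsum statX a n mid) sqrtrM ?sqr_ge0// sqrtr_sqr.
have h1 : `|Ex P (fun w => cos (t / s * S 0 (m + r) w - c)) -
    Ex P (fun w => cos (t / b * S 0 (m + r) w - c))| <= t * (4 * dl).
  apply: (@le_trans _ _ (Num.sqrt (Ex P (fun w => ((t / s - t / b) * S 0 (m + r) w) ^+ 2)))).
    apply: (Ex_lipschitz_diff (@cos_lipschitz R)).
    - by move=> w; rewrite (_ : _ - _ = (t / s - t / b) * S 0 (m + r) w)//; ring.
    - exact: mac.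
    - exact: mac.
    - exact: sqintZ.
  rewrite sqZ -/V -/s.
  have -> : t / s - t / b = t * ((1 - s / b) / s) by field; rewrite !gt_eqF.
  rewrite !normrM (ger0_norm t0) -!mulrA ler_wpM2l//.
  by rewrite normfV (gtr0_norm s0) mulVf ?mulr1// gt_eqF.
have h2 : `|Ex P (fun w => cos (t / b * S 0 (m + r) w - c)) -
    Ex P (fun w => cos (t / b * S 0 m w - c))| <= t * dl.
  apply: (@le_trans _ _ (Num.sqrt (Ex P (fun w => (t / b * S m%:Z r w) ^+ 2)))).
    apply: (Ex_lipschitz_diff (@cos_lipschitz R)).
    - move=> w; rewrite bsum_add add0r.
      by rewrite (_ : _ - _ = t / b * S m%:Z r w)//; ring.
    - exact: mac.
    - exact: mac.
    - exact: sqintZ.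
  rewrite sqZ ger0_norm ?divr_ge0 ?(ltW b0)// -mulrA ler_wpM2l//.
  rewrite mulrC ler_pdivrMr// -[leRHS]ger0_norm ?mulr_ge0 ?(ltW d0) ?(ltW b0)//.
  by rewrite -sqrtr_sqr ler_wsqrtr// exprMn.
have -> : Ex P (fun w => cos (t / s * S 0 (m + r) w - c)) -
    Ex P (fun w => cos (t / b * S 0 m w - c)) =
  (Ex P (fun w => cos (t / s * S 0 (m + r) w - c)) -
    Ex P (fun w => cos (t / b * S 0 (m + r) w - c))) +
  (Ex P (fun w => cos (t / b * S 0 (m + r) w - c)) -
    Ex P (fun w => cos (t / b * S 0 m w - c))) by ring.
apply: (le_trans (ler_normD _ _)); lra.
Qed.

End cosine_limit.

Section cosine_clt.
Context {d : measure_display} {T : measurableType d} {R : realType}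
  (P : probability T R) (X : int -> {RV P >-> R}).
Hypothesis statX : strictly_stationary X.
Hypothesis rho0 : rho X n @[n --> \oo] --> 0%E.
Hypothesis sqX : sqint P (X 0).
Hypothesis EX0 : Ex P (X 0) = 0.
Hypothesis vy : forall A : R, exists N, forall i, (N <= i)%N ->
  A <= mom2 X id (2 ^ i).
Hypothesis tailX : forall e : R, 0 < e -> exists N, forall i, (N <= i)%N ->
  expR (201/100 * rho_gap_sum X i) * tail2 X (level i) <= e.

Lemma dyadic_block_decomposition kappa N n : (2 ^ (N + kappa) <= n)%N ->
  exists i k r, [/\ (N <= i)%N, (2 ^ kappa <= k)%N, (k < 2 ^ kappa.+1)%N,
    (r < 2 ^ i)%N & n = (k * 2 ^ i + r)%N].
Proof.
move=> hn; have n0 : (0 < n)%N by rewrite (leq_trans _ hn)// expn_gt0.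
have /andP[b1 b2] := trunc_log_bounds (ltnSn 1) n0.
set L := trunc_log 2 n in b1 b2.
have LN : (N + kappa <= L)%N.
  rewrite leqNgt; apply/negP => h.
  have : (2 ^ L.+1 <= 2 ^ (N + kappa))%N by rewrite leq_exp2l.
  by move=> h2; have := leq_trans b2 (leq_trans h2 hn); rewrite ltnn.
exists (L - kappa)%N, (n %/ 2 ^ (L - kappa))%N, (n %% 2 ^ (L - kappa))%N; split.
- lia.
- by rewrite leq_divRL ?expn_gt0// -expnD addnC subnK//; lia.
- by rewrite ltn_divLR ?expn_gt0// -expnD (_ : kappa.+1 + (L - kappa) = L.+1)%N//; lia.
- by rewrite ltn_mod expn_gt0.
- by rewrite -divn_eq.
Qed.

Lemma cos_clt (t c : R) : 0 <= t -> forall e : R, 0 < e ->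
  exists N, forall n, (N <= n)%N ->
  `|Ex P (fun w => cos (t / Num.sqrt (mom2 X id n) * bsum X id 0 n w - c)) -
    expR (- (t ^+ 2 / 2)) * cos c| <= e.
Proof.
move=> t0 e e0.
have mid : measurable_fun setT (@id R) by exact: measurable_id.
have [C C0 [N1 N1P]] := mom4_low_le statX rho0 sqX EX0 vy tailX.
have [K K0 [N2 N2P]] := mom2_remainder statX rho0 sqX EX0 vy.
have t10 : 0 < 20 * (t + 1) by lra.
pose dl : R := Num.min (1/10) (e / (20 * (t + 1))).
have dl0 : 0 < dl by rewrite lt_min; apply/andP; split; [lra|exact: divr_gt0].
have dl1 : dl <= 1/10 by rewrite ge_min lexx.
have dlt : t * (5 * dl) <= e / 4.
  have : dl * (20 * (t + 1)) <= e by rewrite -ler_pdivlMr// ge_min lexx orbT.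
  lra.
have t30 : 0 <= t ^+ 3 by rewrite exprn_ge0.
have t40 : 0 <= t ^+ 4 by rewrite exprn_ge0.
pose A3 : R := 64 * (1 + C) * t ^+ 3 / e.
have A30 : 0 <= A3 by rewrite divr_ge0 ?(ltW e0)// !mulr_ge0//; lra.
(* A lower bound for the number of blocks. The summands serve in turn tau <= 1, a negligible
   remainder, the error in tau^3, the error in tau^4, and k >= 1. *)
pose A : R := t ^+ 2 + K / dl ^+ 2 + A3 ^+ 2 + 2 * t ^+ 4 / e + 1.
have [kap kapA] : exists kap : nat, A <= (2 ^ kap)%:R.
  exists (Num.bound `|A|); apply: (le_trans (ler_norm _)).
  rewrite ltW// (lt_trans (archi_boundP (normr_ge0 _)))// ltr_nat.
  exact: ltn_expl.
have a1 := sqr_ge0 t; have a2 : 0 <= K / dl ^+ 2 by rewrite divr_ge0 ?sqr_ge0// ltW.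
have a3 := sqr_ge0 A3.
have a4 : 0 <= 2 * t ^+ 4 / e by rewrite divr_ge0 ?(ltW e0)// mulr_ge0.
have [A1 At AK AA3 At4] : [/\ 1 <= A, t ^+ 2 <= A, K / dl ^+ 2 <= A, A3 ^+ 2 <= A
    & 2 * t ^+ 4 / e <= A] by split; rewrite /A; lra.
have t21 : 0 < t ^+ 2 + 1 by lra.
clearbody A.
(* An upper bound for [k], fixed before [q] and the scale are chosen, so that k rho (q) and the k
   gaps can be made small afterwards. The budget is e/4 for the normalisation and five times e/8. *)
pose M : R := (2 ^ kap.+1)%:R.
have M1 : 1 <= M by rewrite ler1n expn_gt0.
have M0 : 0 < M by lra.
have r0 : 0 < e / (16 * M) by rewrite divr_gt0// mulr_gt0.
have [q qP] := rho_small rho0 r0; have [rq rqle] := qP q (leqnn _).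
have ep0 : 0 < e / (64 * (t ^+ 2 + 1)) by rewrite divr_gt0// mulr_gt0.
have [N3 N3P] := mom2_high_small statX rho0 sqX EX0 vy tailX ep0.
have [N4 N4P] := mom2_blocks_uniform statX rho0 sqX EX0 vy (2 ^ kap.+1) dl0.
have [N5 N5P] := vy ((24 * M * Num.sqrt (mom2 X id q) / e) ^+ 2 + 1).
pose N := maxn q (maxn N1 (maxn N2 (maxn N3 (maxn N4 N5)))).
exists (2 ^ (N + kap))%N => n /dyadic_block_decomposition[i [k [r [Ni k1 k2 ri ->]]]].
move: Ni; rewrite !geq_max => /and5P[qi i1 i2 i3 /andP[i4 i5]].
set v := mom2 X id (2 ^ i).
have vbig := N5P i i5; have hrem := N2P i i2 r ri; have hblk := N4P i i4 k k2.
have hm4 := N1P i i1; have hhi := N3P i i3.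
rewrite -/v in vbig hrem hblk hm4 hhi.
have v0 : 0 < v by apply: lt_le_trans vbig; rewrite ltr_wpDl ?sqr_ge0.
set s := Num.sqrt v.
have s0 : 0 < s by rewrite sqrtr_gt0.
have s2 : s ^+ 2 = v by rewrite sqr_sqrtr// ltW.
have kA : A <= k%:R by apply: (le_trans kapA); rewrite ler_nat.
have kM : k%:R <= M by rewrite ler_nat ltnW.
have kge1 : 1 <= (k%:R : R) := le_trans A1 kA.
have k0 : 0 < (k%:R : R) by exact: lt_le_trans ltr01 kge1.
set x := Num.sqrt (k%:R : R).
have x0 : 0 < x by rewrite sqrtr_gt0.
have x2 : x ^+ 2 = k%:R by rewrite sqr_sqrtr// ltW.
have xn : x != 0 by rewrite gt_eqF.
have sn : s != 0 by rewrite gt_eqF.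
pose b := x * s.
have b0 : 0 < b by rewrite mulr_gt0.
have b2 : b ^+ 2 = k%:R * v by rewrite exprMn x2 s2.
pose tau := t / x.
have tx : t <= x.
  rewrite -(@ler_pXn2r _ 2)// ?nnegrE ?(ltW x0)// x2.
  exact: le_trans At kA.
have tau01 : 0 <= tau <= 1.
  by rewrite /tau divr_ge0 ?(ltW x0)//= ler_pdivrMr// mul1r.
have tau2 : k%:R * tau ^+ 2 = t ^+ 2 by rewrite -x2 /tau; field.
have hdl : 0 < dl <= 1/10 by rewrite dl0 dl1.
have kdl : K * v <= dl ^+ 2 * b ^+ 2.
  have : K / dl ^+ 2 <= k%:R by exact: le_trans AK kA.
  rewrite ler_pdivrMr ?exprn_gt0// b2 => h.
  by rewrite mulrA [_ * k%:R]mulrC ler_wpM2r// ltW.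
have dlb : `|mom2 X id (k * 2 ^ i) - b ^+ 2| <= dl * b ^+ 2.
  rewrite b2; apply: (le_trans hblk).
  by rewrite ler_wpM2l ?(ltW dl0)// ler_peMl// ltW.
have part1 := normalized_cos_diff statX sqX c t0 b0 hdl dlb (le_trans hrem kdl).
set f := low_part X (level i) in hm4 *; set g := high_part X (level i) in hhi *.
have cf : centered X f := centered_low_part sqX (level i).
have cg : centered X g := centered_high_part sqX EX0 (level i).
have fg y : y = f y + g y by rewrite /g /high_part addrC subrK.
have I4 : rint P (fun w => bsum X f 0 (2 ^ i) w ^+ 4).
  case: cf => mf _ _; apply: (@rint_bsum_expn _ _ _ P X f 0 (2 ^ i) 4 (2 * level i) mf) => y.
  by apply: norm_low_part => //; exact: level_ge0.
have s4 : s ^+ 4 = v ^+ 2 by rewrite -s2 -exprM.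
rewrite -s2 in hhi; rewrite -s4 in hm4.
have [hc hs] := single_block statX sqX EX0 cf cg fg s0 tau01 I4 s2 hhi hm4.
have ab : tau / s = t / b by rewrite /tau /b invfM mulrA.
set eta := 4 * (1 + C) * tau ^+ 3 + 4 * (e / (64 * (t ^+ 2 + 1))) * tau ^+ 2 in hc hs.
rewrite ab in hc hs.
have tb0 : 0 <= t / b by rewrite divr_ge0// ltW.
have q2i : (q <= 2 ^ i)%N by rewrite (leq_trans qi)// ltnW// ltn_expl.
have rqE : (rho X q <= (fine_rho X q)%:E)%E by rewrite rq.
have part2 := blocks_cos statX sqX c k q2i rqE tb0 tau01 hc hs.
have tk : k%:R * (tau ^+ 2 / 2) = t ^+ 2 / 2 by rewrite mulrA tau2.
rewrite tk in part2.
have b1 : k%:R * (2 * eta) <= e / 8 + e / 8.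
  have e1 : k%:R * (2 * (4 * (1 + C) * tau ^+ 3)) <= e / 8.
    have -> : k%:R * (2 * (4 * (1 + C) * tau ^+ 3)) = (e / 8) * (A3 / x).
      by rewrite /A3 /tau -x2; field; rewrite xn gt_eqF.
    have A3x : A3 <= x.
      rewrite -(@ler_pXn2r _ 2)// ?nnegrE ?(ltW x0)// x2.
      exact: le_trans AA3 kA.
    rewrite ler_piMr ?divr_ge0 ?(ltW e0)// ler_pdivrMr// mul1r//.
  have e2 : k%:R * (2 * (4 * (e / (64 * (t ^+ 2 + 1))) * tau ^+ 2)) <= e / 8.
    have -> : k%:R * (2 * (4 * (e / (64 * (t ^+ 2 + 1))) * tau ^+ 2)) =
        e / 8 * (k%:R * tau ^+ 2 / (t ^+ 2 + 1)).
      by field; rewrite gt_eqF.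
    rewrite tau2 ler_piMr ?divr_ge0 ?(ltW e0)//.
    by rewrite ler_pdivrMr// mul1r lerDl ler01.
  by rewrite /eta [2 * (_ + _)]mulrDr [k%:R * (_ + _)]mulrDr lerD.
have b2' : k%:R * (2 * fine_rho X q) <= e / 8.
  have f0 := fine_rho_ge0 X q.
  apply: (@le_trans _ _ (M * (2 * (e / (16 * M))))).
    by apply: ler_pM => //; [rewrite mulr_ge0|rewrite ler_wpM2l].
  by rewrite le_eqVlt; apply/orP; left; apply/eqP; field; rewrite gt_eqF.
have b3 : k%:R * (3 * (t / b * Num.sqrt (mom2 X id q))) <= e / 8.
  set Q := Num.sqrt (mom2 X id q) in vbig *.
  have Q0 : 0 <= Q by exact: sqrtr_ge0.
  have hQ : 24 * M * Q / e <= s.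
    rewrite -(@ler_pXn2r _ 2)// ?nnegrE ?(ltW s0)//; last first.
      by rewrite divr_ge0 ?(ltW e0)// mulr_ge0// mulr_ge0// ltW.
    by rewrite s2; apply: le_trans vbig; rewrite lerDl ler01.
  have hQ2 : 24 * M * Q <= s * e by rewrite -ler_pdivrMr.
  have -> : k%:R * (3 * (t / b * Q)) = tau * (k%:R * (3 * Q)) / s.
    by rewrite -ab; field.
  rewrite ler_pdivrMr//; apply: (@le_trans _ _ (1 * (M * (3 * Q)))).
    case/andP: tau01 => tau0 tau1; apply: ler_pM => //.
      by rewrite !mulr_ge0.
    by rewrite ler_wpM2r// mulr_ge0.
  rewrite mul1r [_ * s]mulrAC -[e * s]mulrC ler_pdivlMr//; apply: le_trans hQ2.
  by rewrite le_eqVlt; apply/orP; left; apply/eqP; ring.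
have b4 : k%:R * (tau ^+ 4 / 4) <= e / 8.
  have -> : k%:R * (tau ^+ 4 / 4) = e / 8 * ((2 * t ^+ 4 / e) / k%:R).
    by rewrite /tau -x2; field; rewrite xn gt_eqF.
  rewrite ler_piMr ?divr_ge0 ?(ltW e0)// ler_pdivrMr// mul1r.
  exact: le_trans At4 kA.
have -> : Ex P (fun w => cos (t / Num.sqrt (mom2 X id (k * 2 ^ i + r)) *
     bsum X id 0 (k * 2 ^ i + r) w - c)) - expR (- (t ^+ 2 / 2)) * cos c =
   (Ex P (fun w => cos (t / Num.sqrt (mom2 X id (k * 2 ^ i + r)) *
     bsum X id 0 (k * 2 ^ i + r) w - c)) -
    Ex P (fun w => cos (t / b * bsum X id 0 (k * 2 ^ i) w - c))) +
   (Ex P (fun w => cos (t / b * bsum X id 0 (k * 2 ^ i) w - c)) -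
    expR (- (t ^+ 2 / 2)) * cos c) by ring.
apply: (le_trans (ler_normD _ _)); apply: (le_trans (lerD part1 part2)).
clear -P X statX rho0 sqX EX0 vy tailX dlt b1 b2' b3 b4 e0; lra.
Qed.

End cosine_clt.

(** * The Gaussian cosine transform *)

Section gaussian_characteristic.
Variable R : realType.
Notation mu := (@lebesgue_measure R).
Notation pdf := (@normal_pdf R 0 1).

(** Yields the derivative of an integral depending on a parameter from an integrated Taylor
    bound. *)
Lemma is_derive_quadratic (g : R -> R) (t l M : R) :
  (forall s, `|g s - g t - (s - t) * l| <= M * (s - t) ^+ 2) ->
  is_derive t 1 g l.
Proof.
move=> H; have cv : h^-1 *: (g (h *: 1 + t) - g t) @[h --> (0:R)^'] --> l.
  apply/cvgrPdist_le => e e0; near=> h.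
  have h0 : h != 0 by near: h; exact: nbhs_dnbhs_neq.
  have := H (h *: 1 + t).
  rewrite (_ : h *: 1 + t - t = h); last by rewrite -[h *: 1]/(h * 1); ring.
  move=> Hh; have hn : 0 < `|h| by rewrite normr_gt0.
  have -> : l - h^-1 *: (g (h *: 1 + t) - g t) = - (g (h *: 1 + t) - g t - h * l) / h.
    by rewrite -[_ *: _]/(_ * _); field.
  rewrite normf_div normrN ler_pdivrMr//; apply: (le_trans Hh).
  rewrite -(real_normK (num_real h)) expr2 mulrA ler_wpM2r//.
  have hM : `|h| <= e / (`|M| + 1).
    near: h; apply: dnbhs0_le; rewrite divr_gt0//; have := normr_ge0 M; lra.
  have M1 : 0 < `|M| + 1 by have := normr_ge0 M; lra.
  rewrite ler_pdivlMr// in hM; have := ler_norm M; nra.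
have dg : derivable g t 1 by apply/cvg_ex; exists l; exact: cv.
by apply: DeriveDef => //; exact: (cvg_lim _ cv).
Unshelve. all: end_near. Qed.

Lemma normal_pdf01E x : pdf x = pdf 0 * expR (- (x ^+ 2 / 2)).
Proof.
rewrite normal_pdfE ?oner_neq0// /normal_fun.
rewrite subr0 subrr expr1n expr0n /= oppr0 mul0r expR0 mulr1.
by congr (_ * expR _); rewrite mulNr.
Qed.

Lemma is_derive_normal_pdf01 (x : R) : is_derive x 1 pdf (- (x * pdf x)).
Proof.
have -> : pdf = fun y => pdf 0 * expR (- (y ^+ 2 / 2)).
  by apply/funext => y; rewrite {1}normal_pdf01E.
have H : is_derive x 1 (fun y : R => pdf 0 * expR (- (y ^+ 2 / 2)))
    (pdf 0 * (expR (- (x ^+ 2 / 2)) * (- x))).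
  have d1 : is_derive x 1 (fun y : R => - (y ^+ 2 / 2)) (- x).
    have d2 := is_deriveN (is_deriveZ 2^-1 (is_deriveX 2 (is_derive_id x (1 : R)))).
    rewrite (_ : (fun y : R => - (y ^+ 2 / 2)) = - (2^-1 \*: (id ^+ 2))).
      by apply: (is_derive_eq d2); rewrite /GRing.scale /= expr1 mulr1 mulKf.
    by apply/funext => y; rewrite /= mulrC. 
  have d3 := @is_derive1_comp R expR (fun y => - (y ^+ 2 / 2)) x _ _ (is_derive_expR _) d1.
  exact: (is_deriveZ (pdf 0) d3).
by apply: (is_derive_eq H); ring.
Qed.

(** Comparison with the wider Gaussian density of variance 2: half of the exponent absorbs the
    quadratic factor, as 1 + x^2 <= 4 (1 + x^2 / 4) <= 4 exp (x^2 / 4). *)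
Lemma integrable_pdf_le (f : R -> R) (C : R) : measurable_fun setT f ->
  (forall x, `|f x| <= C * ((1 + x ^+ 2) * pdf x)) -> mu.-integrable setT (EFin \o f).
Proof.
move=> mf fC.
have i2 := integrable_normal_pdf (0 : R) (Num.sqrt 2).
set p2 := normal_pdf 0 (Num.sqrt 2) in i2.
have s2 : Num.sqrt 2 != 0 :> R by rewrite gt_eqF// sqrtr_gt0.
have p20 : 0 < p2 0.
  by rewrite /p2 normal_pdfE// mulr_gt0 ?normal_peak_gt0 ?expR_gt0.
have p2E x : p2 x = p2 0 * expR (- (x ^+ 2 / 4)).
  rewrite /p2 normal_pdfE// /normal_fun !subr0 expr0n /= oppr0 mul0r expR0 mulr1.
  congr (_ * expR _); rewrite sqr_sqrtr// mulNr -mulr_natr; congr (- (_ / _)); ring.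
have p0 : 0 <= pdf 0 by exact: normal_pdf_ge0.
have bnd x : (1 + x ^+ 2) * pdf x <= 4 * pdf 0 / p2 0 * p2 x.
  rewrite (normal_pdf01E x) (p2E x).
  have -> : - (x ^+ 2 / 2) = - (x ^+ 2 / 4) + - (x ^+ 2 / 4) :> R by field.
  rewrite expRD; set a := expR (- (x ^+ 2 / 4)).
  have a0 : 0 < a by exact: expR_gt0.
  have -> : 4 * pdf 0 / p2 0 * (p2 0 * a) = 4 * (pdf 0 * a) by field; rewrite gt_eqF.
  have h : (1 + x ^+ 2) * a <= 4.
    rewrite /a expRN ler_pdivrMr ?expR_gt0//.
    have := expR_ge1Dx (x ^+ 2 / 4); have := sqr_ge0 x; lra.
  have := ler_wpM2r (mulr_ge0 p0 (ltW a0)) h; lra.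
have i3 := integrableZl measurableT (`|C| * (4 * pdf 0 / p2 0)) i2.
apply: (le_integrable _ _ _ i3) => //; first exact/measurable_EFinP.
move=> x _ /=; rewrite lee_fin; apply: (le_trans (fC x)); apply: le_trans (ler_norm _).
have x2 : 0 <= (1 + x ^+ 2) * pdf x.
  by rewrite mulr_ge0 ?normal_pdf_ge0// addr_ge0// sqr_ge0.
rewrite -(mulrA `|C|); apply: (le_trans (ler_wpM2r x2 (ler_norm C))).
by rewrite ler_wpM2l ?bnd.
Qed.

Definition gmean (f : R -> R) : R := \int[mu]_x (f x * pdf x).

Let mpdf : measurable_fun setT pdf.
Proof. exact: measurable_normal_pdf. Qed.

Let pdf_ge0 x : 0 <= pdf x.
Proof. exact: normal_pdf_ge0. Qed.

Let intf (f : R -> R) (C : R) : measurable_fun setT f ->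
  (forall x, `|f x| <= C * (1 + x ^+ 2)) -> mu.-integrable setT (EFin \o (fun x => f x * pdf x)).
Proof.
move=> mf fC; apply: (@integrable_pdf_le _ C); first exact: measurable_funM.
by move=> x; rewrite normrM (ger0_norm (pdf_ge0 x)) mulrA ler_wpM2r.
Qed.

Let mphase (t c : R) : measurable_fun setT (fun x : R => t * x - c).
Proof. by apply: measurable_funB => //; exact: measurable_funM. Qed.

Let mcosp (t c : R) : measurable_fun setT (fun x : R => cos (t * x - c)).
Proof. exact: (measurableT_comp (@measurable_cos R) (mphase t c)). Qed.

Let msinp (t c : R) : measurable_fun setT (fun x : R => sin (t * x - c)).
Proof. exact: (measurableT_comp (@measurable_sin R) (mphase t c)). Qed.

Let int_cos t c : mu.-integrable setT (EFin \o (fun x => cos (t * x - c) * pdf x)).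
Proof.
apply: (@intf _ 1) => // x; rewrite mul1r (le_trans (cos_max _))// lerDl.
exact: sqr_ge0.
Qed.

Let int_xsin t c : mu.-integrable setT (EFin \o (fun x => x * sin (t * x - c) * pdf x)).
Proof.
apply: (@intf _ 1) => [|x]; first exact: measurable_funM.
rewrite mul1r normrM; apply: (@le_trans _ _ (`|x| * 1)).
  by rewrite ler_wpM2l// sin_max.
rewrite mulr1 -(real_normK (num_real x)).
by have := sqr_ge0 (`|x| - 1); have := normr_ge0 x; nra.
Qed.

Let int_x2 : mu.-integrable setT (EFin \o (fun x : R => x ^+ 2 * pdf x)).
Proof.
apply: (@intf _ 1) => [|x]; first exact: measurable_funX.
by rewrite mul1r ger0_norm ?sqr_ge0// lerDr.
Qed.

(* Integration by parts: the integrand is the derivative of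
   [- pdf x * sin (t * x - c)]. *)
Lemma gmean_stein t c :
  gmean (fun x => x * sin (t * x - c)) = t * gmean (fun x => cos (t * x - c)).
Proof.
pose F x := - (pdf x * sin (t * x - c)).
pose f x := x * sin (t * x - c) * pdf x - t * (cos (t * x - c) * pdf x).
have dF (x : R) : is_derive x 1 F (f x).
  have d1 : is_derive x 1 (fun y => t * y - c) t.
    have := is_deriveB (is_deriveZ t (is_derive_id x (1 : R))) (is_derive_cst c x 1).
    by move=> h; apply: (is_derive_eq h); rewrite subr0 /GRing.scale /= mulr1.
  have d2 := @is_derive1_comp R (@sin R) (fun y => t * y - c) x _ _ (is_derive_sin _) d1.
  have d3 := is_deriveN (is_deriveM (is_derive_normal_pdf01 x) d2).
  by apply: (is_derive_eq d3); rewrite /f /GRing.scale /=; ring.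
have mf : measurable_fun setT f.
  apply: measurable_funB; first by do 2 apply: measurable_funM => //.
  by apply: measurable_funM => //; exact: measurable_funM.
have If : mu.-integrable setT (EFin \o f).
  exact: (integrableB measurableT (int_xsin t c) (integrableZl measurableT t (int_cos t c))).
have E : gmean (fun x => x * sin (t * x - c)) - t * gmean (fun x => cos (t * x - c)) =
    \int[mu]_x f x.
  rewrite /gmean -RintegralZl//.
  rewrite -RintegralB//; exact: (integrableZl measurableT t (int_cos t c)).
apply/eqP; rewrite -subr_eq0 E; apply/eqP.
pose D n := `[- n.+1%:R, n.+1%:R]%classic : set R.
have cphase (x : R) : t * y - c @[y --> x] --> t * x - c.
  by apply: cvgB; [apply: cvgM; [exact: cvg_cst|exact: cvg_id]|exact: cvg_cst].
have csin (x : R) : sin (t * y - c) @[y --> x] --> sin (t * x - c).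
  exact: (cvg_comp _ _ (cphase x) (@continuous_sin R _)).
have ccos (x : R) : cos (t * y - c) @[y --> x] --> cos (t * x - c).
  exact: (cvg_comp _ _ (cphase x) (@continuous_cos R _)).
have cpdf (x : R) : pdf y @[y --> x] --> pdf x.
  exact: continuous_normal_pdf (oner_neq0 R) _.
have cf : continuous f.
  move=> x; apply: cvgB.
    by apply: cvgM; [apply: cvgM; [exact: cvg_id|exact: csin]|exact: cpdf].
  by apply: cvgM; [exact: cvg_cst|apply: cvgM; [exact: ccos|exact: cpdf]].
have cF : continuous F.
  by move=> x; apply: cvgN; apply: cvgM; [exact: cpdf|exact: csin].
have FTC n : (\int[mu]_(x in D n) (f x)%:E = (F n.+1%:R - F (- n.+1%:R))%:E)%E.
  rewrite EFinB; apply: continuous_FTC2.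
  - by rewrite -subr_gt0 opprK addr_gt0.
  - exact: continuous_subspaceT.
  - split.
    + by move=> x _; have [] := dF x.
    + by apply: cvg_at_right_filter; exact: cF.
    + by apply: cvg_at_left_filter; exact: cF.
  - by move=> x _; rewrite derive1E; have [_ ->] := dF x.
have cv1 : (\int[mu]_(x in D n) (f x)%:E)%E @[n --> \oo] --> (\int[mu]_x (f x)%:E)%E.
  have E1 n : (\int[mu]_(x in D n) (f x)%:E = \int[mu]_x ((EFin \o f) \_ (D n)) x)%E.
    by rewrite integral_mkcond.
  rewrite (_ : (fun n => _) = fun n => \int[mu]_x ((EFin \o f) \_ (D n)) x)%E; last exact/funext.
  have mEf : measurable_fun setT (EFin \o f) by exact/measurable_EFinP.
  have [] := @dominated_convergence _ _ R mu setT measurableT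
    (fun n => (EFin \o f) \_ (D n)) (EFin \o f) (abse \o (EFin \o f)) => //.
  - move=> n; apply/(measurable_restrictT (EFin \o f) (measurable_itv _)).
    exact: (measurable_funTS mEf).
  - apply: aeW => x _; apply: cvg_near_cst.
    exists (Num.bound `|x|) => // n /= xn; rewrite patchE ifT// inE /D /=.
    rewrite in_itv /= -ler_norml ltW// (lt_trans (archi_boundP (normr_ge0 x)))//.
    by rewrite ltr_nat ltnS.
  - exact: integrable_abse.
  - apply: aeW => x n _; rewrite patchE; case: ifP => _ //=.
    by rewrite normr0 lee_fin.
have cv2 : (F n.+1%:R - F (- n.+1%:R)) @[n --> \oo] --> (0 : R).
  have b n : `|F n.+1%:R - F (- n.+1%:R)| <= 4 * pdf 0 * n.+1%:R^-1.
    have Fb x : x ^+ 2 = n.+1%:R ^+ 2 -> `|F x| <= 2 * pdf 0 * n.+1%:R^-1.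
      move=> xn; rewrite /F normrN normrM (ger0_norm (pdf_ge0 x)).
      apply: (@le_trans _ _ (pdf x * 1)); first by rewrite ler_wpM2l ?sin_max.
      rewrite mulr1 (normal_pdf01E x) xn.
      have -> : 2 * pdf 0 * n.+1%:R^-1 = pdf 0 * (2 * n.+1%:R^-1) by ring.
      rewrite ler_wpM2l//.
      have n0 : 0 < (n.+1%:R : R) by [].
      rewrite expRN -[leRHS]invrK lef_pV2 ?posrE ?expR_gt0 ?invr_gt0 ?mulr_gt0 ?invr_gt0//.
      have := expR_ge1Dx (n.+1%:R ^+ 2 / 2 : R).
      have := sqr_ge0 (n.+1%:R - 1 : R); rewrite invfM invrK; lra.
    apply: (le_trans (ler_normB _ _)).
    have := Fb n.+1%:R erefl; have := Fb (- n.+1%:R) (sqrrN _); move: (n.+1%:R^-1) `|F _| `|F _| => y u v; lra.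
  apply/cvgr0Pnorm_le => e e0.
  have p1 : 0 < 4 * pdf 0 + 1 by rewrite ltr_wpDl// mulr_ge0.
  have e1 : 0 < e / (4 * pdf 0 + 1) by rewrite divr_gt0.
  have /cvgr0Pnorm_le /(_ _ e1)[N _ NP] := @cvg_harmonic R.
  exists N => // n /NP /=; rewrite ger0_norm ?invr_ge0// ler_pdivlMr// => h.
  apply: (le_trans (b n)); apply: le_trans h.
  by rewrite mulrC ler_wpM2l ?invr_ge0// lerDl.
have cv3 : (\int[mu]_(x in D n) (f x)%:E)%E @[n --> \oo] --> 0%E.
  rewrite (_ : (fun n => _) = fun n => (F n.+1%:R - F (- n.+1%:R))%:E); last exact/funext.
  by apply: cvg_EFin; [exact: nearW|exact: cv2].
have := cvg_unique _ cv1 cv3.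
by rewrite /Rintegral => ->.
Qed.

Lemma cos_taylor1 (a b : R) : `|cos (a + b) - cos a + b * sin a| <= 5 * b ^+ 2.
Proof.
have h1 := sin_taylor1_split 0 b; rewrite !add0r normr0 expr0n mulr0 add0r in h1.
have /andP[h2 h3] := one_sub_cos_le b.
have -> : cos (a + b) - cos a + b * sin a =
    - (cos a * (1 - cos b)) - sin a * (sin b - b) by rewrite cosD; ring.
apply: (le_trans (ler_normB _ _)); rewrite normrN !normrM.
have k1 : `|cos a| * `|1 - cos b| <= 1 * (b ^+ 2 / 2).
  by apply: ler_pM; rewrite ?cos_max// ger0_norm.
have k2 : `|sin a| * `|sin b - b| <= 1 * (4 * b ^+ 2).
  by apply: ler_pM; rewrite ?sin_max.
have := sqr_ge0 b; lra.
Qed.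

(** Formal differentiation gives the mean of - x sin (t x - c), which [gmean_stein] turns into - t
    times the cosine mean; the second moment of the Gaussian controls the Taylor remainder. *)
Lemma is_derive_gmean_cos (t c : R) : is_derive t 1
  (fun s => gmean (fun x => cos (s * x - c))) (- (t * gmean (fun x => cos (t * x - c)))).
Proof.
apply: (@is_derive_quadratic _ _ _ (5 * \int[mu]_x (x ^+ 2 * pdf x))) => s.
rewrite -gmean_stein /gmean mulrN opprK.
have i3 : mu.-integrable setT (EFin \o (fun x => (s - t) * (x * sin (t * x - c) * pdf x))).
  exact: (integrableZl measurableT (s - t) (int_xsin t c)).
have i2 := integrableB measurableT (int_cos s c) (int_cos t c).
have i4 : mu.-integrable setT (EFin \o (fun x => 5 * (s - t) ^+ 2 * (x ^+ 2 * pdf x))).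
  exact: (integrableZl measurableT (5 * (s - t) ^+ 2) int_x2).
rewrite -RintegralZl// -RintegralB// -RintegralD//.
have -> : 5 * (\int[mu]_x (x ^+ 2 * pdf x)) * (s - t) ^+ 2 =
    5 * (s - t) ^+ 2 * (\int[mu]_x (x ^+ 2 * pdf x)) by ring.
rewrite -RintegralZl//.
have i5 := integrableD measurableT i2 i3.
apply: (le_trans (le_normr_Rintegral _ _)) => //.
apply: le_Rintegral => //; first exact: (integrable_abse i5).
move=> x _.
have -> : cos (s * x - c) * pdf x - cos (t * x - c) * pdf x +
    (s - t) * (x * sin (t * x - c) * pdf x) =
  (cos ((t * x - c) + (s - t) * x) - cos (t * x - c) + (s - t) * x * sin (t * x - c)) * pdf x.
  by rewrite (_ : t * x - c + (s - t) * x = s * x - c); ring.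
rewrite normrM (ger0_norm (pdf_ge0 x)) mulrA ler_wpM2r//.
by apply: (le_trans (cos_taylor1 _ _)); rewrite exprMn mulrA.
Qed.

(** The transform solves g' = - t g, so its product with exp (t^2 / 2) is constant. *)
Lemma gmean_cos (t c : R) :
  gmean (fun x => cos (t * x - c)) = expR (- (t ^+ 2 / 2)) * cos c.
Proof.
pose g s := gmean (fun x => cos (s * x - c)) * expR (s ^+ 2 / 2).
have g0 : g 0 = cos c.
  rewrite /g expr0n mul0r expR0 mulr1 /gmean.
  have -> : (fun x => cos (0 * x - c) * pdf x) = fun x => cos c * pdf x.
    by apply/funext => x; rewrite mul0r sub0r cosN.
  rewrite RintegralZl//; last exact: integrable_normal_pdf.
  by rewrite /Rintegral integral_normal_pdf mulr1.
have gc : g t = g 0.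
  apply: is_derive_0_is_cst => x.
  have d1 : is_derive x 1 (fun y : R => y ^+ 2 / 2) x.
    have d2 := is_deriveZ 2^-1 (is_deriveX 2 (is_derive_id x (1 : R))).
    rewrite (_ : (fun y : R => y ^+ 2 / 2) = 2^-1 \*: (id ^+ 2)).
      by apply: (is_derive_eq d2); rewrite /GRing.scale /= expr1 mulr1 mulKf.
    by apply/funext => y; rewrite /= mulrC.
  have d3 := @is_derive1_comp R expR (fun y => y ^+ 2 / 2) x _ _ (is_derive_expR _) d1.
  apply: (is_derive_eq (is_deriveM (is_derive_gmean_cos x c) d3)).
  by rewrite /GRing.scale /=; ring.
rewrite -g0 -gc /g mulrC -mulrA -expRD subrr expR0 mulr1//.
Qed.

(** The Radon-Nikodym derivative of the normal law and the explicit density have the same integral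
    over every measurable set, hence agree almost everywhere. *)
Lemma Ex_normal_prob (f : R -> R) (C : R) : measurable_fun setT f ->
  (forall x, `|f x| <= C) -> Ex (normal_prob 0 1) f = gmean f.
Proof.
move=> mf fC; rewrite /Ex /gmean /Rintegral; congr fine.
have If : rint (normal_prob 0 1) f by exact (@rint_bounded _ (measurableTypeR R) R (normal_prob 0 1) f C mf fC).
have dom := @normal_prob_dominates R 0 1.
rewrite -(Radon_Nikodym_change_of_variables dom)//=.
apply: ae_eq_integral => //.
- apply: emeasurable_funM; first exact/measurable_EFinP.
  apply: (measurable_int mu); exact: Radon_Nikodym_integrable.
- by apply/measurable_EFinP; exact: measurable_funM.
- under [X in ae_eq _ _ _ X]eq_fun do rewrite EFinM.
  apply: ae_eqe_mul2l => /=.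
  rewrite Radon_NikodymE//=.
  case: cid => /= h [h1 h2 h3].
  apply: integral_ae_eq => //=.
  + exact/measurable_EFinP.
  + by move=> E _ mE; rewrite -h3.
Qed.

Lemma Ex_normal_cos (t c : R) :
  Ex (normal_prob 0 1) (fun x => cos (t * x - c)) = expR (- (t ^+ 2 / 2)) * cos c.
Proof.
by rewrite (Ex_normal_prob (C := 1)) ?gmean_cos// => x; exact: cos_max.
Qed.

End gaussian_characteristic.

(** * From cosine transforms to distribution functions *)

Section step_polynomials.
Variable R : realType.
Implicit Types z u : R.

Lemma bernoulli_sub z N : 0 <= z <= 1 -> 1 - N%:R * z <= (1 - z) ^+ N.
Proof.
move=> /andP[z0 z1]; elim: N => [|N IH]; first by rewrite mul0r subr0 expr0.
have h : 0 <= 1 - z by lra.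
have := ler_wpM2l h IH; rewrite -exprS; apply: le_trans.
have N0 : 0 <= (N%:R : R) by [].
rewrite -[N.+1%:R]natr1; have := mulr_ge0 N0 (mulr_ge0 z0 z0); lra.
Qed.

Lemma bernoulli_sub_upper z N : 0 <= z <= 1 -> (1 - z) ^+ N * (1 + N%:R * z) <= 1.
Proof.
move=> /andP[z0 z1]; elim: N => [|N IH]; first by rewrite expr0 mul0r addr0 mul1r.
apply: le_trans IH; rewrite exprS -mulrA mulrCA ler_wpM2l ?exprn_ge0 ?subr_ge0//.
have N0 : 0 <= (N%:R : R) by [].
rewrite -[N.+1%:R]natr1; have := mulr_ge0 N0 (mulr_ge0 z0 z0).
have := mulr_ge0 z0 z0; lra.
Qed.

(* The polynomials [(1 - v ^ n) ^ (k ^ n)] jump from nearly [1] to nearly [0]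
   at [v = 1 / k]; the factor [s] moves the jump to the midpoint of [a, b]. *)
Lemma step_polynomial (a b e : R) : 0 <= a -> a < b -> 0 < e ->
  exists s n N, [/\ 0 < s, s <= 1 &
    forall u, 0 <= u <= 1 -> (u <= a -> 1 - e <= (1 - (s * u) ^+ n) ^+ N) /\
                             (b <= u -> (1 - (s * u) ^+ n) ^+ N <= e)].
Proof.
move=> a0 ab e0; have [m mE] : exists m, m = (a + b) / 2 by exists ((a + b) / 2).
have m0 : 0 < m by lra.
(* An integer with k m >= 1, which makes the scaling s = 1 / (k m) at most 1 and places the jump 1 /
   k at u = m. *)
pose k := (Num.bound m^-1).+1.
have km : 1 <= k%:R * m.
  rewrite -ler_pdivrMr// mul1r ltW// (lt_trans (archi_boundP _))// ?ltr_nat//.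
  by rewrite invr_ge0 ltW.
have k0 : 0 < (k%:R : R) by rewrite ltr0n.
have km0 : 0 < k%:R * m by rewrite mulr_gt0.
have am : 0 <= a / m < 1.
  by rewrite divr_ge0 ?(ltW m0)//= ltr_pdivrMr// mul1r; lra.
have b0 : 0 < b by lra.
have mb : 0 <= m / b < 1.
  by rewrite divr_ge0 ?(ltW m0) ?(ltW b0)//= ltr_pdivrMr// mul1r; lra.
have [N1 N1P] := exprn_cvgn_small am e0.
have [N2 N2P] := exprn_cvgn_small mb e0.
pose n := maxn N1 N2.
have h1 := N1P n (leq_maxl _ _); have h2 := N2P n (leq_maxr _ _).
exists (k%:R * m)^-1, n, (k ^ n)%N; split.
- by rewrite invr_gt0.
- by rewrite invf_le1.
move=> u /andP[u0 u1]; set z := ((k%:R * m)^-1 * u) ^+ n.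
have z01 : 0 <= z <= 1.
  have su : 0 <= (k%:R * m)^-1 * u by rewrite mulr_ge0// invr_ge0 ltW.
  rewrite exprn_ge0//= exprn_ile1// mulr_ile1// ?invr_ge0 ?(ltW km0)//.
  by rewrite invf_le1.
(* The product of exponent and base is a pure power: it is small for u <= a and large for u >= b,
   and the two Bernoulli bounds convert this into values near 1 and near 0. *)
have Nz : (k ^ n)%:R * z = (u / m) ^+ n.
  by rewrite /z natrX -exprMn; congr (_ ^+ _); field; rewrite !gt_eqF.
split=> [ua|bu].
- apply: le_trans (bernoulli_sub _ z01); rewrite Nz lerD2l lerN2.
  apply: le_trans h1; apply: lerXn2r; rewrite ?nnegrE ?divr_ge0 ?(ltW m0)//.
  by rewrite ler_pM2r ?invr_gt0.
- have u_gt0 : 0 < u by exact: lt_le_trans bu.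
  have um : 0 < (u / m) ^+ n by rewrite exprn_gt0// divr_gt0.
  apply: (@le_trans _ _ ((m / u) ^+ n)); last first.
    apply: le_trans h2; apply: lerXn2r; rewrite ?nnegrE ?divr_ge0 ?(ltW m0) ?(ltW u_gt0) ?(ltW b0)//.
    by rewrite ler_pM2l// lef_pV2 ?posrE.
  have -> : (m / u) ^+ n = ((u / m) ^+ n)^-1 by rewrite -exprVn invf_div.
  rewrite -[leRHS]mul1r ler_pdivlMr//.
  apply: le_trans (bernoulli_sub_upper (k ^ n) z01); rewrite Nz.
  rewrite ler_wpM2l ?lerDr// exprn_ge0// subr_ge0.
  by case/andP: z01.
Qed.

End step_polynomials.

Section levy.
Context {d : measure_display} {T : measurableType d} {R : realType}
  (P : probability T R) (Q : probability (measurableTypeR R) R).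
Variable Y : nat -> T -> R.
Hypothesis mY : forall n, measurable_fun setT (Y n).
Hypothesis cosY : forall t c : R, 0 <= t ->
  Ex P (fun w => cos (t * Y n w - c)) @[n --> \oo] --> Ex Q (fun x => cos (t * x - c)).

(** Convergence is demanded after multiplication by every cosine: this form, unlike plain
    convergence of expectations, passes to products with a further cosine. *)
Definition test_fun (f : R -> R) := [/\ measurable_fun setT f,
  exists C, forall x, `|f x| <= C & forall t c : R, 0 <= t ->
  Ex P (fun w => f (Y n w) * cos (t * Y n w - c)) @[n --> \oo] -->
  Ex Q (fun x => f x * cos (t * x - c))].

Let mcosp (t c : R) : measurable_fun setT (fun x : R => cos (t * x - c)).
Proof.
apply: (measurableT_comp (@measurable_cos R)).
by apply: measurable_funB => //; exact: measurable_funM.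
Qed.

Let rintP (f : R -> R) (C : R) n : measurable_fun setT f -> (forall x, `|f x| <= C) ->
  rint P (fun w => f (Y n w)).
Proof.
move=> mf fC; apply: (@rint_bounded _ _ _ P _ C) => // w.
exact: (measurableT_comp mf (mY n)).
Qed.

Let rintQ (f : R -> R) (C : R) : measurable_fun setT f -> (forall x, `|f x| <= C) ->
  rint Q f.
Proof. by move=> mf fC; exact: (@rint_bounded _ (measurableTypeR R) R Q f C mf fC). Qed.

Let bcos (f : R -> R) (C t c : R) : (forall x, `|f x| <= C) ->
  forall x, `|f x * cos (t * x - c)| <= C.
Proof.
by move=> fC x; rewrite normrM (le_trans _ (fC x))// ler_piMr// cos_max.
Qed.

Let mfcos (f : R -> R) (t c : R) : measurable_fun setT f ->
  measurable_fun setT (fun x => f x * cos (t * x - c)).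
Proof. by move=> mf; exact: measurable_funM. Qed.

Lemma test_fun1 : test_fun (fun=> 1).
Proof.
split=> //; first by exists 1 => x; rewrite normr1.
move=> t c t0; have := @cosY t c t0.
rewrite (_ : (fun x => 1 * cos (t * x - c)) = fun x => cos (t * x - c)).
  rewrite (_ : (fun n => Ex P (fun w => 1 * _)) = fun n => Ex P (fun w => cos (t * Y n w - c)))//.
  by apply/funext => n; congr Ex; apply/funext => w; rewrite mul1r.
by apply/funext => x; rewrite mul1r.
Qed.

Lemma test_fun_lin a b f g : test_fun f -> test_fun g ->
  test_fun (fun x => a * f x + b * g x).
Proof.
move=> [mf [C fC] cf] [mg [D gD] cg]; split.
- by apply: measurable_funD; exact: measurable_funM.
- exists (`|a| * C + `|b| * D) => x; apply: (le_trans (ler_normD _ _)).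
  by rewrite !normrM lerD// ler_wpM2l.
move=> t c t0.
have EP n : Ex P (fun w => (a * f (Y n w) + b * g (Y n w)) * cos (t * Y n w - c)) =
    a * Ex P (fun w => f (Y n w) * cos (t * Y n w - c)) +
    b * Ex P (fun w => g (Y n w) * cos (t * Y n w - c)).
  have i1 := rintP n (mfcos t c mf) (bcos t c fC).
  have i2 := rintP n (mfcos t c mg) (bcos t c gD).
  rewrite -(ExZ a i1) -(ExZ b i2) -(ExD (rintZ a i1) (rintZ b i2)).
  by congr Ex; apply/funext => w; ring.
have EQ : Ex Q (fun x => (a * f x + b * g x) * cos (t * x - c)) =
    a * Ex Q (fun x => f x * cos (t * x - c)) + b * Ex Q (fun x => g x * cos (t * x - c)).
  have i1 := rintQ (mfcos t c mf) (bcos t c fC).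
  have i2 := rintQ (mfcos t c mg) (bcos t c gD).
  rewrite -(ExZ a i1) -(ExZ b i2) -(ExD (rintZ a i1) (rintZ b i2)).
  by congr Ex; apply/funext => w; ring.
rewrite EQ; under eq_cvg do rewrite EP.
by apply: cvgD; apply: cvgM; [exact: cvg_cst|exact: cf|exact: cvg_cst|exact: cg].
Qed.

Lemma test_fun_cos f om c' : test_fun f -> 0 <= om ->
  test_fun (fun x => f x * cos (om * x - c')).
Proof.
move=> [mf [C fC] cf] om0; split.
- exact: mfcos.
- by exists C; exact: bcos.
move=> t c t0.
(* The hypothesis concerns nonnegative frequencies only; a negative difference is reflected by the
   evenness of cosine, which also flips the phase. *)
have [s [c2 [s0 sE]]] : exists s c2 : R, 0 <= s /\
    forall x : R, cos ((om - t) * x - (c' - c)) = cos (s * x - c2).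
  have [tom|omt] := lerP t om.
    by exists (om - t), (c' - c); split; rewrite ?subr_ge0.
  exists (t - om), (c - c'); split; first by rewrite subr_ge0 ltW.
  by move=> x; rewrite -cosN; congr cos; ring.
have prod x : f x * cos (om * x - c') * cos (t * x - c) =
    2^-1 * (f x * cos ((om + t) * x - (c' + c))) + 2^-1 * (f x * cos (s * x - c2)).
  rewrite -sE.
  have -> : (om + t) * x - (c' + c) = (om * x - c') + (t * x - c) by ring.
  have -> : (om - t) * x - (c' - c) = (om * x - c') - (t * x - c) by ring.
  move: (om * x - c') (t * x - c) => A B.
  by rewrite cosD cosB; field.
have p0 : 0 <= om + t by rewrite addr_ge0.
have EP n : Ex P (fun w => f (Y n w) * cos (om * Y n w - c') * cos (t * Y n w - c)) =
    2^-1 * Ex P (fun w => f (Y n w) * cos ((om + t) * Y n w - (c' + c))) +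
    2^-1 * Ex P (fun w => f (Y n w) * cos (s * Y n w - c2)).
  have i1 := rintP n (mfcos (om + t) (c' + c) mf) (bcos (om + t) (c' + c) fC).
  have i2 := rintP n (mfcos s c2 mf) (bcos s c2 fC).
  rewrite -(ExZ _ i1) -(ExZ _ i2) -(ExD (rintZ _ i1) (rintZ _ i2)).
  by congr Ex; apply/funext => w; exact: prod.
have EQ : Ex Q (fun x => f x * cos (om * x - c') * cos (t * x - c)) =
    2^-1 * Ex Q (fun x => f x * cos ((om + t) * x - (c' + c))) +
    2^-1 * Ex Q (fun x => f x * cos (s * x - c2)).
  have i1 := rintQ (mfcos (om + t) (c' + c) mf) (bcos (om + t) (c' + c) fC).
  have i2 := rintQ (mfcos s c2 mf) (bcos s c2 fC).
  rewrite -(ExZ _ i1) -(ExZ _ i2) -(ExD (rintZ _ i1) (rintZ _ i2)).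
  by congr Ex; apply/funext => x; exact: prod.
rewrite EQ; under eq_cvg do rewrite EP.
by apply: cvgD; apply: cvgM; [exact: cvg_cst|exact: cf|exact: cvg_cst|exact: cf].
Qed.

Lemma test_fun_step (A B om c : R) n N : 0 <= om ->
  test_fun (fun x => (1 - (A + B * cos (om * x - c)) ^+ n) ^+ N).
Proof.
move=> om0; pose v x := A + B * cos (om * x - c).
have mulv f : test_fun f -> test_fun (fun x => f x * v x).
  move=> tf; have := test_fun_lin A B tf (test_fun_cos c tf om0).
  rewrite (_ : (fun x => A * f x + _) = fun x => f x * v x)//.
  by apply/funext => x; rewrite /v; ring.
have mulvn f m : test_fun f -> test_fun (fun x => f x * v x ^+ m).
  move=> tf; elim: m => [|m IH].
    by rewrite (_ : (fun x => _) = f)//; apply/funext => x; rewrite expr0 mulr1.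
  rewrite (_ : (fun x => _) = fun x => f x * v x ^+ m * v x); first exact: mulv.
  by apply/funext => x; rewrite exprSr mulrA.
elim: N => [|N IH].
  rewrite (_ : (fun x => _) = fun=> 1); first exact: test_fun1.
  by apply/funext => x; rewrite expr0.
have := test_fun_lin 1 (- 1) IH (mulvn _ n IH).
rewrite (_ : (fun x => 1 * _ + _) = fun x => (1 - v x ^+ n) ^+ N.+1)//.
by apply/funext => x; rewrite exprSr -/(v x); ring.
Qed.

Lemma test_fun_cvg f : test_fun f ->
  Ex P (fun w => f (Y n w)) @[n --> \oo] --> Ex Q f.
Proof.
move=> [_ _ /(_ 0 0 (lexx _))].
have E x : f x * cos (0 * x - 0) = f x by rewrite mul0r subr0 cos0 mulr1.
rewrite (_ : (fun x => f x * cos (0 * x - 0)) = f); last exact/funext.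
rewrite (_ : (fun n => Ex P (fun w => f (Y n w) * _)) = fun n => Ex P (fun w => f (Y n w)))//.
by apply/funext => n; congr Ex; apply/funext => w.
Qed.

Lemma test_fun_separating (K a b e : R) : - K <= a -> a < b -> b <= K -> 0 < e ->
  exists q, [/\ test_fun q, forall x, 0 <= q x <= 1 &
    forall x, `|x| <= K -> (x <= a -> 1 - e <= q x) /\ (b <= x -> q x <= e)].
Proof.
move=> Ka ab bK e0; have K0 : 0 < K by lra.
(* The phase om (x + K) runs from 0 to pi over [-K, K], where cosine is strictly decreasing. *)
pose om : R := pi / (2 * K).
have om0 : 0 < om by rewrite divr_gt0 ?pi_gt0// mulr_gt0.
pose th x : R := om * x - (- (om * K)).
have thE x : th x = om * (x + K) by rewrite /th; ring.
have th_itv x : - K <= x <= K -> th x \in `[0, pi].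
  move=> /andP[x1 x2]; rewrite in_itv /= thE mulr_ge0 ?(ltW om0)//=; last by lra.
  apply: (@le_trans _ _ (om * (2 * K))); first by rewrite ler_wpM2l ?(ltW om0)//; lra.
  by rewrite /om divfK// gt_eqF// mulr_gt0.
pose u x : R := (1 - cos (th x)) / 2.
have u01 x : 0 <= u x <= 1.
  by have := cos_geN1 (th x); have := cos_le1 (th x); rewrite /u; lra.
have umono x y : - K <= x -> x <= y -> y <= K -> u x <= u y.
  move=> Kx xy yK; have [->//|nxy] := eqVneq x y.
  have xly : x < y by rewrite lt_neqAle nxy.
  have := @ltr_cos R (th x) (th y) (th_itv x _) (th_itv y _).
  rewrite !thE ltr_pM2l// ltrD2r xly => /(_ _ _)H.
  have : cos (om * (y + K)) < cos (om * (x + K)) by apply: H; lra.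
  by rewrite /u !thE; lra.
have uab : u a < u b.
  have := @ltr_cos R (th a) (th b) (th_itv a _) (th_itv b _).
  rewrite !thE ltr_pM2l// ltrD2r ab => /(_ _ _)H.
  have : cos (om * (b + K)) < cos (om * (a + K)) by apply: H; lra.
  by rewrite /u !thE; lra.
have [ua0 _] := andP (u01 a).
have [s [n [N [s0 s1 H]]]] := step_polynomial ua0 uab e0.
pose q x := (1 - (s / 2 + (- (s / 2)) * cos (om * x - (- (om * K)))) ^+ n) ^+ N.
have qE x : q x = (1 - (s * u x) ^+ n) ^+ N.
  by rewrite /q /u -/(th x); congr ((1 - _ ^+ _) ^+ _); field.
exists q; split.
- exact: test_fun_step (ltW om0).
- move=> x; rewrite qE; have /andP[h0 h1] := u01 x.
  have su0 : 0 <= s * u x by rewrite mulr_ge0// ltW.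
  have su1 : s * u x <= 1 by rewrite mulr_ile1// ltW.
  have h2 : 0 <= (s * u x) ^+ n <= 1 by rewrite exprn_ge0// exprn_ile1.
  have h3 : 0 <= 1 - (s * u x) ^+ n <= 1 by lra.
  by case/andP: h3 => h3 h4; rewrite exprn_ge0// exprn_ile1.
- move=> x; rewrite ler_norml => /andP[Kx xK]; rewrite qE.
  have [H1 H2] := H (u x) (u01 x); split => hx.
    by apply: H1; apply: umono => //; lra.
  by apply: H2; apply: umono => //; lra.
Qed.

End levy.

Section half_line_indicator.
Context {d : measure_display} {T : measurableType d} {R : realType}
  (P : probability T R).

Definition half_line (r y : R) : R := if y <= r then 1 else 0.

Lemma half_line01 r y : 0 <= half_line r y <= 1.
Proof. by rewrite /half_line; case: ifP; rewrite ?lexx ?ler01. Qed.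

Lemma measurable_half_line r : measurable_fun setT (half_line r).
Proof. by apply: measurable_fun_ifT => //; apply: measurable_fun_ler. Qed.

Lemma Ex_half_line (f : T -> R) r : measurable_fun setT f ->
  P (f @^-1` `]-oo, r]) = (Ex P (fun w => half_line r (f w)))%:E.
Proof.
move=> mf; have mA : measurable (f @^-1` `]-oo, r]).
  by rewrite -[X in measurable X]setTI; exact: mf.
rewrite -(expectation_indic P mA) -EFin_Ex.
  congr (Ex P _)%:E; apply/funext => w; rewrite indicE /half_line.
  by case: ifP => h; [rewrite mem_set//= in_itv /= h|rewrite memNset//= in_itv /= h].
apply: (@rint_bounded _ _ _ P _ 1); first exact: measurable_indic.
by move=> w; rewrite indicE; case: (_ \in _); rewrite ?normr1 ?normr0 ?ler01.
Qed.

End half_line_indicator.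

Section levy_cdf.
Context {d : measure_display} {T : measurableType d} {R : realType}
  (P : probability T R) (Q : probability (measurableTypeR R) R).
Variable Y : nat -> T -> R.
Hypothesis sY : forall n, sqint P (Y n).
Hypothesis EY2 : forall n, Ex P (fun w => Y n w ^+ 2) <= 1.
Hypothesis cosY : forall t c : R, 0 <= t ->
  Ex P (fun w => cos (t * Y n w - c)) @[n --> \oo] --> Ex Q (fun x => cos (t * x - c)).

Let F r := Ex Q (half_line r).

Let outside (K y : R) : R := if `|y| <= K then 0 else 1.

Let outside01 K y : `|outside K y| <= 1.
Proof. by rewrite /outside; case: ifP; rewrite ?normr0 ?normr1 ?ler01. Qed.

Let moutside K : measurable_fun setT (outside K).
Proof. by apply: measurable_fun_ifT => //; apply: measurable_fun_ler. Qed.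

Let rQ (f : R -> R) (C : R) : measurable_fun setT f -> (forall x, `|f x| <= C) ->
  rint Q f.
Proof. by move=> mf fC; exact: (@rint_bounded _ (measurableTypeR R) R Q f C mf fC). Qed.

Let rP (f : R -> R) (C : R) n : measurable_fun setT f -> (forall x, `|f x| <= C) ->
  rint P (fun w => f (Y n w)).
Proof.
move=> mf fC; apply: (@rint_bounded _ _ _ P _ C) => // w.
exact: (measurableT_comp mf (proj1 (sY n))).
Qed.

Lemma outside_small_limit (e : R) : 0 < e ->
  exists N, forall n, (N <= n)%N -> Ex Q (outside n%:R) <= e.
Proof.
move=> e0.
have mo n : measurable_fun [set: measurableTypeR R] (outside n%:R) by exact: moutside.
have cv (x : measurableTypeR R) : outside n%:R x @[n --> \oo] --> (fun=> 0 : R) x.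
  apply: cvg_near_cst; exists (Num.bound `|x|) => // n /= xn.
  rewrite /outside ifT// ltW// (lt_le_trans (archi_boundP (normr_ge0 x)))//.
  by rewrite ler_nat.
have := Ex_dominated_cvg mo (rint_cst Q 1) (fun n x => outside01 n%:R x) cv.
rewrite Ex_cst => /cvgr0Pnorm_le /(_ e e0)[N _ NP].
by exists N => n /NP; apply: le_trans; exact: ler_norm.
Qed.

Lemma outside_small K n : 0 < K -> Ex P (fun w => outside K (Y n w)) <= K ^- 2.
Proof.
move=> K0; have K2 : 0 < K ^+ 2 by rewrite exprn_gt0.
apply: (@le_trans _ _ (K ^- 2 * Ex P (fun w => Y n w ^+ 2))); last first.
  by rewrite ler_piMr// invr_ge0 ltW.
rewrite -(ExZ _ (proj2 (sY n))); apply: Ex_le.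
- exact: rP (moutside K) (outside01 K).
- exact: rintZ (proj2 (sY n)).
move=> w; rewrite /outside; case: ifPn => [_|]; first by rewrite mulr_ge0 ?sqr_ge0 ?invr_ge0 ?ltW.
rewrite -ltNge => h; rewrite mulrC ler_pdivlMr// mul1r.
by rewrite -[leRHS](real_normK (num_real _)) lerXn2r ?nnegrE ?(ltW K0) ?(ltW h).
Qed.

Lemma cdf_cvg_real x :
  (forall e : R, 0 < e -> exists2 dl : R, 0 < dl &
     F (x + dl) <= F x + e /\ F x - e <= F (x - dl)) ->
  Ex P (fun w => half_line x (Y n w)) @[n --> \oo] --> F x.
Proof.
move=> Fx; apply/cvgrPdist_le => e' e0'.
(* Each side of the estimate spends 2e on each of two comparisons, e on the convergence for the test
   function and e on the continuity of the limit. *)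
pose e := e' / 6; have e0 : 0 < e by rewrite divr_gt0.
have [dl dl0 [Fp Fm]] := Fx e e0.
have [N NP] := outside_small_limit e0.
pose M := maxn N.+1 (maxn (Num.bound (`|x| + dl)) (Num.bound e^-1)).
pose K : R := M%:R.
have K0 : 0 < K by rewrite ltr0n !leq_max.
have QK : Ex Q (outside K) <= e by apply: NP; rewrite !leq_max leqnSn.
have K1 : 1 <= K by rewrite ler1n !leq_max.
have PK n : Ex P (fun w => outside K (Y n w)) <= e.
  apply: (le_trans (outside_small n K0)).
  have eK : e^-1 <= K.
    apply: ltW; apply: (lt_le_trans (archi_boundP _)); first by rewrite invr_ge0 ltW.
    by rewrite ler_nat !leq_max leqnn !orbT.
  rewrite -[leRHS]invrK lef_pV2 ?posrE ?exprn_gt0 ?invr_gt0//.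
  by apply: (le_trans eK); rewrite expr2 ler_peMr// ltW.
have xK : `|x| + dl <= K.
  apply: ltW; apply: (lt_le_trans (archi_boundP _)).
    by rewrite addr_ge0// ltW.
  by rewrite ler_nat !leq_max leqnn !orbT.
have [xK1 xK2] : - K <= x - dl /\ x + dl <= K.
  by have := ler_norm x; have := ler_norm (- x); rewrite normrN; split; lra.
(* Comparison on [-K, K] up to [e] costs another [e] outside, where both functions lie in [0, 1] and
   each law has mass at most [e]. *)
have sandwich (f g : R -> R) : measurable_fun setT f -> (forall y, 0 <= f y <= 1) ->
   measurable_fun setT g -> (forall y, 0 <= g y <= 1) ->
   (forall y, `|y| <= K -> f y <= g y + e) ->
   Ex Q f <= Ex Q g + e + e /\
   forall n, Ex P (fun w => f (Y n w)) <= Ex P (fun w => g (Y n w)) + e + e.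
  move=> mf f01 mg g01 fg.
  have n1 (h : R -> R) : (forall y, 0 <= h y <= 1) -> forall y, `|h y| <= 1.
    by move=> h01 y; case/andP: (h01 y) => h0 h1; rewrite ger0_norm.
  have fgo y : f y <= g y + e + outside K y.
    rewrite /outside; case: ifPn => [/fg|_]; first by rewrite addr0.
    by case/andP: (f01 y) => _ h1; case/andP: (g01 y) => h2 _; lra.
  split.
    have i1 := rQ mf (n1 f f01); have i2 := rQ mg (n1 g g01).
    have i3 := rQ (moutside K) (outside01 K).
    have i4 := rintD i2 (rint_cst Q e).
    have := Ex_le i1 (rintD i4 i3) fgo.
    rewrite (ExD i4 i3) (ExD i2 (rint_cst Q e)) Ex_cst; lra.
  move=> n.
  have i1 := rP n mf (n1 f f01); have i2 := rP n mg (n1 g g01).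
  have i3 := rP n (moutside K) (outside01 K).
  have i4 := rintD i2 (rint_cst P e).
  have := Ex_le i1 (rintD i4 i3) (fun w => fgo (Y n w)).
  rewrite (ExD i4 i3) (ExD i2 (rint_cst P e)) Ex_cst; have := PK n; lra.
have mY n : measurable_fun setT (Y n) by exact: (proj1 (sY n)).
have xdl : x < x + dl by rewrite ltrDl.
have dlx : x - dl < x by rewrite gtrBl.
have [q1 [tq1 q101 Hq1]] := test_fun_separating mY cosY
  (le_trans xK1 (ltW dlx)) xdl xK2 e0.
have [q2 [tq2 q201 Hq2]] := test_fun_separating mY cosY
  xK1 dlx (le_trans (ltW xdl) xK2) e0.
have mq1 : measurable_fun setT q1 by case: tq1.
have mq2 : measurable_fun setT q2 by case: tq2.
have hl01 := half_line01 (R := R); have mhl := measurable_half_line (R := R).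
have [_ U1] := sandwich (half_line x) q1 (mhl x) (hl01 x) mq1 q101
  ltac:(move=> y yK; have [+ _] := Hq1 y yK; rewrite /half_line;
    case: ifP => [_ /(_ isT)|_ _]; [lra|by case/andP: (q101 y); lra]).
have [U2 _] := sandwich q1 (half_line (x + dl)) mq1 q101 (mhl _) (hl01 _)
  ltac:(move=> y yK; have [_ +] := Hq1 y yK; rewrite /half_line;
    case: ifPn => [_ _|]; [by case/andP: (q101 y); lra|rewrite -ltNge => /ltW -> /(_ isT); lra]).
have [_ L1] := sandwich q2 (half_line x) mq2 q201 (mhl _) (hl01 _)
  ltac:(move=> y yK; have [_ +] := Hq2 y yK; rewrite /half_line;
    case: ifPn => [_ _|]; [by case/andP: (q201 y); lra|rewrite -ltNge => /ltW -> /(_ isT); lra]).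
have [L2 _] := sandwich (half_line (x - dl)) q2 (mhl _) (hl01 _) mq2 q201
  ltac:(move=> y yK; have [+ _] := Hq2 y yK; rewrite /half_line;
    case: ifP => [_ /(_ isT)|_ _]; [lra|by case/andP: (q201 y); lra]).
have /cvgrPdist_le /(_ e e0)[N1 _ N1P] := test_fun_cvg tq1.
have /cvgrPdist_le /(_ e e0)[N2 _ N2P] := test_fun_cvg tq2.
exists (maxn N1 N2) => // n /=; rewrite geq_max => /andP[/N1P /= c1 /N2P /= c2].
have := U1 n; have := L1 n; have e6 : e' = 6 * e by rewrite /e; field.
move: c1 c2; rewrite !ler_norml => /andP[? ?] /andP[? ?] u1 l1.
rewrite -/(F (x + dl)) in U2; rewrite -/(F (x - dl)) in L2.
by apply/andP; split; lra.
Qed.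

End levy_cdf.

(** * Normalised partial sums and the central limit theorem *)

Section partial_sums.
Context {d : measure_display} {T : measurableType d} {R : realType}
  (P : probability T R) (X : int -> {RV P >-> R}).

Lemma partial_sum_bsum n w : partial_sum X n w = bsum X id 0 n w.
Proof.
rewrite /partial_sum; elim: n => [|n IH]; first by rewrite big_geq// bsum0.
rewrite big_nat_recr//= -[in RHS]addn1 bsum_add -IH; congr (_ + _).
by rewrite /bsum big_ord1 add0r -PoszD addn1.
Qed.

Lemma sigma_bsum n : strictly_stationary X -> sqint P (X 0) -> Ex P (X 0) = 0 ->
  sigma X n = Num.sqrt (mom2 X id n).
Proof.
move=> statX sqX EX0.
have mid : measurable_fun setT (@id R) by exact: measurable_id.
have E : (partial_sum X n : T -> R) = bsum X id 0 n.
  by apply/funext => w; exact: partial_sum_bsum.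
have sS : sqint P (bsum X id 0 n).
  by apply: sqint_bsum => t; exact: (sqint_stationary t statX mid sqX).
rewrite /sigma E (variance_Ex sS) (Ex_bsum statX mid sqX EX0).
by rewrite expr0n subr0.
Qed.

End partial_sums.

Theorem corollary2p6 (d : measure_display) (T : measurableType d)
    (R : realType) (P : probability T R) (X : int -> {RV P >-> R})
    (alpha beta : R)
    (X_stationary : strictly_stationary X)
    (EX0 : ('E_P[X 0%R] = 0)%E)
    (EX0_2 : ('E_P[fun w => (X 0 w ^+ 2)%R] < +oo)%E)
    (sigma_infty : sigma X n @[n --> \oo] --> +oo)
    (rho_0 : rho X n @[n --> \oo] --> 0%E)
    (alpha_gt0 : 0 < alpha) (beta_lt1 : beta < 1)
    (cond_ab :
      (('E_P[fun w => (X 0 w ^+ 2 *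
            log2p (log2p `|X 0 w|) `^ (2 * alpha))%R] < +oo)%E /\
       \forall n \near \oo, (rho X n <=
         (alpha * (log2 n%:R)^-1 * (log2 (log2 n%:R))^-1)%:E)%E)
      \/
      (('E_P[fun w => (X 0 w ^+ 2 *
            expR (2 * alpha * log2p (log2p `|X 0 w|) `^ (1 - beta)
                  / (1 - beta)))%R] < +oo)%E /\
       \forall n \near \oo, (rho X n <=
         (alpha * (log2 n%:R)^-1 * log2 (log2 n%:R) `^ (- beta))%:E)%E)) :
  cvg_in_distribution P (fun n => (sigma X n)^-1 *: partial_sum X n)
    (normal_prob 0 1).
Proof.
have mX : measurable_fun setT (X 0 : T -> R) by exact: measurable_funPT.
have sqX : sqint P (X 0).
  split=> //; apply: rint_lty => //; first exact: measurable_funX.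
  by move=> w; exact: sqr_ge0.
have EX : Ex P (X 0) = 0.
  by apply: EFin_inj; rewrite (EFin_Ex (sqint_rint sqX)).
have mid : measurable_fun setT (@id R) by exact: measurable_id.
have sS n : sqint P (bsum X id 0 n).
  by apply: sqint_bsum => t; exact: (sqint_stationary t X_stationary mid sqX).
have sE n := sigma_bsum n X_stationary sqX EX.
have vy (A : R) : exists N, forall i, (N <= i)%N -> A <= mom2 X id (2 ^ i).
  have /cvgryPge /(_ (`|A| + 1))[N _ NP] := sigma_infty.
  exists N => i Ni.
  have /NP /= : (N <= 2 ^ i)%N by rewrite (leq_trans Ni)// ltnW// ltn_expl.
  rewrite sE => h; have v0 := mom2_ge0 X id (2 ^ i).
  rewrite -(sqr_sqrtr v0); apply: (le_trans (ler_norm A)).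
  have := normr_ge0 A; set s := Num.sqrt _ in h *; nra.
have tailX := tail_condition mX rho_0 alpha_gt0 beta_lt1 cond_ab.
pose Y n w := (sigma X n)^-1 * bsum X id 0 n w.
have sY n : sqint P (Y n) by exact: sqintZ.
have YE n : ((sigma X n)^-1 *: partial_sum X n : T -> R) = Y n.
  by apply/funext => w; rewrite -[LHS]/((sigma X n)^-1 * partial_sum X n w) partial_sum_bsum.
have EY2 n : Ex P (fun w => Y n w ^+ 2) <= 1.
  have -> : (fun w => Y n w ^+ 2) = fun w => (sigma X n)^-1 ^+ 2 * bsum X id 0 n w ^+ 2.
    by apply/funext => w; rewrite exprMn.
  rewrite (ExZ _ (proj2 (sS n))) -[Ex P _]/(mom2 X id n) sE exprVn.
  (* For the finitely many [n] with sigma_n = 0 the inverse is 0 by convention and Y_n vanishes;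
     hence the bound is an inequality. *)
  rewrite sqr_sqrtr ?mom2_ge0//; have [->|v0] := eqVneq (mom2 X id n) 0.
    by rewrite mulr0.
  by rewrite mulVf.
have cosY (t c : R) : 0 <= t -> Ex P (fun w => cos (t * Y n w - c)) @[n --> \oo] -->
    Ex (normal_prob 0 1) (fun x => cos (t * x - c)).
  move=> t0; rewrite Ex_normal_cos; apply/cvgrPdist_le => e e0.
  have [N NP] := cos_clt X_stationary rho_0 sqX EX vy tailX c t0 e0.
  exists N => // n /= /NP; rewrite distrC.
  rewrite (_ : (fun w => cos (t * Y n w - c)) = fun w =>
    cos (t / Num.sqrt (mom2 X id n) * bsum X id 0 n w - c))//.
  by apply/funext => w; rewrite /Y sE mulrA.
move=> x cx.
have FE (mu : probability (measurableTypeR R) R) (r : R) :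
    mu `]-oo, r]%classic = (Ex mu (half_line r))%:E.
  have mi : measurable_fun [set: measurableTypeR R] (@id R) by exact: measurable_id.
  by rewrite -(Ex_half_line mu r mi) preimage_id.
have cdfE n : cdf ((sigma X n)^-1 *: partial_sum X n : {RV P >-> R}) x =
    (Ex P (fun w => half_line x (Y n w)))%:E.
  rewrite -(Ex_half_line P x (proj1 (sY n))) -YE.
  by [].
rewrite (FE (normal_prob 0 1)); under eq_cvg do rewrite cdfE.
apply: cvg_EFin; first exact: nearW.
apply: (cdf_cvg_real sY EY2 cosY) => e e0.
have cF : Ex (normal_prob 0 1) (half_line r) @[r --> x] --> Ex (normal_prob 0 1) (half_line x).
  have FEc : (fun r : R => normal_prob 0 1 `]-oo, r]%classic) =
      fun r => (Ex (normal_prob 0 1) (half_line r))%:E.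
    by apply/funext => r; exact: (FE (normal_prob 0 1)).
  by move: cx; rewrite FEc => /fine_cvg.
have /cvgrPdist_le /(_ e e0) /nbhs_ballP[dl /= dl0 H] := cF.
have dl2 : 0 < dl / 2 by rewrite divr_gt0.
exists (dl / 2) => //.
have near_x y : `|x - y| = dl / 2 ->
    `|Ex (normal_prob 0 1) (half_line x) - Ex (normal_prob 0 1) (half_line y)| <= e.
  by move=> xy; apply: H; rewrite /ball /= xy ltr_pdivrMr// ltr_pMr// ltr1n.
have sandwich (a b c : R) : `|a - b| <= e -> `|a - c| <= e -> b <= a + e /\ a - e <= c.
  by clear; rewrite !ler_norml => /andP[? ?] /andP[? ?]; split; lra.
apply: sandwich; apply: near_x.
  by rewrite opprD addrA subrr add0r normrN gtr0_norm.
by rewrite opprB addrC subrK gtr0_norm.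
Qed.
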